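(* The space $\mathcal{R}^N_T$ does not depend on $T>0$ and, writing $\mathcal{R}^N$ for it, $$\mathcal{R}^N=\{f\in hol(Q_\infty): f'\in\mathcal{R}\},$$ where the equality is understood through restriction to $(0,1)$: a function $g$ on $(0,1)$ belongs to $\mathcal{R}^N$ if and only if $g=f|_{(0,1)}$ for some $f\in hol(Q_\infty)$ with $f'\in\mathcal{R}$.
   Context: Identify $\mathbb{R}^2$ with $\mathbb{C}$. Let $Q=\{x+iy: |y|<x,\ |y|<1-x\}$ and $Q_\infty=\bigcup_{n\in\mathbb{Z}}(n+Q)$; $hol(Q_\infty)$ is the set of analytic functions on $Q_\infty$. $L^2_{\mathbb{C}}(0,T)$ is the space of complex-valued square integrable functions on $(0,T)$. Neumann system: $\partial_tv-\partial_{xx}v=0$ for $0<x<1$, $0<t<T$; $(\partial_xv)(0,t)=u_\ell(t)$, $(\partial_xv)(1,t)=u_r(t)$ for $0<t<T$; $v(x,0)=0$ for $0<x<1$. $\mathcal{R}^N_T$ is the set of all $v(\cdot,T)$ where $v\in C([0,T];L^2_{\mathbb{C}}(0,1))$ is the solution of this system with $u_\ell,u_r\in L^2_{\mathbb{C}}(0,T)$. Dirichlet system and $\mathcal{R}$: let $K(x,t)=\frac{1}{\sqrt{4\pi t}}e^{-x^2/(4t)}$ for $t>0$, $\theta(x,t)=\sum_{n\in\mathbb{Z}}K(x+2n,t)$; for $z\in\mathbb{C}$, $(\partial_xK)(z,t)=-\frac{z}{4\sqrt{\pi}\,t^{3/2}}e^{-z^2/(4t)}$ and $(\partial_x\theta)(z,t)=\sum_{n\in\mathbb{Z}}(\partial_xK)(z+2n,t)$.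 Consider $\partial_tw-\partial_{xx}w=0$ for $0<x<1$, $0<t<T$; $w(0,t)=u_\ell(t)$, $w(1,t)=u_r(t)$ for $0<t<T$; $w(x,0)=0$ for $0<x<1$. For $u_\ell,u_r\in L^2_{\mathbb{C}}(0,T)$ its solution is the unique $w\in C([0,T],W^{-1,2}(0,1))$ given by $$w(x,t)=-2\int_0^t(\partial_x\theta)(x,t-\tau)u_\ell(\tau)\,d\tau+2\int_0^t(\partial_x\theta)(x-1,t-\tau)u_r(\tau)\,d\tau.$$ $\mathcal{R}$ is the set of all $w(\cdot,T)$ with $u_\ell,u_r\in L^2_{\mathbb{C}}(0,T)$; it does not depend on $T>0$. Elements of $\mathcal{R}$ are identified with their analytic extensions from $(0,1)$ to $Q_\infty$ given by the same integral formula with $x$ replaced by $z\in Q_\infty$. *)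

(* Defs.v *)
From HB Require Import structures.
From mathcomp Require Import all_boot all_order all_algebra.
From mathcomp Require Import complex.
From mathcomp Require Import all_classical all_reals all_analysis.

Set Implicit Arguments.
Unset Strict Implicit.
Unset Printing Implicit Defensive.

Import Order.TTheory GRing.Theory Num.Theory.
Import numFieldNormedType.Exports.

Local Open Scope classical_set_scope.
Local Open Scope ring_scope.
Local Open Scope complex_scope.

Section Definitions.
Context {R : realType}.
Implicit Types (A : set R) (T t x : R) (z : R[i]) (u v w : R -> R[i]).

Local Notation mu := (@lebesgue_measure R).

Definition Q : set R[i] :=
  [set z | `|complex.Im z| < complex.Re z /\
           `|complex.Im z| < 1 - complex.Re z].

(* The translates of Q are pairwise disjoint, so Qinf is not connected. *)
Definition Qinf : set R[i] :=
  \bigcup_(n in [set: int]) [set n%:~R + z | z in Q].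

(* [R[i]^o] carries the topology and the normed module structure of the field
   [R[i]] over itself, so derivatives are complex derivatives. *)
Definition hol (U : set R[i]) (f : R[i] -> R[i]^o) : Prop :=
  forall z, U z -> derivable (f : R[i]^o -> R[i]^o) z 1.

Definition cexp z : R[i] :=
  (expR (complex.Re z) * cos (complex.Im z))
    +i* (expR (complex.Re z) * sin (complex.Im z)).

Definition cintegral A u : R[i] :=
  (\int[mu]_(x in A) complex.Re (u x)) +i* (\int[mu]_(x in A) complex.Im (u x)).

Definition sqnorm z : R := complex.Re z ^+ 2 + complex.Im z ^+ 2.

Definition L2 A u : Prop :=
  [/\ measurable_fun A (fun x => complex.Re (u x)),
      measurable_fun A (fun x => complex.Im (u x)) &
      (\int[mu]_(x in A) (sqnorm (u x))%:E < +oo)%E].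

Definition ae_eq_on A u v : Prop := u = v %[ae mu in A].

Definition continuous_L2 T (v : R -> R -> R[i]) : Prop :=
  (forall t, t \in `[0, T] -> L2 `]0, 1[ (v t)) /\
  (forall t, t \in `[0, T] ->
     \int[mu]_(x in `]0, 1[) sqnorm (v s x - v t x)
       @[s --> within `[0, T] (nbhs t)] --> (0 : R)).

(* Every C^2 function on [0, 1] extends to a C^2 function on the line; real
   test functions suffice since the weak identity is linear in phi. *)
Definition neumann_test (phi : R -> R) : Prop :=
  [/\ forall x, derivable phi x 1,
      forall x, derivable phi^`()%classic x 1,
      continuous phi^`(2)%classic,
      phi^`()%classic 0 = 0 & phi^`()%classic 1 = 0].

(* [v t x] is the value at position x and time t.  The integral identity is
   the heat equation multiplied by phi and integrated over ]0,1[ x ]0,t[; two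
   integrations by parts in x leave the boundary terms
   u_r phi(1) - u_l phi(0), since phi' vanishes at 0 and at 1. *)
Definition neumann_solution T (ul ur : R -> R[i]) (v : R -> R -> R[i]) : Prop :=
  [/\ continuous_L2 T v,
      ae_eq_on `]0, 1[ (v 0) (cst 0) &
      forall phi, neumann_test phi -> forall t, t \in `[0, T] ->
        cintegral `]0, 1[ (fun x => v t x * (phi x)%:C) =
        cintegral `]0, t[
          (fun s => cintegral `]0, 1[ (fun x => v s x * (phi^`(2)%classic x)%:C))
        + cintegral `]0, t[
            (fun s => ur s * (phi 1)%:C - ul s * (phi 0)%:C)].

(* Elements of L^2(0,1) are represented by functions on the whole line, of
   which only the almost everywhere class on ]0,1[ matters. *)
Definition reachN T : set (R -> R[i]) :=
  [set g | exists ul ur : R -> R[i],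
     [/\ L2 `]0, T[ ul, L2 `]0, T[ ur &
      exists2 v, neumann_solution T ul ur v & ae_eq_on `]0, 1[ g (v T)]].

Definition dK z t : R[i] :=
  - (z / (4 * Num.sqrt pi * t `^ (3 / 2))%:C) * cexp (- (z ^+ 2 / (4 * t)%:C)).

(* For t > 0 the series over the integers converges absolutely, so that it
   equals the limit of its symmetric partial sums. *)
Definition dtheta z t : R[i] :=
  lim ((dK z t + \sum_(1 <= n < N.+1)
          (dK (z + (2 * n)%:R) t + dK (z - (2 * n)%:R) t) : R[i]^o)
        @[N --> \oo]).

Definition dirichlet (ul ur : R -> R[i]) z t : R[i] :=
  - 2 * cintegral `]0, t[ (fun s => dtheta z (t - s) * ul s)
  + 2 * cintegral `]0, t[ (fun s => dtheta (z - 1) (t - s) * ur s).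

(* Only the values on Qinf matter. *)
Definition reachD T : set (R[i] -> R[i]) :=
  [set F | exists ul ur : R -> R[i],
     [/\ L2 `]0, T[ ul, L2 `]0, T[ ur &
      forall z, Qinf z -> F z = dirichlet ul ur z T]].

End Definitions.

(* Main.v *)
Require Import Defs.
From mathcomp Require Import all_boot all_order all_algebra.
From mathcomp Require Import complex.
From mathcomp Require Import all_classical all_reals all_analysis.
From mathcomp Require Import measurable_realfun.
From mathcomp Require Import ring lra zify.
Import Order.TTheory GRing.Theory Num.Theory.
Import numFieldNormedType.Exports.
Set Implicit Arguments.
Unset Strict Implicit.
Unset Printing Implicit Defensive.
Local Open Scope classical_set_scope.
Local Open Scope ring_scope.

(** Why the theorem holds. The heat flow in (0, 1) with zero initial data and
    Neumann data ul, ur is the difference of two single layer potentials of the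
    2-periodized heat kernel theta,
      v(t, x) = - 2 int_0^t theta(x, t - s) ul(s) ds
                + 2 int_0^t theta(x - 1, t - s) ur(s) ds.
    At a fixed final time S the same formula at complex z defines a function on
    [Qinf] ([extension]). Differentiating under the integral, its derivative is
    the Dirichlet formula for the same controls ([extension_derive]), and on
    (0, 1) it is the final state ([extension_real]). So every reachable state
    extends to a function with derivative in the Dirichlet reachable space.
    Conversely, let f' be given by the Dirichlet formula for ul, ur. Then f minus
    the extension has zero derivative, hence is constant on (0, 1), and the
    state is reachable as soon as a constant can be added to it. [Qinf] is not
    connected, but only its component over (0, 1) is seen by the states.

    Steering. The final state is determined by its cosine coefficients, which
    are int_0^S e^(- lam n (S - s)) ((-1)^n ur(s) - ul(s)) ds with
    lam n = n^2 pi^2. Independence of the time and the addition of constants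
    are therefore statements on the moments of a control against exponentials.
    A family biorthogonal to the exponentials e^(- lam n s) on (0, T), with
    growth at most e^(lam m T / 2), solves every moment problem with data
    e^(- lam n T) b_n, b bounded ([moment_problem]). To move a control from
    (0, S) to (0, T), keep the part that acts during the last T units of time:
    what acts earlier has moments of exactly that form ([moment_transfer]). A
    constant has the single nonzero moment n = 0 ([steering]). The m-th
    biorthogonal function is e^(lam m s) times the density of an infinite
    convolution of two-point signed measures, one for each n <> m, that
    annihilates e^(- (lam n - lam m) s); its total variation is bounded
    independently of m ([infinite_annihilation], [biorthogonal]).

    The weak Neumann problem. That the layer potential solves it
    ([layer_weak_identity], [state_solution]) comes from the heat equation for
    theta tested against a function of x ([kernel_identity]). This is checked on
    cosines, by
    unfolding the integral of theta over (0, 1) to an integral over the line and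
    using the Fourier transform of the Gaussian, and extended by the density of
    cosine polynomials. Square integrability uses theta = O(t^(-1/2)). The
    difference of two solutions has coefficients with c(t) = - lam n
    int_0^t c, so it vanishes by completeness of the cosines
    ([real_solution_unique]).

    Holomorphy. For z in [Qinf] all images z + 2n lie in a sector where the
    real part of their square is positive, so that the kernel decays faster
    than any power of the time. The second-order Taylor remainder of the kernel
    at z + 2n is then O(|h|^2 / n^2) uniformly in time ([sector_bounds],
    [theta_taylor]), and can be summed over n and integrated against a square
    integrable control ([cpot_taylor]). *)

(** * Reflections and translations of the Lebesgue integral *)

Section reflection.
Context {R : realType}.
Local Notation mu := (@lebesgue_measure R).
Implicit Types (c : R) (f : R -> R).

Lemma measurable_reflect c : measurable_fun setT (fun s : R => c - s).
Proof. exact: measurable_funB. Qed.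

(** Lebesgue measure is determined by its values on the intervals ]a, b], whose
    reflections are intervals of the same length. *)
Lemma lebesgue_measure_reflect c (A : set R) : measurable A ->
  pushforward mu (fun s : measurableTypeR R => c - s : measurableTypeR R) A = mu A.
Proof.
move=> mA; have mr := measurable_reflect c.
apply/esym/(lebesgue_measure_unique (mu := pushforward mu (fun s : measurableTypeR R => c - s : measurableTypeR R))) => //= _ [[a b]] _ <-.
rewrite /pushforward/=.
have -> : (fun s : R => c - s) @^-1` `]a, b] = `[c - b, c - a[%classic.
  apply/seteqP; split => s /=; rewrite !in_itv/= => /andP[h1 h2]; apply/andP; split; lra.
rewrite !lebesgue_measure_itv/= !lte_fin.
by rewrite ltrD2l ltrN2; case: ifPn => // _; congr EFin; ring.
Qed.

Lemma ge0_integral_reflect c (f : R -> \bar R) :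
  measurable_fun setT f -> (forall x, 0 <= f x)%E ->
  (\int[mu]_x f (c - x)%R = \int[mu]_x f x)%E.
Proof.
move=> mf f0.
have := @ge0_integral_pushforward _ _ (measurableTypeR R) (measurableTypeR R) R
  (fun s : measurableTypeR R => c - s : measurableTypeR R) (measurable_reflect c) mu setT f.
rewrite preimage_setT => <- //.
have mr := measurable_reflect c.
apply: eq_measure_integral => A mA AS.
exact: (lebesgue_measure_reflect c mA).
Qed.

Lemma integral_reflect c (f : R -> \bar R) :
  measurable_fun setT f ->
  (\int[mu]_x f (c - x)%R = \int[mu]_x f x)%E.
Proof.
move=> mf; rewrite integralE [in RHS]integralE.
have hp := ge0_integral_reflect c (measurable_funepos mf) (funepos_ge0 f).
have hn := ge0_integral_reflect c (measurable_funeneg mf) (funeneg_ge0 f).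
rewrite funepos_comp funeneg_comp; congr (_ - _)%E; [exact: hp|exact: hn].
Qed.

Lemma Rintegral_reflect c f : measurable_fun setT f ->
  \int[mu]_x f (c - x) = \int[mu]_x f x.
Proof.
by move=> mf; congr fine; apply: (integral_reflect c (f := EFin \o f)); exact/measurable_EFinP.
Qed.

Lemma integrable_reflect c f : mu.-integrable setT (EFin \o f) ->
  mu.-integrable setT (EFin \o (fun s => f (c - s))).
Proof.
move=> /integrableP[mf fi]; apply/integrableP; split.
  by apply: (measurableT_comp mf); exact: measurable_reflect.
by rewrite (ge0_integral_reflect c (f := fun x => `|(f x)%:E|%E))//; exact: measurableT_comp.
Qed.

(** A translation is the composite of two reflections. *)
Lemma Rintegral_translate a f : measurable_fun setT f ->
  \int[mu]_x f (x - a) = \int[mu]_x f x.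
Proof.
move=> mf; rewrite -(Rintegral_reflect 0 mf).
rewrite -(Rintegral_reflect a (f := fun x => f (0 - x))).
  by apply: eq_Rintegral => x _; congr f; ring.
by apply: (measurableT_comp mf); exact: measurable_reflect.
Qed.

Lemma integrable_translate a f : mu.-integrable setT (EFin \o f) ->
  mu.-integrable setT (EFin \o (fun s => f (s - a))).
Proof.
move=> /(integrable_reflect 0)/(integrable_reflect a).
by apply: eq_integrable => //= x _; congr (EFin (f _)); ring.
Qed.

End reflection.

(** * Elementary analysis *)

Section tools.
Context {R : realType}.
Local Notation mu := (@lebesgue_measure R).
Implicit Types (f : R -> R).

Lemma lipschitz_continuous f L : (forall s t, `|f s - f t| <= L * `|s - t|) -> continuous f.
Proof.
move=> fL x; apply/cvgrPdist_le => e e0.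
have L0 : 0 <= L by have := le_trans (normr_ge0 _) (fL 1 0); rewrite subr0 normr1 mulr1.
near=> y; apply: le_trans (fL x y) _.
have : `|x - y| <= e / (L + 1).
  near: y; apply: (@cvgr_dist_le _ _ _ _ _ (fun y => y)) => //.
  by rewrite divr_gt0// ltr_wpDl.
rewrite ler_pdivlMr ?ltr_wpDl// => h; apply: le_trans h.
by rewrite mulrC ler_wpM2l// lerDl.
Unshelve. all: by end_near. Qed.

Lemma integrable_supported f a b : continuous f ->
  (forall s, s \notin `[a, b] -> f s = 0) -> mu.-integrable setT (EFin \o f).
Proof.
move=> cf f0.
have -> : EFin \o f = (EFin \o f) \_ `[a, b].
  apply/funext => s; rewrite /patch/=; case: ifPn => //.
  by rewrite notin_setE /= => /negP/f0 ->.
apply/(integrable_mkcond _ _).1 => //; apply: continuous_compact_integrable.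
  exact: segment_compact.
exact: continuous_subspaceT.
Qed.

Lemma Rintegral_FTC f F a b : a <= b -> continuous f ->
  (forall x : R, is_derive x 1 F (f x)) -> \int[mu]_(x in `[a, b]) f x = F b - F a.
Proof.
rewrite le_eqVlt => /predU1P[-> _ _|ab cf dF].
  by rewrite set_itv1 Rintegral_set1 subrr.
have cF : continuous F.
  by move=> x; apply: differentiable_continuous; apply/derivable1_diffP; case: (dF x).
rewrite /Rintegral (@continuous_FTC2 _ _ F)//.
- exact: continuous_subspaceT.
- split=> [x _||]; [by case: (dF x)|exact/cvg_at_right_filter/cF|exact/cvg_at_left_filter/cF].
- by move=> x _; rewrite derive1E; exact: derive_val.
Qed.

Lemma lip_max (x y : R) : `|Num.max 0 x - Num.max 0 y| <= `|x - y|.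
Proof.
have := ler_norm (x - y); have := ler_norm (y - x); rewrite [`|y - x|]distrC => ? ?.
by rewrite /Num.max; case: (ltP 0 x) => ?; case: (ltP 0 y) => ?;
  rewrite ler_norml; apply/andP; split; lra.
Qed.

Lemma lip_min (x y b : R) : `|Num.min x b - Num.min y b| <= `|x - y|.
Proof.
have := ler_norm (x - y); have := ler_norm (y - x); rewrite [`|y - x|]distrC => ? ?.
by rewrite /Num.min; case: (ltP x b) => ?; case: (ltP y b) => ?;
  rewrite ler_norml; apply/andP; split; lra.
Qed.

Lemma Rdominated_cvg d (T : measurableType d) (m : {measure set T -> \bar R})
    (D : set T) (f_ : nat -> T -> R) (f g : T -> R) : measurable D ->
  (forall n, measurable_fun D (f_ n)) ->
  (forall x, D x -> f_ n x @[n --> \oo] --> f x) ->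
  m.-integrable D (EFin \o g) ->
  (forall n x, D x -> `|f_ n x| <= g x) ->
  m.-integrable D (EFin \o f) /\
  \int[m]_(x in D) f_ n x @[n --> \oo] --> \int[m]_(x in D) f x.
Proof.
move=> mD mf cf ig fg.
have mfE n : measurable_fun D (EFin \o f_ n) by exact/measurable_EFinP.
have cfE x : D x -> (f_ n x)%:E @[n --> \oo] --> (f x)%:E.
  by move=> Dx; apply: cvg_EFin; [exact: nearW|exact: cf].
have mflim : measurable_fun D (EFin \o f).
  exact/measurable_EFinP/(measurable_fun_cvg mf).
have [||i1 _ i2] := dominated_convergence mD mfE mflim _ ig.
- by apply: aeW => x Dx; exact: cfE.
- by apply: aeW => x n Dx; rewrite lee_fin; exact: fg.
split=> //; rewrite /Rintegral.
by apply: fine_cvg; rewrite fineK//; exact: integrable_fin_num.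
Qed.

Lemma increments_cvg (F v : nat -> R) B :
  (forall n, `|F n.+1 - F n| <= v n) ->
  (forall N, \sum_(0 <= n < N) v n <= B) ->
  cvgn F /\ `|limn F - F 0%N| <= B.
Proof.
move=> Fv vB.
have v0 n : 0 <= v n by exact: le_trans (normr_ge0 _) (Fv n).
have cv : cvgn (series v).
  apply: nondecreasing_is_cvgn.
    by apply: nondecreasing_series => n _ _; exact: v0.
  by exists B => _ [n _ <-]; exact: vB.
have cF : cvgn F.
  have -> : F = (fun n => series (telescope F) n + F 0%N).
    by apply/funext => n; rewrite telescopeK/= subrK.
  apply: is_cvgD; last exact: is_cvg_cst.
  apply: normed_cvg; apply: series_le_cvg cv => //= n; exact: Fv.
split=> //.
have : (F n - F 0%N) @[n --> \oo] --> limn F - F 0%N.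
  by apply: cvgB => //; exact: cvg_cst.
move=> /cvg_norm cn.
rewrite -(cvg_lim (@Rhausdorff R) cn); apply: limr_le; first by apply/cvg_ex; eexists; exact: cn.
apply: nearW => n; rewrite -(telescope_sumr F (leq0n n)).
apply: le_trans (ler_norm_sum _ _ _) _.
by apply: le_trans (vB n); apply: ler_sum => i _; exact: Fv.
Qed.

End tools.

(** * Annihilating infinitely many exponentials *)

Section infinite_annihilation.
Context {R : realType}.
Local Notation mu := (@lebesgue_measure R).
Implicit Types (f : R -> R).

Definition laplace m f : R := \int[mu]_x (expR (- (m * x)) * f x).

(** Convolution with the signed measure
    (e^(k a) delta_a - delta_0) / (e^(k a) - 1), which has total mass 1 and
    annihilates the exponential of rate k. *)
Definition annih k a f : R -> R :=
  fun s => (expR (k * a) * f (s - a) - f s) / (expR (k * a) - 1).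

(** The total variation of that measure. *)
Definition annih_gain k a : R := (expR (k * a) + 1) / `|expR (k * a) - 1|.

(** The three quantities whose growth under [annih] is controlled: the length of
    the support, the supremum and the Lipschitz constant. *)
Definition lip_bump b M L f :=
  [/\ forall s, s \notin `[0, b] -> f s = 0, forall s, `|f s| <= M &
      forall s t, `|f s - f t| <= L * `|s - t|].

Lemma continuous_expRNM m : continuous (fun x : R => expR (- (m * x))).
Proof.
move=> x; apply: (continuous_comp (f := fun x => - (m * x)) (g := expR)).
  by apply: cvgN; apply: cvgM => //; exact: cvg_cst.
exact: continuous_expR.
Qed.

Lemma lip_bump_continuous b M L f : lip_bump b M L f -> continuous f.
Proof. by case=> _ _; exact: lipschitz_continuous. Qed.

Lemma lip_bump_integrable b M L f m : lip_bump b M L f ->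
  mu.-integrable setT (EFin \o (fun x => expR (- (m * x)) * f x)).
Proof.
move=> fb; apply: (@integrable_supported _ _ 0 b).
  move=> x; apply: cvgM; last exact: lip_bump_continuous fb x.
  exact: continuous_expRNM.
by move=> s sb; case: fb => /(_ _ sb) -> _ _; rewrite mulr0.
Qed.

Lemma expR_mul_neq1 k a : k != 0 -> a > 0 -> expR (k * a) - 1 != 0 :> R.
Proof.
move=> k0 a0; rewrite subr_eq0 -expR0; apply/negP => /eqP/expR_inj/eqP.
by rewrite mulf_eq0 (negbTE k0) (gt_eqF a0).
Qed.

Lemma annih_gain_ge0 k a : 0 <= annih_gain k a.
Proof. by rewrite divr_ge0// addr_ge0// expR_ge0. Qed.

Lemma lip_bump_annih k a b M L f : k != 0 -> a > 0 -> lip_bump b M L f ->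
  lip_bump (b + a) (annih_gain k a * M) (annih_gain k a * L) (annih k a f).
Proof.
move=> k0 a0 [f0 fM fL]; have e0 := expR_mul_neq1 k0 a0.
have key x y B : `|x| <= B -> `|y| <= B ->
    `|(expR (k * a) * x - y) / (expR (k * a) - 1)| <= annih_gain k a * B.
  move=> xB yB; rewrite normrM normfV /annih_gain [leRHS]mulrAC ler_pM2r ?invr_gt0 ?normr_gt0//.
  rewrite (le_trans (ler_normB _ _))// mulrDl mul1r lerD//.
  by rewrite normrM ger0_norm ?expR_ge0// ler_wpM2l ?expR_ge0.
split=> [s sb|s|s t].
- rewrite /annih !f0 ?mulr0 ?subrr ?mul0r//.
    by move: sb; rewrite !in_itv/= !negb_and -!ltNge => /orP[h|h]; apply/orP; lra.
  by move: sb; rewrite !in_itv/= !negb_and -!ltNge => /orP[h|h]; apply/orP; lra.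
- exact: key.
- rewrite /annih -mulrBl -mulrA.
  have -> : expR (k * a) * f (s - a) - f s - (expR (k * a) * f (t - a) - f t) =
    expR (k * a) * (f (s - a) - f (t - a)) - (f s - f t) by ring.
  apply: key => //; apply: le_trans (fL _ _) _.
  by rewrite (_ : s - a - (t - a) = s - t)//; ring.
Qed.

Lemma laplace_annih k a b M L f m : lip_bump b M L f ->
  laplace m (annih k a f) =
  (expR ((k - m) * a) - 1) / (expR (k * a) - 1) * laplace m f.
Proof.
move=> fb.
pose g x := expR (- (m * x)) * f x.
have ig : mu.-integrable setT (EFin \o g) := lip_bump_integrable m fb.
have igt := integrable_translate a ig.
have mg : measurable_fun setT g by case/integrableP : ig => /measurable_EFinP.
rewrite /laplace.
under eq_Rintegral => x _.
  rewrite (_ : _ * _ = (expR (k * a) - 1)^-1 * (expR ((k - m) * a) * g (x - a) - g x)); last first.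
    have e : expR ((k - m) * a) * expR (- (m * (x - a))) = expR (- (m * x)) * expR (k * a).
      by rewrite -!expRD; congr expR; ring.
    by rewrite /annih /g mulrBr [_ * (_ * f (x - a))]mulrA e; ring.
  over.
have i1 : mu.-integrable setT (EFin \o (fun x => expR ((k - m) * a) * g (x - a))).
  exact: (integrableZl _ _ igt).
rewrite RintegralZl//=; last exact: (integrableB _ i1 ig).
rewrite RintegralB//= RintegralZl//= Rintegral_translate// -/g.
by rewrite /laplace -/g; ring.
Qed.

(** A Lipschitz function of integral 1 supported in [0, b]: the parabola through
    the end points, extended by 0 by clipping s to [0, b]. *)
Definition parab (b s : R) : R :=
  let c := Num.max 0 (Num.min s b) in 6 / b ^+ 3 * (c * (b - c)).

Lemma lip_bump_parab b : 0 < b -> lip_bump b (6 / b) (6 / b ^+ 2) (parab b).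
Proof.
move=> b0; have b3 : 0 <= 6 / b ^+ 3 by rewrite divr_ge0// exprn_ge0// ltW.
split=> [s|s|s t].
- rewrite in_itv/= negb_and -!ltNge /parab => /orP[h|h].
    by rewrite (min_idPl _) ?(ltW (lt_trans h _))// (max_idPl _) ?(ltW h)// mul0r mulr0.
  by rewrite (min_idPr _) ?(ltW h)// (max_idPr _) ?ltW// subrr !mulr0.
- rewrite /parab; set c := Num.max _ _.
  have c0 : 0 <= c by rewrite le_max lexx.
  have cb : c <= b by rewrite ge_max (ltW b0) ge_min lexx orbT.
  rewrite normrM (ger0_norm b3).
  rewrite (_ : 6 / b = 6 / b ^+ 3 * (b * b)); last by field; lra.
  apply: ler_wpM2l=> //.
  rewrite ger0_norm; nra.
- rewrite /parab; set c := Num.max 0 (Num.min s _); set d := Num.max 0 (Num.min t _).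
  have c0 : 0 <= c by rewrite le_max lexx.
  have cb : c <= b by rewrite ge_max (ltW b0) ge_min lexx orbT.
  have d0 : 0 <= d by rewrite le_max lexx.
  have db : d <= b by rewrite ge_max (ltW b0) ge_min lexx orbT.
  have cd : `|c - d| <= `|s - t|.
    by rewrite (le_trans (lip_max _ _))// lip_min.
  rewrite -mulrBr normrM (ger0_norm b3).
  rewrite (_ : 6 / b ^+ 2 = 6 / b ^+ 3 * b); last by field; lra.
  rewrite -[leRHS]mulrA; apply: (ler_wpM2l b3).
  rewrite (_ : _ - _ = (c - d) * (b - c - d)); last by ring.
  rewrite normrM mulrC ler_pM//.
  by rewrite ler_norml; apply/andP; split; lra.
Qed.

Lemma laplace0_parab b : 0 < b -> laplace 0 (parab b) = 1.
Proof.
move=> b0; rewrite /laplace.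
under eq_Rintegral do rewrite mul0r oppr0 expR0 mul1r.
transitivity (\int[mu]_(x in `[0, b]) (6 / b ^+ 3 * (x * (b - x)))).
  rewrite [RHS]Rintegral_mkcond; apply: eq_Rintegral => x _; rewrite /patch.
  case: ifPn => [|]; last first.
    rewrite notin_setE/= => /negP xb.
    by have [/(_ _ xb) -> ] := lip_bump_parab b0.
  rewrite inE/= in_itv/= => /andP[x0 xb].
  by rewrite /parab (min_idPl _)// (max_idPr _).
pose F (x : R) : R := 6 / b ^+ 3 * (b * x ^+ 2 / 2 - x ^+ 3 / 3).
have dF (x : R) : is_derive x 1 F (6 / b ^+ 3 * (x * (b - x))).
  by apply: is_derive_eq; rewrite /GRing.scale/= !mulr0 /=; field; lra.
rewrite (Rintegral_FTC (ltW b0) _ dF).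
  by rewrite /F !expr0n/=; field; lra.
move=> x.
by apply: cvgM; [exact: cvg_cst|apply: cvgM => //; apply: cvgB => //; exact: cvg_cst].
Qed.

Lemma lip_bump_le b b' M M' L L' f : b <= b' -> M <= M' -> L <= L' ->
  lip_bump b M L f -> lip_bump b' M' L' f.
Proof.
move=> bb MM LL [f0 fM fL]; split=> [s sb|s|s t].
- apply: f0; apply: contra sb; rewrite !in_itv/= => /andP[-> /=] h.
  exact: le_trans bb.
- exact: le_trans (fM s) MM.
- by apply: le_trans (fL s t) _; exact: ler_wpM2r.
Qed.

Fixpoint iter_annih (k a : nat -> R) f n : R -> R :=
  if n is j.+1 then annih (k j) (a j) (iter_annih k a f j) else f.

Lemma lip_bump_iter_annih (k a : nat -> R) (b M L : R) f n : (forall j, k j != 0) ->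
  (forall j, 0 < a j) -> lip_bump b M L f ->
  let P := \prod_(0 <= j < n) annih_gain (k j) (a j) in
  lip_bump (b + \sum_(0 <= j < n) a j) (P * M) (P * L) (iter_annih k a f n).
Proof.
move=> k0 a0 fb /=; elim: n => [|n IH].
  by rewrite !big_nil addr0 !mul1r.
rewrite !big_nat_recr//= addrA ![_ * annih_gain _ _]mulrC.
rewrite -[_ * _ * M]mulrA -[_ * _ * L]mulrA.
exact: lip_bump_annih.
Qed.

Lemma laplace_iter_annih (k a : nat -> R) (b M L : R) f n (m : R) : (forall j, k j != 0) ->
  (forall j, 0 < a j) -> lip_bump b M L f ->
  laplace m (iter_annih k a f n) =
  \prod_(0 <= j < n) ((expR ((k j - m) * a j) - 1) / (expR (k j * a j) - 1)) *
  laplace m f.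
Proof.
move=> k0 a0 fb; elim: n => [|n IH]; first by rewrite big_nil mul1r.
rewrite big_nat_recr//= (laplace_annih _ _ _ (lip_bump_iter_annih n k0 a0 fb)) IH.
by rewrite mulrA [X in X * _ = _]mulrC.
Qed.

(** The function [G] is the density of an infinite convolution of the signed
    measures (e^(k a) delta_a - delta_0) / (e^(k a) - 1), smoothed by a bump.
    Each factor has total mass 1, its Laplace transform vanishes at [k], and
    its total variation is [annih_gain k a]. *)
Lemma infinite_annihilation (k a e : nat -> R) (A E b : R) : 0 < b ->
  (forall j, k j != 0) -> (forall j, 0 < a j) ->
  (forall N, \sum_(0 <= j < N) a j <= A) ->
  (forall j, 0 <= e j) ->
  (forall j, annih_gain (k j) (a j) <= 1 + e j) ->
  (forall N, \sum_(0 <= j < N) e j <= E) ->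
  exists G, [/\ exists L, lip_bump (b + A) (expR E * (6 / b)) L G,
    laplace 0 G = 1 & forall j, laplace (k j) G = 0].
Proof.
move=> b0 k0 a0 aA e0 ge eE.
have fb := lip_bump_parab b0; pose F := iter_annih k a (parab b).
pose P n := \prod_(0 <= j < n) annih_gain (k j) (a j).
have PE n : P n <= expR E.
  apply: (@le_trans _ _ (\prod_(0 <= j < n) expR (e j))).
    apply: ler_prod => j _; rewrite annih_gain_ge0/=.
    exact: le_trans (ge j) (expR_ge1Dx _).
  rewrite -expR_sum ler_expR; exact: eE.
have Fb n : lip_bump (b + A) (expR E * (6 / b)) (expR E * (6 / b ^+ 2)) (F n).
  apply: lip_bump_le (lip_bump_iter_annih n k0 a0 fb).
  - by rewrite lerD2l.
  - by rewrite ler_wpM2r ?PE// divr_ge0// ltW.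
  - by rewrite ler_wpM2r ?PE// divr_ge0// exprn_ge0// ltW.
have dF s n : `|F n.+1 s - F n s| <= expR E * (6 / b ^+ 2) * a n.
  have [_ _ fL] := lip_bump_iter_annih n k0 a0 fb.
  have en := expR_mul_neq1 (k0 n) (a0 n).
  have -> : F n.+1 s - F n s =
    expR (k n * a n) / (expR (k n * a n) - 1) * (F n (s - a n) - F n s).
    by rewrite /F /= /annih -/(F n); field.
  rewrite normrM.
  have h1 : `|expR (k n * a n) / (expR (k n * a n) - 1)| <= annih_gain (k n) (a n).
    rewrite normrM normfV ger0_norm ?expR_ge0// /annih_gain ler_wpM2r ?invr_ge0//.
    by rewrite lerDl.
  have h2 : `|F n (s - a n) - F n s| <= P n * (6 / b ^+ 2) * a n.
    apply: le_trans (fL _ _) _.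
    by rewrite (_ : s - a n - s = - a n) ?normrN ?(gtr0_norm (a0 n))//; ring.
  apply: le_trans (ler_pM _ _ h1 h2) _ => //.
  rewrite !mulrA; apply: ler_wpM2r; first exact: ltW.
  apply: ler_wpM2r; first by rewrite invr_ge0 exprn_ge0// ltW.
  apply: ler_wpM2r => //; have := PE n.+1.
  by rewrite /P big_nat_recr//= mulrC.
have cF s : cvgn (F ^~ s).
  have C0 : 0 <= expR E * (6 / b ^+ 2).
    by rewrite mulr_ge0 ?expR_ge0// divr_ge0// exprn_ge0// ltW.
  apply: (increments_cvg (B := expR E * (6 / b ^+ 2) * A) (dF s) _).1 => N.
  by rewrite -mulr_sumr ler_wpM2l.
pose G s := limn (F ^~ s).
have GL s : F n s @[n --> \oo] --> G s by exact: cF.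
have Gb : lip_bump (b + A) (expR E * (6 / b)) (expR E * (6 / b ^+ 2)) G.
  split=> [s sb|s|s t].
  - apply/cvg_lim; first exact: Rhausdorff.
    by apply: cvg_near_cst; apply: nearW => n; have [/(_ _ sb)] := Fb n.
  - have /cvg_norm cn := GL s; rewrite -(cvg_lim (@Rhausdorff R) cn).
    apply: limr_le; first by apply/cvg_ex; eexists; exact: cn.
    by apply: nearW => n; have [_ ] := Fb n.
  - have : F n s - F n t @[n --> \oo] --> G s - G t by apply: cvgB; exact: GL.
    move=> /cvg_norm cn; rewrite -(cvg_lim (@Rhausdorff R) cn).
    apply: limr_le; first by apply/cvg_ex; eexists; exact: cn.
    by apply: nearW => n; have [_ _] := Fb n.
have lapG m : laplace m (F n) @[n --> \oo] --> laplace m G.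
  pose g x := expR (- (m * x)) * (expR E * (6 / b)) * \1_(`[0, b + A]%classic) x.
  have := @Rdominated_cvg _ _ _ mu setT (fun n x => expR (- (m * x)) * F n x)
    (fun x => expR (- (m * x)) * G x) g measurableT.
  case=> [||||_]; last by [].
  - by move=> n; case/integrableP : (lip_bump_integrable m (Fb n)) => /measurable_EFinP.
  - by move=> x _; apply: cvgM; [exact: cvg_cst|exact: GL].
  - have -> : EFin \o g = (EFin \o (fun x => expR (- (m * x)) * (expR E * (6 / b)))) \_ `[0, b + A].
      by apply/funext => x; rewrite /g /patch/= indicE; case: ifPn => _; rewrite ?mulr1 ?mulr0.
    apply/(integrable_mkcond _ _).1 => //; apply: continuous_compact_integrable.
      exact: segment_compact.
    apply: continuous_subspaceT => x; apply: cvgM; last exact: cvg_cst.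
    exact: continuous_expRNM.
  - move=> n x _; rewrite /g normrM ger0_norm ?expR_ge0// -mulrA ler_wpM2l ?expR_ge0//.
    have [f0 fM _] := Fb n; rewrite indicE; case: (boolP (x \in _)) => xb.
      by rewrite mulr1.
    rewrite mulr0 f0 ?normr0//.
    by apply: contra xb => xb; rewrite inE.
exists G; split; first by exists (expR E * (6 / b ^+ 2)).
- rewrite -(cvg_lim (@Rhausdorff R) (lapG 0)).
  apply/cvg_lim; first exact: Rhausdorff.
  apply: cvg_near_cst; apply: nearW => n; rewrite (laplace_iter_annih _ _ k0 a0 fb) laplace0_parab// mulr1.
  by rewrite big1// => j _; rewrite subr0 divff// expR_mul_neq1.
- move=> j; rewrite -(cvg_lim (@Rhausdorff R) (lapG (k j))).
  apply/cvg_lim; first exact: Rhausdorff.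
  (* After j + 1 steps the factor that vanishes at k j is present. *)
  apply: cvg_near_cst; exists j.+1 => // n /= jn.
  rewrite (laplace_iter_annih _ _ k0 a0 fb) (big_cat_nat (n := j.+1))//= big_nat_recr//=.
  by rewrite subrr mul0r expR0 subrr mul0r !(mulr0, mul0r).
Qed.

End infinite_annihilation.

(** * A moment problem for the exponentials of rates n ^ 2 pi ^ 2 *)

Section moment_problem.
Context {R : realType}.
Local Notation mu := (@lebesgue_measure R).

Definition lam (n : nat) : R := (n%:R * pi) ^+ 2.

(** Superadditivity of the power n applied to e^(y/n) >= 1 + y/n. *)
Lemma expR_geXn (y : R) n : 0 <= y -> (0 < n)%N -> 1 + (y / n%:R) ^+ n <= expR y.
Proof.
move=> y0 n0; rewrite (_ : expR y = expR (y / n%:R) ^+ n); last first.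
  by rewrite -expRM_natl -mulrC divfK// pnatr_eq0 -lt0n.
have z0 : 0 <= y / n%:R by rewrite divr_ge0.
apply: le_trans (_ : (1 + y / n%:R) ^+ n <= _).
  case: n n0 z0 => // n _ z0; set z := y / _ in z0 *.
  rewrite [leRHS]exprS mulrDl mul1r [z ^+ _]exprS lerD//.
    by rewrite exprn_ege1// lerDl.
  by apply: ler_wpM2l => //; apply: lerXn2r; rewrite ?nnegrE ?addr_ge0// lerDr.
by rewrite ler_pXn2r ?nnegrE ?expR_ge0 ?addr_ge0//; exact: expR_ge1Dx.
Qed.

(** The gain equals coth (|k| a / 2), which tends to 1 exponentially; only a
    cubic rate is kept, since e^y - 1 >= (y/3)^3. *)
Lemma annih_gain_le (k a y : R) : k != 0 -> 0 < a -> 0 < y -> y <= `|k| * a ->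
  annih_gain k a <= 1 + 54 / y ^+ 3.
Proof.
move=> k0 a0 y0 yka.
have gN : annih_gain (- k) a = annih_gain k a.
  rewrite /annih_gain mulNr expRN; have := expR_mul_neq1 k0 a0.
  have := expR_gt0 (k * a); set E := expR _ => E0 E1.
  rewrite (_ : E^-1 - 1 = - ((E - 1) / E)); last by field; lra.
  rewrite normrN normrM normfV (gtr0_norm E0).
  by field; rewrite normr_eq0 E1 gt_eqF.
have -> : annih_gain k a = annih_gain `|k| a.
  by case: (ger0P k) => // _; rewrite gN.
rewrite /annih_gain.
have yE : expR y <= expR (`|k| * a) by rewrite ler_expR.
have y3 : 1 + (y / 3) ^+ 3 <= expR y by apply: expR_geXn => //; exact: ltW.
set E := expR (`|k| * a) in yE *.
have y30 : 0 < y ^+ 3 by rewrite exprn_gt0.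
have E1 : y ^+ 3 / 27 <= E - 1.
  have : (y / 3) ^+ 3 = y ^+ 3 / 27 by field.
  by move=> <-; lra.
have E0 : 0 < E - 1 by lra.
rewrite (gtr0_norm E0) (_ : (E + 1) / (E - 1) = 1 + 2 / (E - 1)); last by field; lra.
rewrite lerD2l ler_pdivrMr//.
rewrite (_ : 2 = 54 / y ^+ 3 * (y ^+ 3 / 27)); last by field; lra.
by rewrite ler_wpM2l// divr_ge0// ltW.
Qed.

Let r (i : nat) : R := (Num.sqrt i.+1%:R)^-1.
(** Steps of order i^(-3/2) whose sum telescopes to 1. *)
Let d (i : nat) : R := r i - r i.+1.

Let dP i : let p := Num.sqrt i.+1%:R : R in
  [/\ 1 <= p, 0 < d i & (p ^+ 3)^-1 / 6 <= d i].
Proof.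
set p := Num.sqrt i.+1%:R => /=; set q : R := Num.sqrt i.+2%:R.
have p2 : p ^+ 2 = i.+1%:R by rewrite sqr_sqrtr.
have q2 : q ^+ 2 = p ^+ 2 + 1 by rewrite p2 sqr_sqrtr// -natr1.
have p1 : 1 <= p by rewrite -[leLHS]sqrtr1 ler_wsqrtr// ler1n.
have q0 : 0 <= q by exact: sqrtr_ge0.
have pq : p < q by rewrite -(ltr_pXn2r (n := 2))// ?nnegrE; lra.
have q2p : q <= 2 * p by rewrite -(ler_pXn2r (n := 2))// ?nnegrE//; nra.
have -> : d i = (p * q * (p + q))^-1.
  have -> : d i = p^-1 - q^-1 by [].
  have e : (q - p) * (p + q) = 1 by nra.
  rewrite (_ : p^-1 - q^-1 = (q - p) * (p + q) / (p * q * (p + q))); last first.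
    by field; apply/and3P; split; lra.
  by rewrite e mul1r.
have P0 : 0 < p * q * (p + q) by nra.
split=> //; first by rewrite invr_gt0.
rewrite -invfM lef_pV2 ?posrE ?mulr_gt0 ?exprn_gt0//; try lra.
have : q * (p + q) <= 2 * p * (3 * p) by apply: ler_pM; lra.
by move=> h; rewrite (_ : p ^+ 3 * 6 = p * (2 * p * (3 * p))); [rewrite -mulrA ler_wpM2l//; lra|ring].
Qed.

Let sum_half N (c : R) : 0 <= c -> \sum_(0 <= j < N) c * d j./2 <= 2 * c.
Proof.
move=> c0; have d0 i : 0 < d i by have [] := dP i.
have even M : \sum_(0 <= j < M.*2) c * d j./2 = 2 * c * (r 0%N - r M).
  elim: M => [|M IH]; first by rewrite big_nil subrr mulr0.
  rewrite doubleS !big_nat_recr//= IH uphalf_double half_double /d; ring.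
apply: le_trans (_ : \sum_(0 <= j < N.*2) c * d j./2 <= _).
  rewrite [leRHS](big_cat_nat (n := N))//=; last by rewrite -addnn leq_addr.
  by rewrite lerDl sumr_ge0// => i _; rewrite mulr_ge0// ltW.
rewrite even -[leRHS]mulr1 ler_wpM2l//; first by rewrite mulr_ge0.
have -> : r 0%N = 1 by rewrite /r sqrtr1 invr1.
by rewrite lerBlDr lerDl invr_ge0 sqrtr_ge0.
Qed.

(** The differences lam n - lam m for all n <> m, interleaved: the odd j run
    through the n below m, the even j through the n above m. Once the n below m
    are exhausted, odd j repeat values already present. *)
Let zero_gap (m j : nat) : R :=
  if odd j && (j./2 < m)%N then lam (m - j./2.+1) - lam m else lam (m + j./2.+1) - lam m.

Let zero_gapP m j : pi ^+ 2 * (j./2.+1)%:R ^+ 2 <= `|zero_gap m j|.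
Proof.
rewrite /zero_gap /lam; have pi20 : 0 < pi ^+ 2 :> R by rewrite exprn_gt0// pi_gt0.
set i := j./2.+1; case: ifPn => [/andP[_ im]|_].
  rewrite !exprMn -mulrBl normrM (gtr0_norm pi20) mulrC ler_pM2r//.
  rewrite natrB// distrC (le_trans _ (ler_norm _))//.
  have : (i%:R : R) <= m%:R by rewrite ler_nat.
  have : (0 : R) <= i%:R by [].
  nra.
rewrite !exprMn -mulrBl normrM (gtr0_norm pi20) mulrC ler_pM2r//.
rewrite natrD (le_trans _ (ler_norm _))//.
have : (0 : R) <= m%:R by [].
have : (0 : R) <= i%:R by [].
nra.
Qed.

(** The zeros are shifted by [lam m], and the step used to produce the zero at
    [lam (m +- i)] has length of order i^(-3/2): since
    |lam (m +- i) - lam m| >= (pi i)^2, all the gains are bounded independently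
    of [m]. *)
Lemma biorthogonal (T : R) : 0 < T -> exists C : R, forall m,
  exists H : R -> R, [/\ continuous H, forall s, s \notin `[0, T] -> H s = 0,
    forall s, `|H s| <= C * expR (lam m * (T / 2)) &
    forall n, \int[mu]_x (expR (- (lam n * x)) * H x) = (n == m)%:R].
Proof.
(* The bump has length T / 4 and the steps add up to 2 del = T / 4, so that the
   support lies in [0, T / 2]. *)
move=> T0; pose del := T / 8; have del0 : 0 < del by rewrite /del; lra.
pose D := 54 / (del / 2) ^+ 3 * 6.
have D0 : 0 <= D.
  apply: mulr_ge0 => //; apply: divr_ge0 => //; apply: exprn_ge0; lra.
exists (expR (2 * D) * (6 / (T / 4))) => m.
have gap0 j : zero_gap m j != 0.
  rewrite -normr_eq0 gt_eqF// (lt_le_trans _ (zero_gapP _ _))//.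
  by rewrite mulr_gt0 ?exprn_gt0 ?pi_gt0.
have a0 j : 0 < del * d j./2 by rewrite mulr_gt0//; have [] := dP j./2.
have T40 : 0 < T / 4 by lra.
have [||||G [[L Gb] G1 G0]] := @infinite_annihilation R (zero_gap m) (fun j => del * d j./2)
  (fun j => D * d j./2) (2 * del) (2 * D) (T / 4) T40 gap0 a0.
- by move=> N; apply: sum_half; exact: ltW.
- by move=> j; rewrite mulr_ge0//; have [_ /ltW] := dP j./2.
- move=> j; set i := j./2; have [] := dP i; set p := Num.sqrt _ => p1 d0 dp.
  have p3 : 0 < p ^+ 3 by rewrite exprn_gt0//; lra.
  apply: le_trans (annih_gain_le (y := del * p / 2) (gap0 j) (a0 j) _ _) _.
  + by rewrite divr_gt0// mulr_gt0//; lra.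
  + apply: le_trans (_ : _ <= pi ^+ 2 * (j./2.+1)%:R ^+ 2 * (del * d i)) _; last first.
      by apply: ler_wpM2r; [exact/ltW/a0|exact: zero_gapP].
    have -> : (j./2.+1)%:R = p ^+ 2 by rewrite sqr_sqrtr.
    have pi2 : 4 <= pi ^+ 2 :> R.
      by have := pi_ge2 R => h; nra.
    apply: le_trans (_ : 4 * (p ^+ 2) ^+ 2 * (del * ((p ^+ 3)^-1 / 6)) <= _).
      rewrite (_ : 4 * _ * _ = 2 / 3 * (del * p)); last by field; lra.
      have : 0 < del * p by rewrite mulr_gt0//; lra.
      lra.
    apply: ler_pM.
    * by rewrite mulr_ge0// exprn_ge0// exprn_ge0//; lra.
    * by rewrite mulr_ge0 ?ltW// divr_gt0// invr_gt0.
    * by rewrite ler_wpM2r// exprn_ge0// exprn_ge0//; lra.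
    * by rewrite ler_wpM2l// ltW.
  + rewrite lerD2l; apply: le_trans (_ : D * ((p ^+ 3)^-1 / 6) <= _); last first.
      by rewrite ler_wpM2l.
    rewrite /D le_eqVlt; apply/orP; left; apply/eqP; field; lra.
- by move=> N; exact: sum_half.
have Gs s : s \notin `[0, T / 2] -> G s = 0.
  have [G_ _ _] := Gb => sT; apply: G_; apply: contra sT; rewrite !in_itv/= /del => /andP[-> h]/=.
  by apply: le_trans h _; lra.
exists (fun s => expR (lam m * s) * G s); split.
- move=> x; apply: cvgM; last exact: (lip_bump_continuous Gb).
  have := @continuous_expRNM R (- lam m).
  under eq_fun do rewrite mulNr opprK.
  exact.
- move=> s sT; rewrite Gs ?mulr0//; apply: contra sT; rewrite !in_itv/= => /andP[-> h]/=.
  by apply: le_trans h _; lra.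
- move=> s; case: (boolP (s \in `[0, T / 2])) => [|sT]; last first.
    rewrite Gs// mulr0 normr0; apply: mulr_ge0; last exact: expR_ge0.
    by apply: mulr_ge0; [exact: expR_ge0|apply: divr_ge0; lra].
  rewrite in_itv/= => /andP[s0 sT]; rewrite normrM mulrC (ger0_norm (expR_ge0 _)).
  apply: ler_pM; rewrite ?expR_ge0//; first by have [_ h _] := Gb; exact: h.
  by rewrite ler_expR ler_wpM2l// sqr_ge0.
- move=> n; transitivity (laplace (lam n - lam m) G).
    apply: eq_Rintegral => x _; rewrite mulrA -expRD; congr (expR _ * _); ring.
  case: (ltngtP n m) => [nm|nm|->]; last by rewrite subrr G1.
  + rewrite ?(ltn_eqF nm) ?mulr0n -(G0 (m - n.+1).*2.+1) /zero_gap /= odd_double/= uphalf_double.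
    rewrite ifT; last by rewrite ltn_subrL (leq_ltn_trans _ nm).
    by have -> : (m - (m - n.+1).+1 = n)%N by lia.
  + rewrite ?(gtn_eqF nm) ?mulr0n -(G0 (n - m.+1).*2) /zero_gap /= odd_double/= half_double.
    by have -> : (m + (n - m.+1).+1 = n)%N by lia.
Qed.

(** Comparison with a geometric series, as lam m >= m. *)
Lemma sum_expR_lam (c : R) N : 0 < c ->
  \sum_(0 <= m < N) expR (- (lam m * c)) <= (1 - expR (- c))^-1.
Proof.
move=> c0; set q := expR (- c).
have q1 : q < 1 by rewrite /q -expR0 ltr_expR oppr_lt0.
have q0 : 0 < q by exact: expR_gt0.
apply: (@le_trans _ _ (\sum_(0 <= m < N) q ^+ m)).
  apply: ler_sum => m _; rewrite /q -expRM_natl ler_expR mulrN lerN2.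
  rewrite ler_wpM2r ?(ltW c0)// /lam exprMn.
  have p1 : 1 <= pi ^+ 2 :> R by rewrite exprn_ege1//; have := pi_ge2 R; lra.
  apply: (@le_trans _ _ (m%:R ^+ 2 * 1)); last by rewrite ler_wpM2l// exprn_ge0.
  by rewrite mulr1 -natrX ler_nat -[leqLHS]expn1; case: m => // m; rewrite leq_pexp2l.
elim: N => [|N IH]; first by rewrite big_nil invr_ge0; lra.
have -> : \sum_(0 <= m < N.+1) q ^+ m = (1 - q ^+ N.+1) / (1 - q).
  rewrite [LHS]big_mkord -opprB subrX1 -[1 - q]opprB invrN mulrNN mulrC mulKf//; lra.
by rewrite ler_pdivrMr ?subr_gt0// mulVf ?gt_eqF ?subr_gt0// gerBl exprn_ge0// ltW.
Qed.

(** Data of size exp (- lam n * T) absorb the growth exp (lam n * T / 2) of the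
    biorthogonal family. *)
Lemma moment_problem (T : R) (b : nat -> R) (B : R) : 0 < T ->
  (forall n, `|b n| <= B) ->
  exists h : R -> R, [/\ measurable_fun setT h,
    exists M : R, forall s, `|h s| <= M,
    forall s, s \notin `[0, T] -> h s = 0 &
    forall n, \int[mu]_x (expR (- (lam n * x)) * h x) = expR (- (lam n * T)) * b n].
Proof.
move=> T0 bB; have [C biC] := biorthogonal T0.
pose H m := sval (cid (biC m)).
have HP m : [/\ continuous (H m), forall s, s \notin `[0, T] -> H m s = 0,
    forall s, `|H m s| <= C * expR (lam m * (T / 2)) &
    forall n, \int[mu]_x (expR (- (lam n * x)) * H m x) = (n == m)%:R].
  exact: svalP (cid (biC m)).
pose t m s := expR (- (lam m * T)) * b m * H m s.
pose S N s := \sum_(0 <= m < N) t m s.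
have B0 : 0 <= B by exact: le_trans (bB 0%N).
have C0 : 0 <= C.
  have [_ _ /(_ 0) h _] := HP 0%N; have := le_trans (normr_ge0 _) h.
  by rewrite pmulr_lge0// expR_gt0.
have tb m s : `|t m s| <= B * C * expR (- (lam m * (T / 2))).
  have [_ _ hb _] := HP m.
  rewrite /t normrM normrM ger0_norm ?expR_ge0//.
  apply: (@le_trans _ _ (expR (- (lam m * T)) * B * (C * expR (lam m * (T / 2))))).
    by apply: ler_pM => //; apply: ler_wpM2l => //; exact: expR_ge0.
  have -> : expR (- (lam m * (T / 2))) = expR (- (lam m * T)) * expR (lam m * (T / 2)).
    by rewrite -expRD; congr expR; field.
  by rewrite le_eqVlt; apply/orP; left; apply/eqP; ring.
pose M := B * C * (1 - expR (- (T / 2)))^-1.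
have sM N : \sum_(0 <= m < N) (B * C * expR (- (lam m * (T / 2)))) <= M.
  by rewrite -mulr_sumr ler_wpM2l ?mulr_ge0//; apply: sum_expR_lam; lra.
have St N s : `|S N.+1 s - S N s| <= B * C * expR (- (lam N * (T / 2))).
  by rewrite /S big_nat_recr//= addrAC subrr add0r.
have cS s : cvgn (S ^~ s) /\ `|limn (S ^~ s) - S 0%N s| <= M.
  exact: increments_cvg (fun n => St n s) sM.
have SM N s : `|S N s| <= M.
  apply: le_trans (ler_norm_sum _ _ _) _; apply: le_trans (sM N).
  by apply: ler_sum => m _; exact: tb.
have S0 N s : s \notin `[0, T] -> S N s = 0.
  by move=> sT; rewrite /S big1// => m _; rewrite /t; have [_ -> // _ _] := HP m; rewrite mulr0.
have cont N : continuous (S N).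
  elim: N => [|N IH] x.
    have -> : S 0%N = cst 0 by apply/funext => s; rewrite /S big_geq.
    exact: cvg_cst.
  have -> : S N.+1 = (fun s => S N s + t N s).
    by apply/funext => s; rewrite /S big_nat_recr.
  apply: cvgD; first exact: IH.
  by apply: cvgM; [exact: cvg_cst|have [cH _ _ _] := HP N; exact: cH].
have intH n m : mu.-integrable setT (EFin \o (fun x => expR (- (lam n * x)) * H m x)).
  have [cH H0 _ _] := HP m; apply: (integrable_supported (a := 0) (b := T)).
    by move=> x; apply: cvgM; [exact: continuous_expRNM|exact: cH].
  by move=> s /H0 ->; rewrite mulr0.
have intS n N : mu.-integrable setT (EFin \o (fun x => expR (- (lam n * x)) * S N x)) /\
    \int[mu]_x (expR (- (lam n * x)) * S N x) =
    \sum_(0 <= m < N) expR (- (lam m * T)) * b m * (n == m)%:R.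
  elim: N => [|N [IH1 IH2]].
    split; last first.
      by rewrite big_nil; under eq_Rintegral do rewrite /S big_geq// mulr0; rewrite Rintegral_cst// mul0r.
    apply: eq_integrable (integrable0 _ _ ) => //= x _.
    by rewrite /S big_geq// mulr0.
  have e x : expR (- (lam n * x)) * S N.+1 x = expR (- (lam n * x)) * S N x +
      expR (- (lam N * T)) * b N * (expR (- (lam n * x)) * H N x).
    rewrite /S big_nat_recr//= mulrDr; congr (_ + _); rewrite /t; ring.
  have i2 : mu.-integrable setT (EFin \o (fun x =>
      expR (- (lam N * T)) * b N * (expR (- (lam n * x)) * H N x))).
    exact: (integrableZl _ _ (intH n N)).
  split.
    have := integrableD measurableT IH1 i2.
    by apply: eq_integrable => //= x _; rewrite e EFinD.
  under eq_Rintegral do rewrite e.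
  rewrite RintegralD//= RintegralZl//= IH2 big_nat_recr//=.
  by have [_ _ _ ->] := HP N.
exists (fun s => limn (S ^~ s)); split.
- apply: (measurable_fun_cvg (h := S)); first by move=> N; exact: continuous_measurable_fun.
  by move=> x _; have [] := cS x.
- by exists M => s; have [_] := cS s; rewrite {2}/S big_nil subr0.
- move=> s sT; apply/cvg_lim; first exact: Rhausdorff.
  by apply: cvg_near_cst; apply: nearW => n; exact: S0.
- move=> n.
  pose g x := expR (- (lam n * x)) * M * \1_(`[0, T]%classic) x.
  have := @Rdominated_cvg R _ _ mu setT (fun N x => expR (- (lam n * x)) * S N x)
    (fun x => expR (- (lam n * x)) * limn (S ^~ x)) g measurableT.
  case.
  + by move=> N; have [/integrableP[/measurable_EFinP]] := intS n N.
  + by move=> x _; apply: cvgM; [exact: cvg_cst|have [] := cS x].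
  + have -> : EFin \o g = (EFin \o (fun x => expR (- (lam n * x)) * M)) \_ `[0, T].
      by apply/funext => x; rewrite /g /patch/= indicE; case: ifPn => _; rewrite ?mulr1 ?mulr0.
    apply/(integrable_mkcond _ _).1 => //; apply: continuous_compact_integrable.
      exact: segment_compact.
    apply: continuous_subspaceT => x; apply: cvgM; last exact: cvg_cst.
    exact: continuous_expRNM.
  + move=> N x _; rewrite /g normrM ger0_norm ?expR_ge0// -mulrA ler_wpM2l ?expR_ge0//.
    rewrite indicE; case: (boolP (x \in _)) => xb; first by rewrite mulr1.
    by rewrite mulr0 S0 ?normr0//; apply: contra xb => xb; rewrite inE.
  move=> _ cI; apply: (cvg_unique (@Rhausdorff R) cI).
  apply: cvg_near_cst; exists n.+1 => // N /= nN; rewrite (intS n N).2.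
  rewrite (big_cat_nat (n := n.+1))//= big_nat_recr//= eqxx mulr1.
  rewrite big_nat big1 ?add0r => [|i /andP[_ ni]]; last by rewrite gtn_eqF// mulr0.
  by rewrite big_nat big1 ?addr0// => i /andP[ni _]; rewrite ltn_eqF// mulr0.
Qed.

End moment_problem.

(** * Square integrable controls and their moments *)

Section integrability.
Context {R : realType} d (T : measurableType d) (m : {measure set T -> \bar R}).
Implicit Types (D : set T) (f g : T -> R).

Lemma le_Rintegrable D f g : measurable D -> measurable_fun D f ->
  (forall x, D x -> `|f x| <= g x) -> m.-integrable D (EFin \o g) ->
  m.-integrable D (EFin \o f).
Proof.
move=> mD mf fg ig; apply: le_integrable ig => //; first exact/measurable_EFinP.
by move=> x Dx /=; rewrite lee_fin (le_trans (fg x Dx))// ler_norm.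
Qed.

Lemma bounded_Rintegrable D f M : measurable D -> (m D < +oo)%E ->
  measurable_fun D f -> (forall x, D x -> `|f x| <= M) -> m.-integrable D (EFin \o f).
Proof.
move=> mD Doo mf fM; apply: measurable_bounded_integrable => //.
by exists M; split=> [|r Mr x Dx]; [exact: num_real|exact: le_trans (fM x Dx) (ltW Mr)].
Qed.

End integrability.

Lemma measurable_expRNM {R : realType} (D : set R) (m : R) :
  measurable_fun D (fun x => expR (- (m * x))).
Proof.
apply: measurable_funTS; apply: continuous_measurable_fun.
exact: continuous_expRNM.
Qed.

Lemma measurable_expRNM_comp {R : realType} (D : set R) (m : R) (g : R -> R) :
  measurable_fun D g -> measurable_fun D (fun x => expR (- (m * g x))).
Proof.
move=> mg; apply: (measurableT_comp (f := expR)) => //.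
by apply: measurable_funN; exact: measurable_funM.
Qed.

Section square_integrable.
Context {R : realType}.
Local Notation mu := (@lebesgue_measure R).
Implicit Types (D : set R) (u v f : R -> R) (T : R).

Definition L2r D u :=
  measurable_fun D u /\ mu.-integrable D (EFin \o (fun x => u x ^+ 2)).

Lemma L2rD D u v : measurable D -> L2r D u -> L2r D v -> L2r D (u \+ v).
Proof.
move=> mD [mu_ iu] [mv iv]; split; first exact: measurable_funD.
apply: (le_Rintegrable (m := mu) (g := fun x => 2 * u x ^+ 2 + 2 * v x ^+ 2)) => //.
- by apply: measurable_funX; exact: measurable_funD.
- move=> x _; rewrite ger0_norm ?sqr_ge0// /=; have := sqr_ge0 (u x - v x); nra.
- have i1 : mu.-integrable D (fun x => 2%:E * (u x ^+ 2)%:E)%E by exact: integrableZl.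
  have i2 : mu.-integrable D (fun x => 2%:E * (v x ^+ 2)%:E)%E by exact: integrableZl.
  have : mu.-integrable D (fun x => 2%:E * (u x ^+ 2)%:E + 2%:E * (v x ^+ 2)%:E)%E.
    exact: integrableD.
  by apply: eq_integrable.
Qed.

Lemma L2rZ D c u : measurable D -> L2r D u -> L2r D (fun x => c * u x).
Proof.
move=> mD [mu_ iu]; split; first exact: measurable_funM.
have : mu.-integrable D (fun x => (c ^+ 2)%:E * (u x ^+ 2)%:E)%E by exact: integrableZl.
by apply: eq_integrable => //= x _; rewrite exprMn EFinM.
Qed.

Lemma L2r_bounded D u M : measurable D -> (mu D < +oo)%E ->
  measurable_fun D u -> (forall x, D x -> `|u x| <= M) -> L2r D u.
Proof.
move=> mD Doo mu_ uM; split=> //; apply: (bounded_Rintegrable (m := mu) (M := M ^+ 2)) => //.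
  exact: measurable_funX.
by move=> x Dx; rewrite normrX lerXn2r ?nnegrE ?(le_trans _ (uM x Dx))// uM.
Qed.

Lemma L2r_integrable D u : measurable D -> (mu D < +oo)%E -> L2r D u ->
  mu.-integrable D (EFin \o u).
Proof.
move=> mD Doo [mu_ iu]; apply: (le_Rintegrable (m := mu) (g := fun x => 1 + u x ^+ 2)) => //.
  move=> x _; have := sqr_ge0 (`|u x| - 1); rewrite sqrrB expr1n mulr1 real_normK ?num_real//.
  by have := normr_ge0 (u x); nra.
have i1 : mu.-integrable D (EFin \o cst 1).
  by apply: (bounded_Rintegrable (m := mu) (M := 1)) => // x _; rewrite normr1.
by have : mu.-integrable D (fun x => 1%:E + (u x ^+ 2)%:E)%E by exact: integrableD.
Qed.

Lemma L2rS D D' u : measurable D -> measurable D' -> D' `<=` D -> L2r D u -> L2r D' u.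
Proof.
move=> mD mD' DD [mu_ iu]; split; first exact: measurable_funS mu_.
exact: integrableS iu.
Qed.

Lemma L2r_ext D u : measurable D -> L2r D u <-> L2r setT (u \_ D).
Proof.
move=> mD; split=> -[mu_ iu]; split.
- exact/(measurable_restrictT _ _).1.
- have -> : EFin \o (fun x => (u \_ D) x ^+ 2) = (EFin \o (fun x => u x ^+ 2)) \_ D.
    by apply/funext => x; rewrite /patch/=; case: ifPn; rewrite // expr0n.
  exact/(integrable_mkcond _ _).1.
- exact/(measurable_restrictT _ _).2.
- apply/(integrable_mkcond _ _).2 => //.
  have -> // : (EFin \o (fun x => u x ^+ 2)) \_ D = EFin \o (fun x => (u \_ D) x ^+ 2).
  by apply/funext => x; rewrite /patch/=; case: ifPn; rewrite // expr0n.
Qed.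

Lemma L2r_reflect u c : L2r setT u -> L2r setT (fun s => u (c - s)).
Proof.
move=> [mu_ iu]; split.
  by apply: (measurableT_comp mu_); exact: measurable_reflect.
exact: (integrable_reflect c iu).
Qed.

Lemma reflect_itv T (s : R) : (T - s \in `]0, T[) = (s \in `]0, T[).
Proof. by rewrite !in_itv/=; apply/idP/idP => /andP[? ?]; apply/andP; split; lra. Qed.

Lemma Rintegral_reflect_itv T f : measurable_fun `]0, T[ f ->
  \int[mu]_(s in `]0, T[) f (T - s) = \int[mu]_(s in `]0, T[) f s.
Proof.
move=> mf; rewrite [LHS]Rintegral_mkcond [RHS]Rintegral_mkcond.
rewrite -(Rintegral_reflect T (f := f \_ `]0, T[)); last exact/(measurable_restrictT _ _).1.
apply: eq_Rintegral => s _; rewrite /patch.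
by rewrite !mem_setE reflect_itv.
Qed.

Lemma measurable_reflect_itv T f : measurable_fun `]0, T[ f ->
  measurable_fun `]0, T[ (fun s => f (T - s)).
Proof.
move=> mf; apply: (measurable_comp (F := `]0, T[)) => //.
  by move=> _ [s /= sT <-]; rewrite -(reflect_itv T) subKr.
exact: measurable_funB.
Qed.

End square_integrable.

Section steering.
Context {R : realType}.
Local Notation mu := (@lebesgue_measure R).
Implicit Types (T S : R) (u : R -> R).

(** The coefficient along cos (n pi x), at time [T], of the heat flow in (0, 1)
    with inward flux [u] at x = 0, inward meaning into the interval. *)
Definition moment T u (n : nat) : R :=
  \int[mu]_(s in `]0, T[) (expR (- (lam n * (T - s))) * u s).

Lemma fin_itv (a b : R) : (mu `]a, b[ < +oo)%E.
Proof. by rewrite /= lebesgue_measure_itv/=; case: ifP => // _; rewrite -EFinB ltry. Qed.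

Lemma momentE T u n : measurable_fun `]0, T[ u ->
  moment T u n = \int[mu]_(s in `]0, T[) (expR (- (lam n * s)) * u (T - s)).
Proof.
move=> mu_; rewrite /moment -[RHS]Rintegral_reflect_itv; last first.
  apply: measurable_funM; last exact: measurable_reflect_itv.
  exact: measurable_expRNM.
by apply: eq_Rintegral => s _; rewrite subKr.
Qed.

Lemma lam_ge0 n : 0 <= lam n :> R. Proof. exact: sqr_ge0. Qed.

Lemma expR_lam_le1 n (s : R) : 0 <= s -> expR (- (lam n * s)) <= 1.
Proof. by move=> s0; rewrite -expR0 ler_expR oppr_le0 mulr_ge0// lam_ge0. Qed.

Lemma control_moments T (b : nat -> R) (B : R) : 0 < T -> (forall n, `|b n| <= B) ->
  exists u, L2r `]0, T[ u /\ forall n, moment T u n = expR (- (lam n * T)) * b n.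
Proof.
move=> T0 /(moment_problem T0)[h [mh [M hM] hs hm]].
have mu_ : measurable_fun setT (fun s : R => h (T - s)).
  by apply: (measurableT_comp mh); exact: measurable_reflect.
exists (fun s => h (T - s)); split.
  apply: (L2r_bounded (M := M)) => //; [exact: fin_itv|exact: measurable_funTS].
move=> n; rewrite momentE; last exact: measurable_funTS.
under eq_Rintegral do rewrite subKr.
pose f s := expR (- (lam n * s)) * h s.
have mf : measurable_fun setT f.
  by apply: measurable_funM => //; exact: measurable_expRNM.
have intf (b1 b2 : bool) : mu.-integrable [set` Interval (BSide b1 0) (BSide b2 T)] (EFin \o f).
  apply: (bounded_Rintegrable (m := mu) (M := M)) => //.
  - by rewrite /= lebesgue_measure_itv/=; case: ifP => // _; rewrite -EFinB ltry.
  - exact: measurable_funTS.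
  - move=> x /=; rewrite in_itv/= => /andP[x0 _].
    have {}x0 : 0 <= x by case: b1 x0 => //= /ltW.
    rewrite /f normrM ger0_norm ?expR_ge0// -[M]mul1r ler_pM ?expR_ge0//.
    exact: expR_lam_le1.
rewrite -hm -/f Rintegral_itv_bndo_bndc; last exact: intf.
rewrite Rintegral_itv_obnd_cbnd; last exact: intf.
rewrite Rintegral_mkcond; apply: eq_Rintegral => s _; rewrite /patch.
by rewrite mem_setE; case: ifPn => // sT; rewrite /f hs ?mulr0.
Qed.

(** In reversed time the part of the control acting before time [S - T] lies
    beyond [T], so that its moments carry the factor exp (- lam n * T) that a
    control on (0, T) needs in order to reproduce them. *)
Lemma moment_transfer T S u : 0 < T -> L2r `]0, S[ u ->
  exists u', L2r `]0, T[ u' /\ forall n, moment T u' n = moment S u n.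
Proof.
move=> T0 uL.
pose v := u \_ `]0, S[; pose U s := v (S - s).
have UL : L2r setT U by apply: L2r_reflect; exact: (L2r_ext u (measurable_itv _)).1 uL.
have [mU _] := UL.
have Us s : s \notin `]0, S[ -> U s = 0.
  move=> sS; rewrite /U /v /patch ifF//; apply/negbTE.
  by rewrite mem_setE reflect_itv.
have iU : mu.-integrable setT (EFin \o U).
  apply: integrable_reflect; rewrite /v.
  have -> : EFin \o u \_ `]0, S[ = (EFin \o u) \_ `]0, S[.
    by apply/funext => x; rewrite /patch/=; case: ifP.
  apply/(integrable_mkcond _ _).1 => //; apply: L2r_integrable => //; exact: fin_itv.
(* The moments of the early part of the control, without the factor
   exp (- lam n T). *)
pose b n := \int[mu]_(s in `[T, +oo[) (expR (- (lam n * (s - T))) * U s).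
have ibU n : mu.-integrable `[T, +oo[ (EFin \o (fun s => expR (- (lam n * (s - T))) * U s)).
  apply: (le_Rintegrable (m := mu) (g := fun s => `|U s|)) => //.
  - apply/measurable_funTS/measurable_funM => //.
    by apply: measurable_expRNM_comp; exact: measurable_funB.
  - move=> s /=; rewrite in_itv/= andbT => Ts.
    rewrite normrM ger0_norm ?expR_ge0// -[leRHS]mul1r ler_wpM2r//.
    by apply: expR_lam_le1; lra.
  - by apply: integrableS (integrable_norm iU).
have bB n : `|b n| <= \int[mu]_(s in `[T, +oo[) `|U s|.
  apply: le_trans (le_normr_Rintegral _ (ibU n)) _ => //.
  apply: le_Rintegral => //; first exact: integrable_norm (ibU n).
    by apply: integrableS (integrable_norm iU).
  move=> s /=; rewrite in_itv/= andbT => Ts.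
  rewrite normrM ger0_norm ?expR_ge0// -[leRHS]mul1r ler_wpM2r//.
  by apply: expR_lam_le1; lra.
have [w [wL wm]] := control_moments T0 bB.
have UTL : L2r `]0, T[ (fun s => U (T - s)).
  by apply: (@L2rS _ setT) => //; exact: L2r_reflect.
exists ((fun s => U (T - s)) \+ w); split; first exact: L2rD.
move=> n; have iE u1 : L2r `]0, T[ u1 ->
    mu.-integrable `]0, T[ (EFin \o (fun s => expR (- (lam n * (T - s))) * u1 s)).
  move=> u1L; have [mu1 _] := u1L.
  apply: (le_Rintegrable (m := mu) (g := fun s => `|u1 s|)) => //.
  - apply: measurable_funM => //; apply/measurable_funTS.
    by apply: measurable_expRNM_comp; exact: measurable_funB.
  - move=> s /=; rewrite in_itv/= => /andP[s0 sT].
    rewrite normrM ger0_norm ?expR_ge0// -[leRHS]mul1r ler_wpM2r//.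
    by apply: expR_lam_le1; lra.
  - by apply: integrable_norm; apply: L2r_integrable => //; exact: fin_itv.
rewrite /moment; under eq_Rintegral do rewrite mulrDr.
rewrite RintegralD//=; [|exact: iE|exact: iE].
rewrite -!/(moment _ _ _) wm [moment T _ n]momentE; last by have [] := UTL.
under eq_Rintegral do rewrite subKr.
rewrite /b -RintegralZl//.
rewrite [X in _ + X](_ : _ = \int[mu]_(s in `[T, +oo[) (expR (- (lam n * s)) * U s)); last first.
  by apply: eq_Rintegral => s _; rewrite mulrA -expRD; congr (expR _ * _); ring.
rewrite momentE; last by have [] := uL.
have iEU : mu.-integrable `]0, +oo[ (EFin \o (fun s => expR (- (lam n * s)) * U s)).
  apply: (le_Rintegrable (m := mu) (g := fun s => `|U s|)) => //.
  - apply: measurable_funTS; apply: measurable_funM; [exact: measurable_expRNM|exact: mU].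
  - move=> s /=; rewrite in_itv/= andbT => s0.
    rewrite normrM ger0_norm ?expR_ge0// -[leRHS]mul1r ler_wpM2r//.
    by apply: expR_lam_le1; lra.
  - by apply: integrableS (integrable_norm iU).
have e : `]0, +oo[%classic = `]0, T[ `|` `[T, +oo[ :> set R.
  by rewrite (@itv_bndbnd_setU _ _ _ (BLeft T))// bnd_simp.
rewrite -Rintegral_setU//=; last 2 first.
- by rewrite -e.
- apply/disj_setPS => s /= []; rewrite !in_itv/= andbT => /andP[_ sT] Ts; lra.
rewrite -e [LHS]Rintegral_mkcond [RHS]Rintegral_mkcond; apply: eq_Rintegral => s _; rewrite /patch !mem_setE.
case: ifPn => s0; last first.
  rewrite ifF//; apply: contraNF s0; rewrite !in_itv/= => /andP[-> _]//.
case: ifPn => sS; last by rewrite Us ?mulr0.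
by rewrite /U /v /patch mem_setE reflect_itv sS.
Qed.

End steering.

(** * Uniform density of cosine polynomials *)

Section bernstein.
Context {R : realType}.
Implicit Types (f g : nat -> R) (y : R).

(** The expectation of [f] at a binomial variable of parameters [N] and [y],
    in the recursive form in which positivity and the moments are immediate. *)
Fixpoint bern N f y : R :=
  if N is M.+1 then (1 - y) * bern M f y + y * bern M (fun k => f k.+1) y
  else f 0%N.

Lemma ler_bern N f g y : 0 <= y <= 1 -> (forall k, (k <= N)%N -> f k <= g k) ->
  bern N f y <= bern N g y.
Proof.
move=> /andP[y0 y1]; elim: N f g => [|N IH] f g fg /=; first exact: fg.
apply: lerD; apply: ler_wpM2l; rewrite ?subr_ge0//; apply: IH => k kN; apply: fg => //.
exact: leqW.
Qed.

(** The mean and the variance of the binomial law. *)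
Lemma bern_quad N (A B c y : R) :
  bern N (fun k => A + B * (k%:R + c) ^+ 2) y =
  A + B * ((c + N%:R * y) ^+ 2 + N%:R * (y * (1 - y))).
Proof.
elim: N c => [|N IH] c /=; first by rewrite !mul0r !add0r !addr0.
have -> : (fun k => A + B * (k.+1%:R + c) ^+ 2) = (fun k => A + B * (k%:R + (1 + c)) ^+ 2).
  by apply/funext => k; rewrite -natr1 addrA.
rewrite !IH -natr1; ring.
Qed.

End bernstein.

Section cosine_polynomials.
Context {R : realType}.
Implicit Types (f g : R -> R) (x : R).

Inductive cospoly : (R -> R) -> Prop :=
| cospoly_cos (k : nat) (c : R) : cospoly (fun x => c * cos (k%:R * pi * x))
| cospoly_add f g : cospoly f -> cospoly g -> cospoly (fun x => f x + g x).

Lemma cospoly_cst c : cospoly (fun=> c).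
Proof.
have -> : (fun=> c) = (fun x : R => c * cos (0%:R * pi * x)).
  by apply/funext => x; rewrite !mul0r cos0 mulr1.
exact: cospoly_cos.
Qed.

Lemma cospolyZ a f : cospoly f -> cospoly (fun x => a * f x).
Proof.
elim=> [k c|g h _ IHg _ IHh].
  have -> : (fun x => a * (c * cos (k%:R * pi * x))) = (fun x => (a * c) * cos (k%:R * pi * x)).
    by apply/funext => x; rewrite mulrA.
  exact: cospoly_cos.
have -> : (fun x => a * (g x + h x)) = (fun x => a * g x + a * h x).
  by apply/funext => x; rewrite mulrDr.
exact: cospoly_add.
Qed.

(** Product-to-sum formula. *)
Lemma cospolyM f : cospoly f -> cospoly (fun x => cos (pi * x) * f x).
Proof.
elim=> [k c|g h _ IHg _ IHh]; last first.
  have -> : (fun x => cos (pi * x) * (g x + h x)) =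
      (fun x => cos (pi * x) * g x + cos (pi * x) * h x).
    by apply/funext => x; rewrite mulrDr.
  exact: cospoly_add.
case: k => [|k].
  have -> : (fun x => cos (pi * x) * (c * cos (0%:R * pi * x))) = (fun x => c * cos (1%:R * pi * x)).
    by apply/funext => x; rewrite !mul0r cos0 mul1r mulr1 mulrC.
  exact: cospoly_cos.
have -> : (fun x => cos (pi * x) * (c * cos (k.+1%:R * pi * x))) =
    (fun x => c / 2 * cos (k.+2%:R * pi * x) + c / 2 * cos (k%:R * pi * x)).
  apply/funext => x.
  have -> : k.+2%:R * pi * x = k.+1%:R * pi * x + pi * x by rewrite -[k.+2%:R]natr1; ring.
  have -> : k%:R * pi * x = k.+1%:R * pi * x - pi * x by rewrite -[k.+1%:R]natr1; ring.
  by rewrite cosD cosB; field.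
by apply: cospoly_add; exact: cospoly_cos.
Qed.

(** A change of variable from [0, 1] to itself that turns polynomials into
    cosine polynomials. *)
Definition cosvar x : R := (1 + cos (pi * x)) / 2.

Lemma cospoly_bern N (f : nat -> R) : cospoly (fun x => bern N f (cosvar x)).
Proof.
elim: N f => [|N IH] f /=; first exact: cospoly_cst.
have -> : (fun x => (1 - cosvar x) * bern N f (cosvar x) +
      cosvar x * bern N (fun k => f k.+1) (cosvar x)) =
    (fun x => (2^-1 * bern N f (cosvar x) + - 2^-1 * (cos (pi * x) * bern N f (cosvar x))) +
     (2^-1 * bern N (fun k => f k.+1) (cosvar x) +
      2^-1 * (cos (pi * x) * bern N (fun k => f k.+1) (cosvar x)))).
  by apply/funext => x; rewrite /cosvar; field.
by apply: cospoly_add; apply: cospoly_add; apply: cospolyZ => //; exact: cospolyM.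
Qed.

Lemma cosvar_itv x : 0 <= cosvar x <= 1.
Proof.
have := cos_geN1 (pi * x); have := cos_le1 (pi * x); rewrite /cosvar => ? ?.
by apply/andP; split; lra.
Qed.

Lemma continuous_cosvar : continuous cosvar.
Proof.
move=> x; rewrite /cosvar; apply: cvgM; last exact: cvg_cst.
apply: cvgD; first exact: cvg_cst.
apply: (continuous_comp (f := fun x => pi * x) (g := cos)); last exact: continuous_cos.
exact: mulrl_continuous.
Qed.

Lemma cosvar_inj : {in `[0, 1] &, injective cosvar}.
Proof.
move=> a b; rewrite !in_itv/= => /andP[a0 a1] /andP[b0 b1] ab.
have h z : 0 <= z -> z <= 1 -> pi * z \in `[0, pi]%R.
  move=> z0 z1; rewrite in_itv/= mulr_ge0 ?pi_ge0//=.
  by rewrite ler_piMr// pi_ge0.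
have : cos (pi * a) = cos (pi * b) by move: ab; rewrite /cosvar; lra.
move=> /(congr1 (@acos R)); rewrite !cosK ?h// => /mulfI; apply.
by rewrite gt_eqF// pi_gt0.
Qed.

(** A modulus of continuity of [f] in terms of the injective variable
    [cosvar], shaped so that the variance of the binomial law bounds it. *)
Lemma quadratic_modulus f (e : R) : 0 < e -> continuous f ->
  exists2 M : R, 0 <= M & {in `[0, 1] &, forall a b,
    `|f a - f b| <= e + M * (cosvar a - cosvar b) ^+ 2}.
Proof.
move=> e0 cf.
pose K : set (R * R) := (`[0, 1]%classic `*` `[0, 1]%classic).
have cK : compact K by apply: compact_setX; exact: segment_compact.
have c1 (h : R -> R) : continuous h -> continuous (fun z : R * R => h z.1).
  by move=> ch z; apply: (continuous_comp (f := fst) (g := h)); [exact: cvg_fst|exact: ch].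
have c2 (h : R -> R) : continuous h -> continuous (fun z : R * R => h z.2).
  by move=> ch z; apply: (continuous_comp (f := snd) (g := h)); [exact: cvg_snd|exact: ch].
(* Pairs with |f a - f b| >= e form a compact set off the diagonal, where the
   quadratic distance has a positive minimum. *)
pose d (z : R * R) := `|f z.1 - f z.2|.
pose g (z : R * R) := (cosvar z.1 - cosvar z.2) ^+ 2.
have cd : continuous d.
  move=> z; apply: (@cvg_norm _ _ _ _ _ (fun z : R * R => f z.1 - f z.2)).
  by apply: cvgB; [exact: c1|exact: c2].
have cg : continuous g.
  have -> : g = (fun z => (cosvar z.1 - cosvar z.2) * (cosvar z.1 - cosvar z.2)).
    by apply/funext => z; rewrite /g expr2.
  move=> z.
  by apply: cvgM; apply: cvgB; [exact/c1/continuous_cosvar|exact/c2/continuous_cosvar|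
    exact/c1/continuous_cosvar|exact/c2/continuous_cosvar].
pose K' := K `&` [set z | e <= d z].
have cK' : compact K'.
  apply: compact_closedI => //.
  by apply: (preimage_closed (f := d) _ (closed_ge (y := e))) => z _; exact: cd.
have [K'0|K'0] := eqVneq K' set0.
  exists 0 => // a b a01 b01; rewrite mul0r addr0 leNgt; apply/negP => /ltW ead.
  have : K' (a, b) by split.
  by rewrite K'0.
move/set0P in K'0.
have [z1 K'z1 z1max] := compact_EVT_max K'0 cK' (continuous_subspaceT cd).
have [z2 K'z2 z2min] := compact_EVT_min K'0 cK' (continuous_subspaceT cg).
have gz2 : 0 < g z2.
  rewrite lt_def sqr_ge0 andbT sqrf_eq0 subr_eq0; apply/eqP => /cosvar_inj h.
  have [[z21 z22] /= ez] := set_mem K'z2.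
  by move: ez; rewrite /d h// subrr normr0; lra.
have dz1 : 0 <= d z1 by exact: normr_ge0.
exists (d z1 / g z2) => [|a b a01 b01]; first by rewrite divr_ge0// ltW.
have [le|lt] := leP `|f a - f b| e.
  by rewrite (le_trans le)// lerDl mulr_ge0 ?sqr_ge0 ?divr_ge0// ltW.
have K'ab : (a, b) \in K' by apply/mem_set; split => //=; exact: ltW.
have h1 := z1max _ K'ab; have h2 := z2min _ K'ab.
rewrite (le_trans h1)// ler_wpDl ?(ltW e0)// -mulrA ler_peMr//.
by rewrite mulrC ler_pdivlMr// mul1r.
Qed.

(** Bernstein's proof of the Weierstrass theorem in the variable [cosvar]: the
    quadratic modulus of continuity is averaged over the binomial law, whose
    variance is O(1 / N) after normalization. *)
Lemma cospoly_dense f (e : R) : 0 < e -> continuous f ->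
  exists2 p, cospoly p & {in `[0, 1], forall x, `|f x - p x| <= e}.
Proof.
move=> e0 cf; have e20 : 0 < e / 2 by lra.
have [M M0 fM] := quadratic_modulus e20 cf.
pose N := (Num.truncn (M / (e / 2))).+1.
have N0 : (0 : R) < N%:R by rewrite ltr0n.
have NM : M / N%:R <= e / 2.
  rewrite ler_pdivrMr// -ler_pdivrMl// mulrC ltW//.
  exact: truncnS_gt.
pose node (k : nat) : R := acos (2 * (k%:R / N%:R) - 1) / pi.
have nodeP k : (k <= N)%N -> node k \in `[0, 1]%R /\ cosvar (node k) = k%:R / N%:R.
  move=> kN; have k01 : -1 <= (2 * (k%:R / N%:R) - 1 : R) <= 1.
    have h0 : (0 : R) <= k%:R / N%:R by rewrite divr_ge0.
    have h1 : k%:R / N%:R <= 1 :> R by rewrite ler_pdivrMr// mul1r ler_nat.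
    by apply/andP; split; lra.
  rewrite /node; split.
    rewrite in_itv/= divr_ge0 ?acos_ge0 ?pi_ge0//=.
    by rewrite ler_pdivrMr ?pi_gt0// mul1r acos_lepi.
  rewrite /cosvar [pi * _]mulrC divfK ?gt_eqF ?pi_gt0// acosK//; first by field; lra.
pose F k := f (node k).
exists (fun x => bern N F (cosvar x)); first exact: cospoly_bern.
move=> x x01; set y := cosvar x.
have y01 := cosvar_itv x; rewrite -/y in y01.
have key (B : R) : bern N (fun k => f x + B * (e / 2) + B * M / N%:R ^+ 2 * (k%:R + - (N%:R * y)) ^+ 2) y
    = f x + B * (e / 2 + M / N%:R * (y * (1 - y))).
  by rewrite bern_quad addNr expr0n/= add0r; field; lra.
have dF k : (k <= N)%N -> `|f x - F k| <= e / 2 + M / N%:R ^+ 2 * (k%:R + - (N%:R * y)) ^+ 2.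
  move=> kN; have [k01 kE] := nodeP k kN; apply: le_trans (fM _ _ x01 k01) _.
  by rewrite kE -/y lerD2l le_eqVlt; apply/orP; left; apply/eqP; field; lra.
have yy : 0 <= y * (1 - y) <= 1 by case/andP: y01 => ? ?; apply/andP; split; nra.
have Me : M / N%:R * (y * (1 - y)) <= e / 2.
  apply: le_trans NM; rewrite ler_piMr ?divr_ge0// ?(ltW N0)//; by case/andP: yy.
have up : bern N F y <= f x + 1 * (e / 2 + M / N%:R * (y * (1 - y))).
  rewrite -key; apply: ler_bern => // k kN.
  by have := dF k kN; rewrite distrC ler_norml => /andP[_]; rewrite !mul1r; lra.
have lo : f x + -1 * (e / 2 + M / N%:R * (y * (1 - y))) <= bern N F y.
  rewrite -key; apply: ler_bern => // k kN.
  have := dF k kN; rewrite ler_norml => /andP[_]; rewrite !mulN1r !mulNr; lra.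
by rewrite ler_norml; apply/andP; split; lra.
Qed.

End cosine_polynomials.

(** * Completeness of the cosines *)

Section cosine_completeness.
Context {R : realType}.
Local Notation mu := (@lebesgue_measure R).
Implicit Types (f g : R -> R).

Definition cosn (n : nat) : R -> R := fun x => cos (n%:R * pi * x).

Lemma continuous_cosn n : continuous (cosn n).
Proof.
move=> x; apply: (continuous_comp (f := fun x => n%:R * pi * x) (g := cos)).
  exact: mulrl_continuous.
exact: continuous_cos.
Qed.

Lemma cospoly_continuous f : cospoly f -> continuous f.
Proof.
elim=> [k c x|h1 h2 _ c1 _ c2 x]; last by apply: cvgD; [exact: c1|exact: c2].
by apply: cvgM; [exact: cvg_cst|exact: continuous_cosn].
Qed.

Lemma continuous_bounded01 f : continuous f ->
  exists2 M : R, 0 <= M & forall x, x \in `[0, 1] -> `|f x| <= M.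
Proof.
move=> cf; have cn : continuous (fun x => `|f x|) by move=> x; apply: cvg_norm; exact: cf.
have [c c01 cmax] := EVT_max ler01 (continuous_subspaceT cn).
by exists `|f c| => // x x01; exact: cmax.
Qed.

Lemma integrable_mul_continuous f g : mu.-integrable `]0, 1[ (EFin \o g) ->
  continuous f -> mu.-integrable `]0, 1[ (EFin \o (fun x => g x * f x)).
Proof.
move=> ig cf; have [M M0 fM] := continuous_bounded01 cf.
apply: (le_Rintegrable (m := mu) (g := fun x => M * `|g x|)) => //.
- apply: measurable_funM; first by case/integrableP : ig => /measurable_EFinP.
  by apply: measurable_funTS; exact: continuous_measurable_fun.
- move=> x x01; rewrite normrM mulrC ler_wpM2r// fM//.
  exact: (subset_itv_oo_cc x01).
- have : mu.-integrable `]0, 1[ (fun x => M%:E * `|(g x)%:E|)%E.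
    by apply: integrableZl => //; exact: integrable_abse.
  by apply: eq_integrable.
Qed.

Lemma orthogonal_cos_continuous g : mu.-integrable `]0, 1[ (EFin \o g) ->
  (forall n, \int[mu]_(x in `]0, 1[) (g x * cosn n x) = 0) ->
  forall f, continuous f -> \int[mu]_(x in `]0, 1[) (g x * f x) = 0.
Proof.
move=> ig g0.
have gp p : cospoly p -> \int[mu]_(x in `]0, 1[) (g x * p x) = 0.
  elim=> [k c|p1 p2 c1 IH1 c2 IH2].
    under eq_Rintegral do rewrite mulrCA.
    rewrite RintegralZl//; first by rewrite -/(cosn k) g0 mulr0.
    exact: (integrable_mul_continuous ig (@continuous_cosn k)).
  under eq_Rintegral do rewrite mulrDr.
  rewrite RintegralD//; first by rewrite IH1 IH2 addr0.
    exact: (integrable_mul_continuous ig (cospoly_continuous c1)).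
  exact: (integrable_mul_continuous ig (cospoly_continuous c2)).
move=> f cf; apply/eqP; rewrite -normr_eq0 eq_le normr_ge0 andbT.
have in_ : mu.-integrable `]0, 1[ (EFin \o (fun x => `|g x|)) by exact: integrable_norm.
set N := \int[mu]_(x in `]0, 1[) `|g x|.
have N0 : 0 <= N by apply: Rintegral_ge0.
apply/ler_addgt0Pr => e e0; rewrite add0r.
have d0 : 0 < e / (N + 1) by rewrite divr_gt0// ltr_wpDl.
have [p cp fp] := cospoly_dense d0 cf.
have if_ := integrable_mul_continuous ig cf.
have ip := integrable_mul_continuous ig (cospoly_continuous cp).
have -> : \int[mu]_(x in `]0, 1[) (g x * f x) = \int[mu]_(x in `]0, 1[) (g x * (f x - p x)).
  under [RHS]eq_Rintegral do rewrite mulrBr.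
  by rewrite RintegralB// (gp p cp) subr0.
have cfp : continuous (fun x => f x - p x).
  by move=> x; apply: cvgB; [exact: cf|exact: cospoly_continuous].
have ifp := integrable_mul_continuous ig cfp.
apply: le_trans (le_normr_Rintegral _ ifp) _ => //.
apply: (@le_trans _ _ (\int[mu]_(x in `]0, 1[) (e / (N + 1) * `|g x|))).
  apply: le_Rintegral => //; first exact: integrable_norm.
    have : mu.-integrable `]0, 1[ (fun x => (e / (N + 1))%:E * `|g x|%:E)%E by exact: integrableZl.
    by apply: eq_integrable.
  move=> x x01; rewrite normrM mulrC ler_wpM2r//; apply: fp.
  exact: (subset_itv_oo_cc x01).
rewrite RintegralZl// -/N -mulrA ler_piMr ?(ltW e0)//.
by rewrite mulrC ler_pdivrMr ?mul1r ?lerDl// ltr_wpDl.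
Qed.

(** Indicators of half lines are bounded limits of continuous ramps, so that every
    primitive of g is constant and Lebesgue differentiation gives g = 0. *)
Lemma cosine_complete g : mu.-integrable `]0, 1[ (EFin \o g) ->
  (forall n, \int[mu]_(x in `]0, 1[) (g x * cosn n x) = 0) ->
  {ae mu, forall x, x \in `]0, 1[ -> g x = 0}.
Proof.
move=> ig g0; have gc := orthogonal_cos_continuous ig g0.
pose f := g \_ `]0, 1[.
have if_ : mu.-integrable setT (EFin \o f).
  rewrite (_ : EFin \o f = (EFin \o g) \_ `]0, 1[); last first.
    by apply/funext => x; rewrite /f /patch/=; case: ifP.
  exact/(integrable_mkcond _ _).1.
have F0 x : \int[mu]_(y in `]-oo, x]) f y = 0.
  (* A ramp from 1 at x - 1 / N down to 0 at x. *)
  pose rho (N : nat) (y : R) : R := Num.min (Num.max 0 (N%:R * (x - y))) 1.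
  have rho01 N y : 0 <= rho N y <= 1.
    by rewrite /rho le_min le_max lexx ler01/= ge_min lexx orbT.
  have crho N : continuous (rho N).
    apply: (lipschitz_continuous (L := N%:R)) => s t.
    apply: le_trans (lip_min _ _ _) _; apply: le_trans (lip_max _ _) _.
    by rewrite -mulrBr normrM ger0_norm// (_ : x - s - (x - t) = t - s) ?[`|t - s|]distrC//; ring.
  have rlim y : rho N y @[N --> \oo] --> (\1_(`]-oo, x[%classic) y : R).
    rewrite indicE; case: (boolP (y \in _)) => [|]; rewrite ?inE ?notin_setE/= in_itv/= => yx.
      apply: cvg_near_cst.
      have xy0 : 0 < x - y by lra.
      exists (Num.truncn (x - y)^-1).+1 => // N /= Nn; rewrite /rho (min_idPr _)//.
      rewrite le_max; apply/orP; right.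
      have : (x - y)^-1 <= N%:R.
        by rewrite (le_trans (ltW (truncnS_gt _)))// ler_nat.
      by move=> h; rewrite -ler_pdivrMr// div1r.
    apply: cvg_near_cst; apply: nearW => N; rewrite /rho (max_idPl _)//.
      by rewrite (min_idPl _).
    by rewrite mulr_ge0_le0// subr_le0 leNgt; exact/negP.
  have [||||_] := @Rdominated_cvg R _ _ mu `]0, 1[%classic (fun N y => g y * rho N y)
    (fun y => g y * \1_(`]-oo, x[%classic) y) (fun y => `|g y|) (measurable_itv _).
  - by move=> N; case/integrableP : (integrable_mul_continuous ig (crho N)) => /measurable_EFinP.
  - by move=> y _; apply: cvgM; [exact: cvg_cst|exact: rlim].
  - exact: integrable_norm.
  - move=> N y _; rewrite normrM ler_piMr//; have /andP[r0 r1] := rho01 N y.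
    by rewrite ger0_norm.
  under eq_fun do rewrite gc//.
  move=> /(cvg_unique (@Rhausdorff R) (cvg_cst 0)) ->.
  rewrite -Rintegral_itv_bndo_bndc; last exact: integrableS if_.
  rewrite [LHS]Rintegral_mkcond [RHS]Rintegral_mkcond.
  apply: eq_Rintegral => y _; rewrite /f /patch indicE.
  by case: ifP => _; case: ifP => _; rewrite ?mulr1 ?mulr0.
have /= := @FTC1Ny R f.
have h1 : forall y, mu.-integrable `]-oo, y] (EFin \o f) by move=> y; exact: integrableS if_.
move=> /(_ h1 (open_integrable_locally openT if_)).
apply: (@filterS _ _ (ae_filter_ringOfSetsType mu)) => x [_]; rewrite (_ : (fun x => _) = cst 0); last exact/funext.
rewrite derive1_cst /f /patch => h x01; rewrite ifT in h => //.
by rewrite inE.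
Qed.

End cosine_completeness.

(** * The heat kernel on the line *)

Section derivatives.
Context {R : realType}.
Implicit Types (w x : R).

Lemma is_derive_scaled (f df : R -> R) w x : is_derive (w * x) 1 f (df (w * x)) ->
  is_derive x 1 (fun x => f (w * x)) (w * df (w * x)).
Proof.
move=> hf.
have hg : is_derive x 1 (fun x => w * x) w.
  by apply: is_derive_eq; rewrite /GRing.scale/= mulr1.
have h := @is_derive1_comp R f (fun x => w * x) x _ _ hf hg.
by apply: (is_derive_eq h); rewrite mulrC.
Qed.

Lemma is_derive_mul (f g : R -> R) (df dg x : R) : is_derive x 1 f df -> is_derive x 1 g dg ->
  is_derive x 1 (fun x => f x * g x) (df * g x + f x * dg).
Proof.
move=> hf hg; have h := @is_deriveM R R f g x 1 df dg hf hg.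
by apply: (is_derive_eq h); rewrite /GRing.scale/= addrC [g x * df]mulrC.
Qed.

Lemma is_derive_mulc (f : R -> R) (c df x : R) : is_derive x 1 f df ->
  is_derive x 1 (fun x => c * f x) (c * df).
Proof.
move=> hf; have h := is_derive_mul (is_derive_cst c x 1) hf.
by apply: (is_derive_eq h); rewrite mul0r add0r.
Qed.

Lemma is_derive_cosM w x : is_derive x 1 (fun x => cos (w * x)) (- w * sin (w * x)).
Proof. by apply: (is_derive_eq (is_derive_scaled (df := fun y => - sin y) (is_derive_cos (w * x)))); rewrite mulrN mulNr. Qed.

Lemma is_derive_sinM w x : is_derive x 1 (fun x => sin (w * x)) (w * cos (w * x)).
Proof. exact: (is_derive_scaled (df := cos) (is_derive_sin (w * x))). Qed.

Lemma is_derive_expRM w x : is_derive x 1 (fun x => expR (w * x)) (w * expR (w * x)).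
Proof. exact: (is_derive_scaled (df := expR) (is_derive_expR (w * x))). Qed.

Lemma is_derive_gaussian (a x : R) :
  is_derive x 1 (fun x => expR (- (a * x ^+ 2))) (- (2 * a * x) * expR (- (a * x ^+ 2))).
Proof.
have hg : is_derive x 1 (fun x => - (a * x ^+ 2)) (- (2 * a * x)).
  apply: is_derive_eq; rewrite /GRing.scale/= !mulr1; ring.
have h := @is_derive1_comp R expR (fun x => - (a * x ^+ 2)) x _ _ (is_derive_expR _) hg.
by apply: (is_derive_eq h); rewrite mulrC.
Qed.

End derivatives.

Section gaussian.
Context {R : realType}.
Local Notation mu := (@lebesgue_measure R).
Implicit Types (x t w : R).

(** The heat kernel on the line; it vanishes for t <= 0 because [Num.sqrt] does. *)
Definition gk x t : R := (2 * Num.sqrt pi * Num.sqrt t)^-1 * expR (- (x ^+ 2 / (4 * t))).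

Lemma gk_ge0 x t : 0 <= gk x t.
Proof. by rewrite mulr_ge0 ?expR_ge0// invr_ge0 !mulr_ge0// sqrtr_ge0. Qed.

Lemma gkN x t : gk (- x) t = gk x t.
Proof. by rewrite /gk sqrrN. Qed.

Lemma gk0 x t : t <= 0 -> gk x t = 0.
Proof. by move=> t0; rewrite /gk (ler0_sqrtr t0) mulr0 invr0 mul0r. Qed.

Lemma gk_pdf t : 0 < t -> gk ^~ t = normal_pdf 0 (Num.sqrt (2 * t)).
Proof.
move=> t0; have s0 : Num.sqrt (2 * t) != 0 by rewrite gt_eqF// sqrtr_gt0 mulr_gt0.
rewrite normal_pdfE//; apply/funext => x; rewrite /gk; congr (_ * _).
  rewrite /normal_peak sqr_sqrtr ?mulr_ge0 ?(ltW t0)//; congr (_^-1).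
  rewrite (_ : 2 * t * pi *+ 2 = 2 ^+ 2 * (pi * t)); last by rewrite -mulr_natl; ring.
  by rewrite sqrtrM// sqrtr_sqr ger0_norm// sqrtrM ?pi_ge0// mulrA.
rewrite /normal_fun sqr_sqrtr ?mulr_ge0 ?(ltW t0)//; congr expR.
by rewrite subr0 mulNr -mulr_natl; congr (- (_ / _)); ring.
Qed.

Lemma integrable_gk t : 0 < t -> mu.-integrable setT (EFin \o (gk ^~ t)).
Proof. by move=> t0; rewrite gk_pdf//; exact: integrable_normal_pdf. Qed.

Lemma integral_gk t : 0 < t -> \int[mu]_x gk x t = 1.
Proof.
move=> t0; transitivity (\int[mu]_x normal_pdf 0 (Num.sqrt (2 * t)) x).
  by apply: eq_Rintegral => x _; rewrite -(gk_pdf t0).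
by rewrite /Rintegral integral_normal_pdf// gt_eqF// sqrtr_gt0 mulr_gt0.
Qed.

Lemma gkE x t : gk x t = (2 * Num.sqrt pi * Num.sqrt t)^-1 * expR (- ((4 * t)^-1 * x ^+ 2)).
Proof. by rewrite /gk [_ / _]mulrC. Qed.

Lemma is_derive_gk x t : is_derive x 1 (gk ^~ t) (- (2 * (4 * t)^-1 * x) * gk x t).
Proof.
have -> : gk ^~ t = fun x => (2 * Num.sqrt pi * Num.sqrt t)^-1 * expR (- ((4 * t)^-1 * x ^+ 2)).
  by apply/funext => y; rewrite gkE.
have h := is_derive_gaussian (4 * t)^-1 x.
apply: is_derive_eq; rewrite /GRing.scale/= gkE; ring.
Qed.

Lemma continuous_gk t : continuous (gk ^~ t).
Proof.
move=> x; apply: differentiable_continuous; apply/derivable1_diffP.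
by case: (is_derive_gk x t).
Qed.

Lemma integrable_gk_x t : 0 < t -> mu.-integrable setT (EFin \o (fun x => gk x t * `|x|)).
Proof.
move=> t0; pose c := Num.sqrt 2 * (1 + 8 * t).
have t20 : 0 < 2 * t by rewrite mulr_gt0.
apply: (le_Rintegrable (m := mu) (g := fun x => c * gk x (2 * t))) => //.
- by apply: measurable_funM => //; apply: continuous_measurable_fun; exact: continuous_gk.
- move=> x _; rewrite ger0_norm ?mulr_ge0 ?gk_ge0//.
  have e1 : expR (- (x ^+ 2 / (4 * t))) =
      expR (- (x ^+ 2 / (4 * (2 * t)))) * expR (- (x ^+ 2 / (8 * t))).
    by rewrite -expRD; congr expR; field; lra.
  have e2 : `|x| * expR (- (x ^+ 2 / (8 * t))) <= 1 + 8 * t.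
    rewrite expRN ler_pdivrMr ?expR_gt0//.
    apply: (@le_trans _ _ ((1 + 8 * t) * (1 + x ^+ 2 / (8 * t)))); last first.
      by rewrite ler_wpM2l ?expR_ge1Dx//; lra.
    have : `|x| <= 1 + x ^+ 2.
      by rewrite -(real_normK (num_real x)); have := sqr_ge0 (`|x| - 1); nra.
    move=> h; apply: le_trans h _.
    have -> : x ^+ 2 = 8 * t * (x ^+ 2 / (8 * t)) by field; lra.
    have : 0 <= x ^+ 2 / (8 * t) by rewrite divr_ge0 ?sqr_ge0//; lra.
    set z := x ^+ 2 / (8 * t) => z0.
    by rewrite (_ : 8 * t * z / (8 * t) = z); [nra|field; lra].
  rewrite /gk e1 /c sqrtrM//.
  have st0 : 0 < Num.sqrt t by rewrite sqrtr_gt0.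
  have sp0 : 0 < Num.sqrt pi :> R by rewrite sqrtr_gt0 pi_gt0.
  have s20 : 0 < Num.sqrt 2 :> R by rewrite sqrtr_gt0.
  rewrite (_ : _ * _ * _ = (2 * Num.sqrt pi * Num.sqrt t)^-1 * expR (- (x ^+ 2 / (4 * (2 * t))))
    * (`|x| * expR (- (x ^+ 2 / (8 * t))))); last by ring.
  rewrite [leRHS](_ : _ = (2 * Num.sqrt pi * Num.sqrt t)^-1 * expR (- (x ^+ 2 / (4 * (2 * t))))
    * (1 + 8 * t)); last first.
    by field; rewrite !gt_eqF.
  by apply: ler_wpM2l => //; rewrite mulr_ge0 ?expR_ge0// invr_ge0 !mulr_ge0 ?sqrtr_ge0.
- have : mu.-integrable setT (fun x => c%:E * (gk x (2 * t))%:E)%E.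
    by apply: integrableZl => //; exact: integrable_gk.
  by apply: eq_integrable.
Qed.

Lemma integrable_gk_mul t (f : R -> R) : 0 < t -> measurable_fun setT f ->
  (forall x, `|f x| <= 1) -> mu.-integrable setT (EFin \o (fun x => gk x t * f x)).
Proof.
move=> t0 mf f1; apply: (le_Rintegrable (m := mu) (g := gk ^~ t)) => //.
- by apply: measurable_funM => //; apply: continuous_measurable_fun; exact: continuous_gk.
- by move=> x _; rewrite normrM ger0_norm ?gk_ge0// ler_piMr// gk_ge0.
- exact: integrable_gk.
Qed.

Lemma measurable_cosM w : measurable_fun setT (fun x => cos (w * x)).
Proof.
apply: continuous_measurable_fun => x; apply: (continuous_comp (f := fun x => w * x) (g := cos)).
  exact: mulrl_continuous.
exact: continuous_cos.
Qed.

Lemma measurable_sinM w : measurable_fun setT (fun x => sin (w * x)).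
Proof.
apply: continuous_measurable_fun => x; apply: (continuous_comp (f := fun x => w * x) (g := sin)).
  exact: mulrl_continuous.
exact: continuous_sin.
Qed.

End gaussian.

(** * Its Fourier transform *)

Section gaussian_fourier.
Context {R : realType}.
Local Notation mu := (@lebesgue_measure R).
Implicit Types (x t w : R).

Lemma integral_derivative0 (F f : R -> R) : (forall x : R, is_derive x 1 F (f x)) ->
  continuous f -> mu.-integrable setT (EFin \o f) ->
  (F n.+1%:R - F (- n.+1%:R)) @[n --> \oo] --> (0 : R) ->
  \int[mu]_x f x = 0.
Proof.
move=> dF cf if_ F0.
have [||||_] := @Rdominated_cvg R _ _ mu setT
   (fun n x => f x * \1_(`[- n.+1%:R, n.+1%:R]%classic) x) f (fun x => `|f x|) measurableT.
- move=> n; apply: measurable_funM; last exact: measurable_indic.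
  exact: continuous_measurable_fun.
- move=> x _; apply: cvg_near_cst; exists (Num.truncn `|x|) => // n /= xn.
  rewrite indicE mem_set ?mulr1//= in_itv/= -ler_norml.
  by rewrite (le_trans (ltW (truncnS_gt _)))// ler_nat.
- exact: integrable_norm.
- by move=> n x _; rewrite indicE; case: (_ \in _); rewrite ?mulr1// mulr0 normr0.
have e n : \int[mu]_x (f x * \1_(`[- n.+1%:R, n.+1%:R]%classic) x) = F n.+1%:R - F (- n.+1%:R).
  rewrite -(@Rintegral_FTC _ f)//; last by rewrite (@le_trans _ _ 0)// oppr_le0.
  rewrite [RHS]Rintegral_mkcond; apply: eq_Rintegral => x _.
  by rewrite /patch indicE; case: ifP; rewrite ?mulr1 ?mulr0.
under eq_fun do rewrite e.
by move=> h; exact: (cvg_unique (@Rhausdorff R) h F0).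
Qed.

Lemma gk_le x t : 0 < t -> x != 0 -> gk x t <= 2 * Num.sqrt t / x ^+ 2.
Proof.
move=> t0 x0; rewrite /gk; have x20 : 0 < x ^+ 2 by rewrite exprn_even_gt0.
have st0 : 0 < Num.sqrt t by rewrite sqrtr_gt0.
have sp1 : 1 <= Num.sqrt pi :> R.
  by rewrite -[leLHS]sqrtr1 ler_wsqrtr//; have := pi_ge2 R; lra.
have e1 : expR (- (x ^+ 2 / (4 * t))) <= 4 * t / x ^+ 2.
  have y0 : 0 < x ^+ 2 / (4 * t) by rewrite divr_gt0//; lra.
  have -> : 4 * t / x ^+ 2 = (x ^+ 2 / (4 * t))^-1 by rewrite invf_div.
  rewrite expRN lef_pV2 ?posrE ?expR_gt0//.
  by have := expR_ge1Dx (x ^+ 2 / (4 * t)); lra.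
apply: (@le_trans _ _ ((2 * Num.sqrt t)^-1 * (4 * t / x ^+ 2))).
  apply: ler_pM; [|exact: expR_ge0| |exact: e1].
    by rewrite invr_ge0 !mulr_ge0 ?sqrtr_ge0.
  by rewrite lef_pV2 ?posrE ?mulr_gt0//; nra.
rewrite -[t in 4 * t](sqr_sqrtr (ltW t0)) le_eqVlt; apply/orP; left; apply/eqP.
by field; rewrite x0 gt_eqF.
Qed.

(** As a function of w the left-hand side has derivative - 2 t w times itself:
    differentiate under the integral and integrate by parts. *)
Lemma gaussian_fourier t w : 0 < t -> \int[mu]_x (gk x t * cos (w * x)) = expR (- (t * w ^+ 2)).
Proof.
move=> t0.
pose J (w : R) := \int[mu]_x (gk x t * cos (w * x)).
have dJ (w0 : R) : is_derive w0 1 J (- (2 * t * w0) * J w0).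
  pose f (w x : R) := gk x t * cos (w * x).
  have df (v x : R) : is_derive v 1 (f ^~ x) (- (gk x t * x * sin (v * x))).
    rewrite /f; have -> : (fun y => gk x t * cos (y * x)) = (fun y => gk x t * cos (x * y)).
      by apply/funext => y; rewrite [y * x]mulrC.
    apply: (is_derive_eq (is_derive_mulc (gk x t) (is_derive_cosM x v))).
    by rewrite [v * x]mulrC; ring.
  have intf (v : R) : (`](w0 - 1), (w0 + 1)[%classic : set R) v -> mu.-integrable setT (EFin \o f v).
    by move=> _; apply: integrable_gk_mul => //; [exact: measurable_cosM|move=> x; exact: cos_max].
  have Iw : (`](w0 - 1), (w0 + 1)[%classic : set R) w0 by rewrite /= in_itv/=; apply/andP; split; lra.
  have G0 (x : R) : 0 <= gk x t * `|x| by rewrite mulr_ge0 ?gk_ge0.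
  have Gub (v x : R) : (`](w0 - 1), (w0 + 1)[%classic : set R) v -> setT x -> `|partial1of2 f v x| <= gk x t * `|x|.
    move=> _ _; rewrite partial1of2E derive_val normrN normrM [`|gk x t * x|]normrM (ger0_norm (gk_ge0 x t)).
    by rewrite ler_piMr ?mulr_ge0 ?gk_ge0// sin_max.
  have ex (v x : R) : (`](w0 - 1), (w0 + 1)[%classic : set R) v -> setT x -> derivable (f ^~ x) v 1.
    by move=> _ _; case: (df v x).
  have iG := integrable_gk_x t0.
  have dv := derivable_under_integral measurableT Iw intf ex G0 iG Gub.
  have dE := differentiation_under_integral measurableT Iw intf ex G0 iG Gub.
  apply: DeriveDef; first exact: dv.
  rewrite -derive1E [LHS]dE.
  have -> : \int[mu]_x partial1of2 f w0 x = \int[mu]_x (- (gk x t * x * sin (w0 * x))).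
    by apply: eq_Rintegral => x _; rewrite partial1of2E derive_val.
  have i1 : mu.-integrable setT (EFin \o (fun x => gk x t * x * sin (w0 * x))).
    apply: (le_Rintegrable (m := mu) (g := fun x => gk x t * `|x|)) => //.
      apply: measurable_funM; last exact: measurable_sinM.
      by apply: measurable_funM => //; apply: continuous_measurable_fun; exact: continuous_gk.
    move=> x _; rewrite normrM [`|gk x t * x|]normrM (ger0_norm (gk_ge0 x t)).
    by rewrite ler_piMr ?mulr_ge0 ?gk_ge0// sin_max.
  have i2 := intf w0 Iw.
  have i3 : mu.-integrable setT (EFin \o (fun x => - (gk x t * x * sin (w0 * x)))).
    by have : mu.-integrable setT (fun x => - (gk x t * x * sin (w0 * x))%:E)%E by exact: integrableN.
  have i4 : mu.-integrable setT (EFin \o (fun x => 2 * t * w0 * f w0 x)).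
    by have : mu.-integrable setT (fun x => (2 * t * w0)%:E * (f w0 x)%:E)%E by exact: integrableZl.
  pose h (x : R) := - (gk x t * x * sin (w0 * x)) + 2 * t * w0 * f w0 x.
  have ih : mu.-integrable setT (EFin \o h).
    by have : mu.-integrable setT (fun x => (- (gk x t * x * sin (w0 * x)))%:E + (2 * t * w0 * f w0 x)%:E)%E by exact: integrableD.
  have : \int[mu]_x h x = 0.
    apply: (@integral_derivative0 (fun x : R => 2 * t * (gk x t * sin (w0 * x))) h); [| |exact: ih|].
    - move=> x; have h1 := is_derive_gk x t; have h2 := is_derive_sinM w0 x.
      have h3 := is_derive_mulc (2 * t) (is_derive_mul h1 h2).
      by apply: (is_derive_eq h3); rewrite /h /f; field; lra.
    - have csin : continuous (fun x => sin (w0 * x)).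
        move=> x; apply: (continuous_comp (f := fun x => w0 * x) (g := sin)).
          exact: mulrl_continuous.
        exact: continuous_sin.
      have ccos : continuous (fun x => cos (w0 * x)).
        move=> x; apply: (continuous_comp (f := fun x => w0 * x) (g := cos)).
          exact: mulrl_continuous.
        exact: continuous_cos.
      move=> x; apply: cvgD.
        apply: cvgN; apply: cvgM; last exact: csin.
        by apply: cvgM => //; exact: continuous_gk.
      apply: cvgM; first exact: cvg_cst.
      by apply: cvgM; [exact: continuous_gk|exact: ccos].
    - pose C := 8 * t * Num.sqrt t.
      have C0 : 0 <= C by rewrite !mulr_ge0 ?sqrtr_ge0// ltW.
      apply: (@squeeze_cvgr _ _ _ _ (fun n => - (C * harmonic n)) (fun n => C * harmonic n)).
      + apply: nearW => n; rewrite -ler_norml gkN [w0 * - _]mulrN sinN !mulrN opprK.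
        rewrite (_ : _ + _ = 2 * (2 * t) * (gk n.+1%:R t * sin (w0 * n.+1%:R))); last by ring.
        rewrite normrM [`|gk _ _ * _|]normrM (ger0_norm (gk_ge0 _ t)).
        rewrite (ger0_norm (x := 2 * (2 * t))); last by rewrite !mulr_ge0 ?(ltW t0).
        have n0 : n.+1%:R != 0 :> R by rewrite pnatr_eq0.
        apply: (@le_trans _ _ (2 * (2 * t) * (gk n.+1%:R t))).
          apply: ler_wpM2l; first by rewrite !mulr_ge0 ?(ltW t0).
          by apply: ler_piMr; [exact: gk_ge0|exact: sin_max].
        apply: (@le_trans _ _ (2 * (2 * t) * (2 * Num.sqrt t / n.+1%:R ^+ 2))).
          by apply: ler_wpM2l; [rewrite !mulr_ge0 ?(ltW t0)|exact: gk_le].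
        rewrite /C /harmonic/= (_ : _ * (_ / _) = 8 * t * Num.sqrt t * (n.+1%:R ^- 2)); last by field.
        apply: ler_wpM2l => //.
        by rewrite lef_pV2 ?posrE ?exprn_gt0 ?ltr0n// -natrX ler_nat -[leqLHS]expn1 leq_pexp2l.
      + have -> : (0 : R) = - (C * 0) by rewrite mulr0 oppr0.
        by apply: cvgN; apply: cvgM; [exact: cvg_cst|exact: cvg_harmonic].
      + have -> : (0 : R) = C * 0 by rewrite mulr0.
        by apply: cvgM; [exact: cvg_cst|exact: cvg_harmonic].
  rewrite /h RintegralD// RintegralZl// -/(J w0) => hJ; lra.
have cst (v : R) : J v * expR (t * v ^+ 2) = J 0 * expR (t * 0 ^+ 2).
  apply: (is_derive_0_is_cst (f := fun v => J v * expR (t * v ^+ 2))) => y.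
  have h1 := dJ y; have h2 := is_derive_gaussian (- t) y.
  have h3 : is_derive y 1 (fun v => expR (t * v ^+ 2)) (2 * t * y * expR (t * y ^+ 2)).
    have e (z : R) : - (- t * z ^+ 2) = t * z ^+ 2 by ring.
    have -> : (fun v => expR (t * v ^+ 2)) = (fun v => expR (- (- t * v ^+ 2))).
      by apply/funext => z; rewrite e.
    by apply: (is_derive_eq h2); rewrite e; ring.
  by apply: (is_derive_eq (is_derive_mul h1 h3)); ring.
have J0 : J 0 = 1.
  by rewrite /J -(integral_gk t0); apply: eq_Rintegral => x _; rewrite mul0r cos0 mulr1.
have := cst w; rewrite J0 expr0n/= mulr0 expR0 mulr1 -/(J w) => e.
by rewrite expRN -[RHS]mul1r -e mulfK// gt_eqF// expR_gt0.
Qed.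

End gaussian_fourier.

(** * The periodized heat kernel *)

Section theta.
Context {R : realType}.
Local Notation mu := (@lebesgue_measure R).
Implicit Types (x t w : R).

(** Partial sums of the method of images for the two Neumann conditions. *)
Definition imgs (N : nat) x t : R :=
  gk x t + \sum_(1 <= n < N.+1) (gk (x + (2 * n)%:R) t + gk (x - (2 * n)%:R) t).

(** The 2-periodized heat kernel; the estimates are stated on the period
    |x| <= 1. *)
Definition theta x t : R := limn (fun N => imgs N x t).

Lemma imgsS N x t : imgs N.+1 x t =
  imgs N x t + (gk (x + (2 * N.+1)%:R) t + gk (x - (2 * N.+1)%:R) t).
Proof. by rewrite /imgs big_nat_recr//= addrA. Qed.

Lemma imgs0 x t : imgs 0 x t = gk x t.
Proof. by rewrite /imgs big_geq// addr0. Qed.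

Lemma imgsN N x t : imgs N (- x) t = imgs N x t.
Proof.
elim: N => [|N IH]; first by rewrite !imgs0 gkN.
rewrite !imgsS IH; congr (_ + _).
set a := (2 * _)%:R; rewrite -(gkN (- x + a)) -(gkN (- x - a)) addrC.
by congr (gk _ _ + gk _ _); ring.
Qed.

Lemma gk_image_le N x t : 0 <= t -> `|x| <= 1 ->
  0 <= gk (x + (2 * N.+1)%:R) t + gk (x - (2 * N.+1)%:R) t <= 4 * Num.sqrt t / N.+1%:R ^+ 2.
Proof.
move=> t0; rewrite ler_norml => /andP[x1 x2]; rewrite addr_ge0 ?gk_ge0//=.
have n1 : (1 : R) <= N.+1%:R by rewrite ler1n.
have e : (2 * N.+1)%:R = 2 * N.+1%:R :> R by rewrite natrM.
have key y : N.+1%:R ^+ 2 <= y ^+ 2 -> gk y t <= 2 * Num.sqrt t / N.+1%:R ^+ 2.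
  move=> yN; have N20 : (0 : R) < N.+1%:R ^+ 2 by rewrite exprn_gt0.
  have y20 : 0 < y ^+ 2 by exact: lt_le_trans yN.
  move: t0; rewrite le_eqVlt => /predU1P[<-|t0].
    by rewrite gk0// mulr_ge0 ?invr_ge0 ?mulr_ge0 ?sqrtr_ge0 ?ltW.
  have y0 : y != 0 by apply: contraTneq y20 => ->; rewrite expr0n/= ltxx.
  apply: le_trans (gk_le t0 y0) _; apply: ler_wpM2l; first by rewrite mulr_ge0 ?sqrtr_ge0.
  by rewrite lef_pV2 ?posrE.
have -> : 4 * Num.sqrt t / N.+1%:R ^+ 2 =
  2 * Num.sqrt t / N.+1%:R ^+ 2 + 2 * Num.sqrt t / N.+1%:R ^+ 2 :> R by ring.
by apply: lerD; apply: key; rewrite e; nra.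
Qed.

Lemma sum_inv_sq M N : \sum_(0 <= j < N) (M.+1 + j).+1%:R ^- 2 <= M.+1%:R^-1 :> R.
Proof.
apply: (@le_trans _ _ (M.+1%:R^-1 - (M.+1 + N)%:R^-1)); last first.
  by rewrite gerBl invr_ge0.
elim: N => [|N IH]; first by rewrite big_geq// addn0 subrr.
rewrite big_nat_recr//=; apply: le_trans (lerD IH (lexx _)) _.
set m := (M.+1 + N)%N; have m0 : (0 : R) < m%:R by rewrite ltr0n.
rewrite addnS -/m -addrA lerD2l -natr1.
have -> : - m%:R^-1 + (m%:R + 1) ^- 2 = - (m%:R + 1)^-1 - (m%:R * (m%:R + 1) ^+ 2)^-1 :> R.
  by field; apply/andP; split; lra.
by rewrite gerBl invr_ge0 mulr_ge0 ?ltW// sqr_ge0.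
Qed.

Lemma imgs_cvg M x t : 0 <= t -> `|x| <= 1 ->
  imgs N x t @[N --> \oo] --> theta x t /\
  `|theta x t - imgs M.+1 x t| <= 4 * Num.sqrt t / M.+1%:R.
Proof.
move=> t0 x1.
have h m : cvgn (fun N => imgs (N + m.+1) x t) /\
    `|limn (fun N => imgs (N + m.+1) x t) - imgs m.+1 x t| <= 4 * Num.sqrt t / m.+1%:R.
  have := @increments_cvg R (fun N => imgs (N + m.+1) x t)
     (fun j => 4 * Num.sqrt t * (m.+1 + j).+1%:R ^- 2) (4 * Num.sqrt t / m.+1%:R).
  apply.
    move=> N; rewrite addSn imgsS addrAC subrr add0r.
    have /andP[h0 h1] := gk_image_le (N + m.+1) t0 x1.
    by rewrite ger0_norm// [(m.+1 + N)%N]addnC.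
  move=> N; rewrite -mulr_sumr; apply: ler_wpM2l; last exact: sum_inv_sq.
  by rewrite mulr_ge0 ?sqrtr_ge0.
have [c0 _] := h 0%N; have [_ hM] := h M.
have cv : imgs N x t @[N --> \oo] --> theta x t.
  have /cvg_ex[l cl] := c0.
  have : imgs N x t @[N --> \oo] --> l by rewrite -(cvg_shiftn 1 (fun N => imgs N x t)).
  by move=> cl'; rewrite /theta (cvg_lim (@Rhausdorff R) cl').
split=> //; move: hM; have e : imgs (N + M.+1) x t @[N --> \oo] --> theta x t.
  by rewrite (cvg_shiftn M.+1 (fun N => imgs N x t)).
by rewrite (cvg_lim (@Rhausdorff R) e).
Qed.

Lemma imgs_ge0 N x t : 0 <= imgs N x t.
Proof. by rewrite addr_ge0 ?gk_ge0// sumr_ge0// => i _; rewrite addr_ge0// gk_ge0. Qed.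

Lemma imgs_le N x t : 0 <= t -> `|x| <= 1 -> imgs N x t <= gk x t + 8 * Num.sqrt t.
Proof.
move=> t0 x1; rewrite lerD2l.
rewrite big_add1/= (@le_trans _ _ (\sum_(0 <= j < N) (4 * Num.sqrt t / j.+1%:R ^+ 2)))//.
  by apply: ler_sum => j _; have /andP[] := gk_image_le j t0 x1.
rewrite -mulr_sumr (_ : 8 * Num.sqrt t = 4 * Num.sqrt t * 2); last by ring.
rewrite ler_wpM2l ?mulr_ge0 ?sqrtr_ge0//.
case: N => [|N]; first by rewrite big_geq.
rewrite big_nat_recl//= expr1n invr1 (_ : 2 = 1 + 1)// lerD2l.
by have := sum_inv_sq 0 N; rewrite invr1.
Qed.

Lemma theta_itv x t : 0 <= t -> `|x| <= 1 -> 0 <= theta x t <= gk x t + 8 * Num.sqrt t.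
Proof.
move=> t0 x1; have [cv _] := imgs_cvg 0 t0 x1; apply/andP; split.
  apply: limr_ge; first by apply/cvg_ex; eexists; exact: cv.
  by apply: nearW => n; exact: imgs_ge0.
apply: limr_le; first by apply/cvg_ex; eexists; exact: cv.
by apply: nearW => n; exact: imgs_le.
Qed.

Lemma imgs_neg N x t : t <= 0 -> imgs N x t = 0.
Proof.
by move=> t0; rewrite /imgs gk0// add0r big1// => i _; rewrite !gk0// addr0.
Qed.

Lemma theta_neg x t : t <= 0 -> theta x t = 0.
Proof.
move=> t0; rewrite /theta; apply/cvg_lim; first exact: Rhausdorff.
by apply: cvg_near_cst; apply: nearW => N; exact: imgs_neg.
Qed.

Lemma gk_le_sqrtV x t : gk x t <= (Num.sqrt t)^-1.
Proof.
have [t0|t0] := leP t 0; first by rewrite gk0// invr_ge0 sqrtr_ge0.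
have st0 : 0 < Num.sqrt t by rewrite sqrtr_gt0.
have sp1 : 1 <= Num.sqrt pi :> R.
  by rewrite -[leLHS]sqrtr1 ler_wsqrtr//; have := pi_ge2 R; lra.
rewrite /gk -[leRHS]mulr1; apply: ler_pM; [|exact: expR_ge0| |].
- by rewrite invr_ge0 !mulr_ge0 ?sqrtr_ge0.
- by rewrite lef_pV2 ?posrE ?mulr_gt0//; nra.
- by rewrite -expR0 ler_expR oppr_le0 divr_ge0 ?sqr_ge0// mulr_ge0// ltW.
Qed.

(** Away from the singularity at x = 0 the kernel stays bounded as t tends to 0. *)
Lemma theta_le x t : 0 <= t -> `|x| <= 1 -> x != 0 ->
  theta x t <= 2 * Num.sqrt t / x ^+ 2 + 8 * Num.sqrt t.
Proof.
move=> t0 x1 x0; have /andP[_ h] := theta_itv t0 x1; apply: le_trans h _.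
rewrite lerD2r; move: t0; rewrite le_eqVlt => /predU1P[<-|t0]; last exact: gk_le.
by rewrite gk0// divr_ge0 ?sqr_ge0// mulr_ge0 ?sqrtr_ge0.
Qed.

Lemma continuous_gk_t (y : R) : y != 0 -> continuous (gk y).
Proof.
move=> y0 t; have [t0|t0|t0] := ltgtP t 0.
- apply: cvg_near_cst.
  near=> s; rewrite (gk0 _ (ltW t0)) gk0//.
  have : s < 0 by near: s; exact: lt_nbhsl.
  exact: ltW.
- rewrite /continuous_at /gk; apply: cvgM.
    apply: cvgV; first by rewrite gt_eqF// !mulr_gt0 ?sqrtr_gt0 ?pi_gt0.
    by apply: cvgM; [exact: cvg_cst|exact: sqrt_continuous].
  apply: (cvg_comp _ expR); last exact: continuous_expR.
  apply: cvgN; apply: cvgM; first exact: cvg_cst.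
  apply: cvgV; first by rewrite gt_eqF// mulr_gt0.
  by apply: cvgM; [exact: cvg_cst|exact: cvg_id].
- rewrite /continuous_at t0 gk0//.
  apply: (@squeeze_cvgr _ _ _ _ (cst 0) (fun s => 2 * Num.sqrt s / y ^+ 2)).
  + apply: nearW => s /=; rewrite gk_ge0/=.
    have [s0|s0] := leP s 0; last exact: gk_le.
    by rewrite gk0// divr_ge0 ?sqr_ge0// mulr_ge0 ?sqrtr_ge0.
  + exact: cvg_cst.
  + have : 2 * Num.sqrt s / y ^+ 2 @[s --> (0 : R)] --> 2 * Num.sqrt 0 / y ^+ 2.
      apply: cvgM; last exact: cvg_cst.
      by apply: cvgM; [exact: cvg_cst|exact: sqrt_continuous].
    by rewrite sqrtr0 mulr0 mul0r.
Unshelve. all: by end_near. Qed.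

Lemma continuous_imgs N x : 0 < x <= 1 -> continuous (imgs N x).
Proof.
move=> /andP[x0 x1]; elim: N => [|N IH].
  have -> : imgs 0 x = gk x by apply/funext => t; rewrite imgs0.
  by apply: continuous_gk_t; rewrite gt_eqF.
have -> : imgs N.+1 x = fun t =>
    imgs N x t + (gk (x + (2 * N.+1)%:R) t + gk (x - (2 * N.+1)%:R) t).
  by apply/funext => t; rewrite imgsS.
have n1 : (2 : R) <= (2 * N.+1)%:R by rewrite ler_nat leq_pmulr.
move=> t; apply: cvgD; first exact: IH.
apply: cvgD; apply: continuous_gk_t.
  by rewrite gt_eqF//; lra.
by rewrite lt_eqF//; lra.
Qed.

Lemma continuous_th x : 0 < x <= 1 -> continuous (theta x).
Proof.
move=> x01; have x1 : `|x| <= 1 by case/andP: x01 => x0 x1; rewrite gtr0_norm.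
move=> t; apply/cvgrPdist_le => e e0.
pose C := 4 * Num.sqrt (`|t| + 1).
have C0 : 0 <= C by rewrite mulr_ge0 ?sqrtr_ge0.
pose M := Num.truncn (C / (e / 3)).
have CM : C / M.+1%:R <= e / 3.
  rewrite ler_pdivrMr// -ler_pdivrMl; last by lra.
  by rewrite mulrC ltW// truncnS_gt.
have unif s : s <= `|t| + 1 -> `|theta x s - imgs M.+1 x s| <= e / 3.
  move=> st; have [s0|/ltW s0] := leP s 0.
    by rewrite theta_neg// imgs_neg// subrr normr0; lra.
  have [_ h] := imgs_cvg M s0 x1; apply: le_trans h _; apply: le_trans CM.
  by rewrite ler_wpM2r ?invr_ge0// ler_wpM2l// ler_wsqrtr.
have /cvgrPdist_le/(_ (e / 3)) ci := @continuous_imgs M.+1 x x01 t.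
near=> s.
have h1 : `|theta x t - imgs M.+1 x t| <= e / 3.
  by apply: unif; have := ler_norm t; lra.
have h2 : `|theta x s - imgs M.+1 x s| <= e / 3.
  apply: unif; apply: ltW; near: s; apply: lt_nbhsl.
  by have := ler_norm t; lra.
have h3 : `|imgs M.+1 x t - imgs M.+1 x s| <= e / 3.
  by near: s; apply: ci; lra.
rewrite (_ : theta x t - theta x s = (theta x t - imgs M.+1 x t) + (imgs M.+1 x t - imgs M.+1 x s)
  - (theta x s - imgs M.+1 x s)); last by ring.
apply: le_trans (ler_normB _ _) _; apply: le_trans (lerD (ler_normD _ _) (lexx _)) _; lra.
Unshelve. all: by end_near. Qed.

End theta.

(** * Cosine moments of the periodized kernel *)

Section theta_moments.
Context {R : realType}.
Local Notation mu := (@lebesgue_measure R).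
Implicit Types (x t w : R).

(** The inverse is the pointwise limit of the continuous functions
    x / (x ^ 2 + 1 / n). *)
Lemma measurable_inv : measurable_fun setT (fun x : R => x^-1).
Proof.
apply: (measurable_fun_cvg (h := fun n x => x / (x ^+ 2 + n.+1%:R^-1))).
  move=> n; apply: continuous_measurable_fun => x; apply: cvgM; first exact: cvg_id.
  apply: cvgV; first by rewrite gt_eqF// ltr_wpDl ?sqr_ge0// invr_gt0.
  apply: cvgD; last exact: cvg_cst.
  exact: exprn_continuous.
move=> x _; have [->|x0] := eqVneq x 0.
  by rewrite invr0; apply: cvg_near_cst; apply: nearW => n; rewrite mul0r.
have x20 : x ^+ 2 + 0 != 0 by rewrite addr0 expf_neq0.
have -> : x^-1 = x / (x ^+ 2 + 0) by field.
apply: cvgM; first exact: cvg_cst.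
apply: cvgV => //; apply: cvgD; first exact: cvg_cst.
exact: cvg_harmonic.
Qed.

Lemma measurable_gk2 (a : R) : measurable_fun setT (fun z : R * R => gk (z.1 + a) z.2).
Proof.
have m1 : measurable_fun setT (fun z : R * R => z.1 + a).
  by apply: measurable_funD; [exact: measurable_fst|exact: measurable_cst].
have m2 : measurable_fun setT (fun z : R * R => z.2) by exact: measurable_snd.
have minv (f : R * R -> R) : measurable_fun setT f -> measurable_fun setT (fun z => (f z)^-1).
  by move=> mf; exact: (measurableT_comp measurable_inv mf).
have msqrt : measurable_fun setT (@Num.sqrt R).
  by apply: continuous_measurable_fun; exact: sqrt_continuous.
apply: measurable_funM.
  apply: minv; apply: measurable_funM => //.
  exact: (measurableT_comp msqrt m2).
apply: (measurableT_comp (f := expR)) => //.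
apply: measurable_funN; apply: measurable_funM; first exact: measurable_funX.
by apply: minv; exact: measurable_funM.
Qed.

Lemma measurable_imgs N : measurable_fun setT (fun z : R * R => imgs N z.1 z.2).
Proof.
elim: N => [|N IH].
  have := measurable_gk2 0; under eq_fun do rewrite addr0.
  by under [in X in _ -> X]eq_fun do rewrite imgs0.
under eq_fun do rewrite imgsS.
by apply: measurable_funD => //; apply: measurable_funD; exact: measurable_gk2.
Qed.

Lemma imgs_cvgT x t : `|x| <= 1 -> imgs N x t @[N --> \oo] --> theta x t.
Proof.
move=> x1; have [t0|/ltW t0] := leP t 0; last by have [] := imgs_cvg 0 t0 x1.
rewrite theta_neg//; apply: cvg_near_cst; apply: nearW => N; exact: imgs_neg.
Qed.

Lemma measurable_th2 : measurable_fun ((`[-1, 1]%classic : set R) `*` (setT : set R)) (fun z : R * R => theta z.1 z.2).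
Proof.
apply: (measurable_fun_cvg (h := fun N z => imgs N z.1 z.2)).
  by move=> N; apply: measurable_funTS; exact: measurable_imgs.
by move=> [x t] /= [+ _]; rewrite in_itv/= -ler_norml => /imgs_cvgT.
Qed.

Lemma cosn_shift n (j : nat) x : cosn n (x + (2 * j)%:R) = cosn n x.
Proof.
rewrite /cosn (_ : n%:R * pi * (x + (2 * j)%:R) = n%:R * pi * x + (pi *+ 2) *+ (n * j)).
  exact: (periodicn (@cosD2pi R)).
by rewrite -mulr_natl -(mulr_natl (pi *+ 2)) -[pi *+ 2]mulr_natl !natrM; ring.
Qed.

Lemma cosnN n x : cosn n (- x) = cosn n x :> R.
Proof. by rewrite /cosn mulrN cosN. Qed.

Lemma integral_itv_cvg (f : R -> R) : mu.-integrable setT (EFin \o f) ->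
  \int[mu]_(x in `[- (2 * n).+1%:R, (2 * n).+1%:R]) f x @[n --> \oo] --> \int[mu]_x f x.
Proof.
move=> if_; have mf : measurable_fun setT f by case/integrableP : if_ => /measurable_EFinP.
have [||||_] := @Rdominated_cvg R _ _ mu setT
   (fun n x => f x * \1_(`[- (2 * n).+1%:R, (2 * n).+1%:R]%classic) x) f (fun x => `|f x|) measurableT.
- by move=> n; apply: measurable_funM => //; exact: measurable_indic.
- move=> x _; apply: cvg_near_cst; exists (Num.truncn `|x|) => // n /= xn.
  rewrite indicE mem_set ?mulr1//= in_itv/= -ler_norml.
  by rewrite (le_trans (ltW (truncnS_gt _)))// ler_nat ltnS (leq_trans xn)// leq_pmull.
- exact: integrable_norm.
- by move=> n x _; rewrite indicE; case: (_ \in _); rewrite ?mulr1// mulr0 normr0.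
under eq_fun => n.
  rewrite (_ : Rintegral _ _ _ = \int[mu]_(x in `[- (2 * n).+1%:R, (2 * n).+1%:R]) f x); last first.
    rewrite [RHS]Rintegral_mkcond; apply: eq_Rintegral => x _.
    by rewrite /patch indicE; case: ifP; rewrite ?mulr1 ?mulr0.
  over.
by [].
Qed.

Lemma continuous_imgs_x N t : continuous (imgs N ^~ t).
Proof.
elim: N => [|N IH].
  have -> : imgs 0 ^~ t = gk ^~ t by apply/funext => x; rewrite imgs0.
  exact: continuous_gk.
have -> : imgs N.+1 ^~ t = fun x => imgs N x t + (gk (x + (2 * N.+1)%:R) t + gk (x - (2 * N.+1)%:R) t).
  by apply/funext => y; rewrite imgsS.
have cs (a : R) : continuous (fun x => gk (x + a) t).
  move=> y; apply: (continuous_comp (f := fun x => x + a) (g := gk ^~ t)).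
    by apply: cvgD; [exact: cvg_id|exact: cvg_cst].
  exact: continuous_gk.
move=> x; apply: cvgD; first exact: IH.
by apply: cvgD; exact: cs.
Qed.

(** The images of (0, 1) under the translations by even integers and the
    reflection tile the line, so that integrating the periodized kernel over
    (0, 1) against an even 2-periodic function amounts to integrating the heat
    kernel over the line. *)
Lemma imgs_cos_moment N n t : 0 < t ->
  \int[mu]_(x in `[0, 1]) (2 * imgs N x t * cosn n x) =
  \int[mu]_(x in `[- (2 * N).+1%:R, (2 * N).+1%:R]) (gk x t * cosn n x).
Proof.
move=> t0; pose h x := gk x t * cosn n x.
have ch : continuous h by move=> x; apply: cvgM; [exact: continuous_gk|exact: continuous_cosn].
have ih : mu.-integrable setT (EFin \o h).
  apply: integrable_gk_mul => //; last by move=> x; exact: cos_max.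
  by apply: continuous_measurable_fun; exact: continuous_cosn.
have hN x : h (- x) = h x by rewrite /h gkN cosnN.
pose F y := \int[mu]_(x in `]-oo, y]) h x.
have dF (y : R) : is_derive y 1 F (h y).
  have iy : mu.-integrable `]-oo, (y + 1)] (EFin \o h) by exact: integrableS ih.
  have [|||d1 d2] := @continuous_FTC1 R h -oo%O y (y + 1) _ iy.
  - lra.
  - by rewrite ltNyr.
  - exact: ch.
  by apply: DeriveDef; [exact: d1|rewrite -derive1E; exact: d2].
rewrite (@Rintegral_FTC _ h F)//; last by rewrite (@le_trans _ _ 0)// oppr_le0.
have dFa (a y : R) : is_derive y 1 (fun x => F (x + a)) (h (y + a)).
  have d1 : is_derive y 1 (fun x : R => x + a) 1 by apply: is_derive_eq; rewrite addr0.
  have := @is_derive1_comp R F (fun x => x + a) y _ _ (dF (y + a)) d1.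
  by rewrite mulr1.
have dFNa (a y : R) : is_derive y 1 (fun x => F (- x + a)) (- h (y - a)).
  have d1 : is_derive y 1 (fun x : R => - x + a) (-1) by apply: is_derive_eq; rewrite addr0.
  have := @is_derive1_comp R F (fun x => - x + a) y _ _ (dF (- y + a)) d1.
  by rewrite mulrN1 -hN opprD opprK.
pose G := fix G (M : nat) (x : R) : R := if M is M'.+1 then
    G M' x + (F (x + (2 * M)%:R) + F (x + - (2 * M)%:R)
      - (F (- x + (2 * M)%:R) + F (- x + - (2 * M)%:R)))
  else F (x + 0) - F (- x + 0).
have dG M (x : R) : is_derive x 1 (G M) (2 * imgs M x t * cosn n x).
  elim: M => [|M IH].
    have h1 := is_deriveB (dFa 0 x) (dFNa 0 x).
    by apply: (is_derive_eq h1); rewrite imgs0 addr0 subr0 /h; ring.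
  set a : R := (2 * M.+1)%:R.
  have h1 := is_deriveD IH (is_deriveB (is_deriveD (dFa a x) (dFa (- a) x))
    (is_deriveD (dFNa a x) (dFNa (- a) x))).
  apply: (is_derive_eq h1); rewrite imgsS -/a opprK /h.
  have -> : cosn n (x + a) = cosn n x by rewrite /a cosn_shift.
  have -> : cosn n (x - a) = cosn n x.
    by rewrite -[in RHS](subrK a x) /a cosn_shift.
  ring.
rewrite (@Rintegral_FTC _ (fun x => 2 * imgs N x t * cosn n x) (G N))//; first last.
- move=> x; apply: cvgM; last exact: continuous_cosn.
  apply: cvgM; first exact: cvg_cst.
  exact: continuous_imgs_x.
have G0 M : G M 0 = 0.
  elim: M => [|M IH]; first by rewrite /= oppr0 subrr.
  by rewrite /= -/(G M) IH oppr0 subrr addr0.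
have G1 M : G M 1 = F (2 * M).+1%:R - F (- (2 * M).+1%:R).
  elim: M => [|M IH]; first by rewrite /= !addr0 muln0.
  rewrite /= -/(G M) IH; set m : R := (2 * M).+1%:R.
  have -> : (2 * M.+1)%:R = 1 + m :> R by rewrite mulnS -addn1 /m -[(2 * M).+1]addn1 !natrD; ring.
  have -> : (2 * M.+1).+1%:R = 1 + (1 + m) :> R.
    by rewrite mulnS -addn1 /m -[(2 * M).+1]addn1 !natrD; ring.
  have -> : 1 + - (1 + m) = - m by ring.
  have -> : - 1 + (1 + m) = m by ring.
  have -> : - 1 + - (1 + m) = - (1 + (1 + m)) by ring.
  ring.
by rewrite G0 G1 subr0.
Qed.

End theta_moments.

(** * The periodized kernel tested against functions of position *)

Section kernel_functional.
Context {R : realType}.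
Local Notation mu := (@lebesgue_measure R).
Implicit Types (x t : R) (f g : R -> R).

(** The value at time [t] of the solution of the Neumann problem issued from a
    unit flux impulse at x = 0, tested against [f]. *)
Definition kf f t : R := \int[mu]_(x in `]0, 1[) (2 * theta x t * f x).

Lemma itv01_norm x : x \in `]0, 1[ -> `|x| <= 1.
Proof. by rewrite in_itv/= => /andP[x0 x1]; rewrite gtr0_norm// ltW. Qed.

Lemma itv01_sub x : x \in `]0, 1[ -> x \in `[0, 1].
Proof. exact: subset_itv_oo_cc. Qed.

Lemma theta_ge0 x t : x \in `]0, 1[ -> 0 <= theta x t.
Proof.
move=> /itv01_norm x1; have [t0|/ltW t0] := leP t 0; first by rewrite theta_neg.
by have /andP[] := theta_itv t0 x1.
Qed.

(** The supremum over (0, 1) is of order t ^ (-1/2) for small t. With the unit mass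
    of the kernel, this makes the kernel square integrable in (x, t). *)
Lemma theta_sup x t : x \in `]0, 1[ -> 0 <= t -> theta x t <= (Num.sqrt t)^-1 + 8 * Num.sqrt t.
Proof.
move=> /itv01_norm x1 t0; have /andP[_ h] := theta_itv t0 x1; apply: le_trans h _.
by rewrite lerD2r gk_le_sqrtV.
Qed.

Lemma measurable_th_x t : measurable_fun (`]0, 1[%classic : set R) (theta ^~ t).
Proof.
apply: (measurable_fun_cvg (h := fun N x => imgs N x t)).
  by move=> N; apply: measurable_funTS; apply: continuous_measurable_fun; exact: continuous_imgs_x.
by move=> x /itv01_norm; exact: imgs_cvgT.
Qed.

Lemma integrable_th t : mu.-integrable `]0, 1[ (EFin \o (fun x => 2 * theta x t)).
Proof.
apply: (bounded_Rintegrable (m := mu) (M := 2 * ((Num.sqrt t)^-1 + 8 * Num.sqrt t))) => //.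
- exact: fin_itv.
- by apply: measurable_funM => //; exact: measurable_th_x.
- move=> x x01; rewrite ger0_norm ?mulr_ge0 ?theta_ge0//; apply: ler_wpM2l => //.
  have [t0|/ltW t0] := leP t 0; last exact: theta_sup.
  by rewrite theta_neg// addr_ge0 ?invr_ge0 ?mulr_ge0 ?sqrtr_ge0.
Qed.

Lemma integrable_thM f t : continuous f ->
  mu.-integrable `]0, 1[ (EFin \o (fun x => 2 * theta x t * f x)).
Proof. by move=> cf; apply: integrable_mul_continuous => //; exact: integrable_th. Qed.

Lemma kf_neg f t : t <= 0 -> kf f t = 0.
Proof.
move=> t0; transitivity (\int[mu]_(x in `]0, 1[) (0 : R)).
  by apply: eq_Rintegral => x _; rewrite theta_neg// mulr0 mul0r.
by rewrite Rintegral_cst// mul0r.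
Qed.

Lemma kfD f g t : continuous f -> continuous g ->
  kf (fun x => f x + g x) t = kf f t + kf g t.
Proof.
move=> cf cg; rewrite /kf -RintegralD//; [|exact: integrable_thM|exact: integrable_thM].
by apply: eq_Rintegral => x _; rewrite mulrDr.
Qed.

Lemma kfZ c f t : continuous f -> kf (fun x => c * f x) t = c * kf f t.
Proof.
move=> cf; rewrite /kf -RintegralZl//; last exact: integrable_thM.
by apply: eq_Rintegral => x _; rewrite mulrCA.
Qed.

(** Each cosine is an eigenfunction of the Neumann Laplacian. *)
Lemma kf_cosn n t : 0 < t -> kf (cosn n) t = expR (- (lam n * t)).
Proof.
move=> t0; have m01 : measurable (`]0, 1[%classic : set R) by exact: measurable_itv.
have := @Rdominated_cvg R _ _ mu `]0, 1[%classic (fun N x => 2 * imgs N x t * cosn n x)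
  (fun x => 2 * theta x t * cosn n x) (cst (2 * ((Num.sqrt t)^-1 + 8 * Num.sqrt t))) m01.
case.
- move=> N; apply: measurable_funTS; apply: continuous_measurable_fun => x.
  apply: cvgM; last exact: continuous_cosn.
  by apply: cvgM; [exact: cvg_cst|exact: continuous_imgs_x].
- move=> x /itv01_norm x1; apply: cvgM; last exact: cvg_cst.
  by apply: cvgM; [exact: cvg_cst|exact: imgs_cvgT].
- apply: (bounded_Rintegrable (m := mu) (M := `|2 * ((Num.sqrt t)^-1 + 8 * Num.sqrt t)|)) => //.
  exact: fin_itv.
- move=> N x /itv01_norm x1; rewrite normrM ger0_norm ?mulr_ge0 ?imgs_ge0//.
  apply: (@le_trans _ _ (2 * imgs N x t)).
    by apply: ler_piMr; [rewrite mulr_ge0 ?imgs_ge0|exact: cos_max].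
  apply: ler_wpM2l => //; apply: le_trans (imgs_le _ (ltW t0) x1) _.
  by rewrite lerD2r gk_le_sqrtV.
move=> _ c1.
have -> : expR (- (lam n * t)) = \int[mu]_x (gk x t * cosn n x).
  by rewrite gaussian_fourier// /lam mulrC.
apply: (cvg_unique (@Rhausdorff R) c1).
have e N : \int[mu]_(x in `]0, 1[) (2 * imgs N x t * cosn n x) =
    \int[mu]_(x in `[- (2 * N).+1%:R, (2 * N).+1%:R]) (gk x t * cosn n x).
  rewrite -imgs_cos_moment//.
  have ii : mu.-integrable `[0, 1] (EFin \o (fun x => 2 * imgs N x t * cosn n x)).
    apply: continuous_compact_integrable; first exact: segment_compact.
    apply: continuous_subspaceT => x.
    apply: cvgM; last exact: continuous_cosn.
    by apply: cvgM; [exact: cvg_cst|exact: continuous_imgs_x].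
  rewrite Rintegral_itv_bndo_bndc; last first.
    by apply: integrableS ii => //; apply: subset_itv; rewrite bnd_simp.
  by rewrite Rintegral_itv_obnd_cbnd//; apply: integrableS ii => //; apply: subset_itv; rewrite bnd_simp.
rewrite (_ : (fun N => _) = fun N => \int[mu]_(x in `[- (2 * N).+1%:R, (2 * N).+1%:R]) (gk x t * cosn n x)); last first.
  by apply/funext => N; exact: e.
apply: integral_itv_cvg; apply: integrable_gk_mul => //; last by move=> x; exact: cos_max.
by apply: continuous_measurable_fun; exact: continuous_cosn.
Qed.

Lemma cosn0 : @cosn R 0 = fun=> 1.
Proof. by apply/funext => x; rewrite /cosn !mul0r cos0. Qed.

Lemma kf_cst c t : 0 < t -> kf (fun=> c) t = c.
Proof.
move=> t0; have := kf_cosn 0 t0; rewrite cosn0 /lam mul0r expr0n/= mul0r oppr0 expR0 => h.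
have -> : (fun=> c) = (fun _ : R => c * (fun=> 1) (0 : R)) by apply/funext => x; rewrite mulr1.
by rewrite (kfZ c (f := fun=> 1)) ?h ?mulr1// => x; exact: cvg_cst.
Qed.

Lemma kf_le f t M : continuous f -> (forall x, x \in `[0, 1] -> `|f x| <= M) ->
  `|kf f t| <= M.
Proof.
move=> cf fM; have M0 : 0 <= M.
  by apply: le_trans (fM 0 _) => //; rewrite in_itv/= lexx ler01.
have [t0|t0] := leP t 0; first by rewrite kf_neg// normr0.
rewrite -[leRHS](kf_cst M t0); have i1 := integrable_thM t cf.
apply: le_trans (le_normr_Rintegral _ i1) _ => //; apply: le_Rintegral => //.
- exact: integrable_norm i1.
- by apply: integrable_thM => x; exact: cvg_cst.
- move=> x x01; rewrite normrM ger0_norm ?mulr_ge0 ?theta_ge0//.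
  by apply: ler_wpM2l; [rewrite mulr_ge0 ?theta_ge0|apply: fM; exact: itv01_sub].
Qed.

Lemma measurable_kf_cospoly p : cospoly p -> measurable_fun setT (kf p).
Proof.
elim=> [k c|p1 p2 c1 m1 c2 m2].
  have -> : kf (fun x => c * cos (k%:R * pi * x)) =
      fun t => c * (\1_(`]0, +oo[%classic) t * expR (- (lam k * t))).
    apply/funext => t; rewrite (kfZ c (f := cosn k)); last exact: continuous_cosn.
    rewrite indicE; have [t0|t0] := leP t 0.
      by rewrite kf_neg// memNset ?mul0r ?mulr0//= in_itv/= andbT ltNge t0.
    by rewrite mem_set ?mul1r ?kf_cosn//= in_itv/= t0.
  apply: measurable_funM => //; apply: measurable_funM; first exact: measurable_indic.
  exact: measurable_expRNM.
have -> : kf (fun x => p1 x + p2 x) = kf p1 \+ kf p2.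
  by apply/funext => t; rewrite kfD//; exact: cospoly_continuous.
exact: measurable_funD.
Qed.

Lemma kfB f g t : continuous f -> continuous g ->
  kf (fun x => f x - g x) t = kf f t - kf g t.
Proof.
move=> cf cg; rewrite -mulN1r -kfZ// -kfD//.
  by congr (kf _ t); apply/funext => x; rewrite mulN1r.
by move=> x; apply: cvgM; [exact: cvg_cst|exact: cg].
Qed.

Lemma measurable_kf f : continuous f -> measurable_fun setT (kf f).
Proof.
move=> cf; have e0 n : (0 : R) < n.+1%:R^-1 by rewrite invr_gt0.
pose p n := sval (cid2 (cospoly_dense (e0 n) cf)).
have pP n : cospoly (p n) by rewrite /p; case: cid2.
have fp n : {in `[0, 1], forall x, `|f x - p n x| <= n.+1%:R^-1} by rewrite /p; case: cid2.
apply: (measurable_fun_cvg (h := fun n => kf (p n))).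
  by move=> n; exact: measurable_kf_cospoly.
move=> t _; apply/cvgrPdist_le => e e_gt0.
have /cvgrPdist_le/(_ _ e_gt0) [N _ NE] := @cvg_harmonic R.
exists N => // n Nn; rewrite -kfB//; last exact: cospoly_continuous.
apply: le_trans (kf_le t _ (fp n)) _.
  by move=> x; apply: cvgB; [exact: cf|exact: cospoly_continuous].
by have := NE n Nn; rewrite sub0r normrN ger0_norm// /harmonic invr_ge0.
Qed.

Lemma integrable_kf f t : continuous f -> mu.-integrable `]0, t[ (EFin \o kf f).
Proof.
move=> cf; have [M M0 fM] := continuous_bounded01 cf.
apply: (bounded_Rintegrable (m := mu) (M := M)) => //; first exact: fin_itv.
  by apply: measurable_funTS; exact: measurable_kf.
by move=> s _; exact: kf_le.
Qed.

Lemma is_derive_cosn n x : is_derive x 1 (@cosn R n) (- (n%:R * pi) * sin (n%:R * pi * x)).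
Proof. exact: is_derive_cosM. Qed.

(** Integrating q twice gives a primitive compatible with the Neumann condition at
    x = 1 only after the mean c0 of q is removed. On each cosine the identity is
    the formula for [kf_cosn]. *)
Lemma kernel_identity_cospoly q : cospoly q -> exists (c0 : R) (P P1 : R -> R),
  [/\ forall x : R, is_derive x 1 P (P1 x), forall x : R, is_derive x 1 P1 (q x - c0),
      [/\ P1 0 = 0, P1 1 = 0 & P 0 = 0] &
      forall t, 0 < t -> kf P t = \int[mu]_(s in `]0, t[) kf (fun x => q x - c0) s].
Proof.
elim=> [k c|q1 q2 cq1 [c1 [P [P1 [dP dP1 [P10 P11 P0] kP]]]] cq2 [c2 [Q [Q1 [dQ dQ1 [Q10 Q11 Q0] kQ]]]]].
  case: k => [|k].
    exists c, (fun=> 0), (fun=> 0); split=> //.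
    - by move=> x; exact: is_derive_cst.
    - by move=> x; rewrite !mul0r cos0 mulr1 subrr; exact: is_derive_cst.
    - move=> t t0; rewrite kf_cst//.
      transitivity (\int[mu]_(s in `]0, t[) (0 : R)); first by rewrite Rintegral_cst// mul0r.
      apply: eq_Rintegral => s; rewrite inE/= in_itv/= => /andP[s0 _].
      rewrite (_ : (fun x => _) = fun=> 0) ?kf_cst//.
      by apply/funext => x; rewrite !mul0r cos0 mulr1 subrr.
  set n := k.+1; set w : R := n%:R * pi.
  have w0 : w != 0 by rewrite mulf_neq0 ?pnatr_eq0// gt_eqF// pi_gt0.
  have l0 : lam n != 0 :> R by rewrite /lam expf_neq0.
  exists 0, (fun x => (- (c / lam n)) * cosn n x + c / lam n), (fun x => c / w * sin (w * x)).
  split.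
  - move=> x; have h := is_deriveD (is_derive_mulc (- (c / lam n)) (is_derive_cosn n x)) (is_derive_cst (c / lam n) x 1).
    by apply: (is_derive_eq h); rewrite /lam -/w; field.
  - move=> x; have h := is_derive_mulc (c / w) (is_derive_sinM w x).
    by apply: (is_derive_eq h); rewrite subr0; field.
  - split; first by rewrite mulr0 sin0 mulr0.
      have -> : w * 1 = 0 + pi *+ n by rewrite mulr1 add0r /w mulr_natl.
      have -> : sin (0 + pi *+ n) = 0 :> R; last by rewrite mulr0.
      elim: (n) => [|m IH]; first by rewrite mulr0n addr0 sin0.
      by rewrite mulrS addrCA addrC sinDpi IH oppr0.
    by rewrite /cosn mulr0 cos0; field.
  - move=> t t0; rewrite kfD; [|by move=> x; apply: cvgM; [exact: cvg_cst|exact: continuous_cosn]|by move=> x; exact: cvg_cst].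
    rewrite (kfZ (- (c / lam n)) t (@continuous_cosn R n)).
    rewrite kf_cst// kf_cosn//.
    have e1 : {in `]0, t[%classic, (fun s => kf (fun x => c * cos (w * x) - 0) s) =1
        fun s => c * expR (- lam n * s)}.
      move=> s; rewrite inE/= in_itv/= => /andP[s0 _].
      rewrite (_ : (fun x => _) = fun x => c * cosn n x); last by apply/funext => x; rewrite subr0.
      by rewrite kfZ ?kf_cosn ?mulNr//; exact: continuous_cosn.
    rewrite [RHS](_ : _ = \int[mu]_(s in `]0, t[) (c * expR (- lam n * s))); last by apply: eq_Rintegral => s; exact: e1.
    have cE : continuous (fun s => c * expR (- lam n * s)).
      move=> s; apply: cvgM; first exact: cvg_cst.
      have := @continuous_expRNM R (lam n) s; under eq_fun do rewrite -mulNr.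
      by rewrite -mulNr.
    have ii : mu.-integrable `[0, t] (EFin \o (fun s => c * expR (- lam n * s))).
      apply: continuous_compact_integrable; first exact: segment_compact.
      exact: continuous_subspaceT.
    have iE (b1 b2 : bool) : mu.-integrable [set` Interval (BSide b1 0) (BSide b2 t)]
        (EFin \o (fun s => c * expR (- lam n * s))).
      by apply: integrableS ii => //; apply: subset_itv; rewrite bnd_simp; case: b1; case: b2.
    rewrite (Rintegral_itv_bndo_bndc (iE _ _)) (Rintegral_itv_obnd_cbnd (iE _ _)).
    have dF (s : R) : is_derive s 1 (fun s => (- (c / lam n)) * expR (- lam n * s)) (c * expR (- lam n * s)).
      have h := is_derive_mulc (- (c / lam n)) (is_derive_expRM (- lam n) s).
      by apply: (is_derive_eq h); field.
    rewrite (Rintegral_FTC (ltW t0) cE dF).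
    by rewrite mulr0 expR0 -[- (lam n * t)]mulNr; ring.
exists (c1 + c2), (fun x => P x + Q x), (fun x => P1 x + Q1 x).
have cont (F F' : R -> R) : (forall x : R, is_derive x 1 F (F' x)) -> continuous F.
  by move=> dF x; apply: differentiable_continuous; apply/derivable1_diffP; case: (dF x).
have cB z c : cospoly z -> continuous (fun x => z x - c).
  by move=> cq x; apply: cvgB; [exact: cospoly_continuous|exact: cvg_cst].
split.
- by move=> x; exact: is_deriveD (dP x) (dQ x).
- by move=> x; apply: (is_derive_eq (is_deriveD (dP1 x) (dQ1 x))); ring.
- by rewrite P10 Q10 P11 Q11 P0 Q0 !addr0.
- move=> t t0; rewrite kfD; [|exact: cont dP|exact: cont dQ].
  rewrite kP// kQ// -RintegralD//; last 2 first.
  + by apply: integrable_kf; exact: cB.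
  + by apply: integrable_kf; exact: cB.
  apply: eq_Rintegral => s _; rewrite -kfD; [|exact: cB|exact: cB].
  by congr (kf _ s); apply/funext => x; ring.
Qed.

End kernel_functional.

(** * The heat equation for the periodized kernel *)

Section kernel_identity.
Context {R : realType}.
Local Notation mu := (@lebesgue_measure R).

Lemma mvt01 (f f1 : R -> R) (x : R) : (forall x : R, is_derive x 1 f (f1 x)) -> 0 <= x ->
  exists2 c, 0 <= c <= x & f x - f 0 = f1 c * x.
Proof.
move=> df x0; have cf : continuous f.
  by move=> y; apply: differentiable_continuous; apply/derivable1_diffP; case: (df y).
have d01 y : y \in `]0, x[ -> is_derive y 1 f (f1 y) by move=> _; exact: df.
have [c c0 e] := MVT_segment x0 d01 (continuous_subspaceT cf).
by exists c; [rewrite in_itv/= in c0|rewrite e subr0].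
Qed.

(** Heat equation for the kernel, in integrated form and tested against [f]: it
    holds for cosine polynomials, and is stable under the approximation of the
    second derivative of [f] by them. *)
Lemma kernel_identity (f f1 f2 : R -> R) : (forall x : R, is_derive x 1 f (f1 x)) ->
  (forall x : R, is_derive x 1 f1 (f2 x)) -> continuous f2 -> f1 0 = 0 -> f1 1 = 0 ->
  forall t, 0 < t -> kf f t = f 0 + \int[mu]_(s in `]0, t[) kf f2 s.
Proof.
move=> df df1 cf2 f10 f11 t t0; apply/eqP; rewrite -subr_eq0 -normr_eq0 eq_le normr_ge0 andbT.
apply/ler_addgt0Pr => e e0; rewrite add0r.
have d0 : 0 < e / (2 * (1 + t)) by rewrite divr_gt0//; lra.
have ed : 2 * (e / (2 * (1 + t))) + 2 * (e / (2 * (1 + t))) * t = e by field; lra.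
move: (e / (2 * (1 + t))) d0 ed => d d0 ed.
have [q cq fq] := cospoly_dense d0 cf2.
have [c0 [P [P1 [dP dP1 [P10 P11 P0] kP]]]] := kernel_identity_cospoly cq.
pose r x := f x - P x; pose r1 x := f1 x - P1 x; pose r2 x := f2 x - (q x - c0).
have dr (x : R) : is_derive x 1 r (r1 x) by exact: is_deriveB (df x) (dP x).
have dr1 (x : R) : is_derive x 1 r1 (r2 x) by exact: is_deriveB (df1 x) (dP1 x).
have r10 : r1 0 = 0 by rewrite /r1 f10 P10 subrr.
(* The mean of f2 is zero by the Neumann condition, so that the mean of its
   approximation is small. *)
have c0d : `|c0| <= d.
  have [xi xi01] := mvt01 dr1 ler01; rewrite r10 /r1 f11 P11 !subrr mulr1 => /esym r2xi.
  have := fq xi; rewrite in_itv/= => /(_ xi01).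
  have -> : f2 xi - q xi = - c0 by move: r2xi; rewrite /r2; lra.
  by rewrite normrN.
have r2d x : x \in `[0, 1] -> `|r2 x| <= 2 * d.
  move=> x01; rewrite /r2 (_ : _ - _ = (f2 x - q x) + c0); last by ring.
  by apply: le_trans (ler_normD _ _) _; have := fq x x01; lra.
have r1d x : x \in `[0, 1] -> `|r1 x| <= 2 * d.
  rewrite in_itv/= => /andP[x0 x1]; have [c /andP[c0' cx]] := mvt01 dr1 x0.
  rewrite r10 subr0 => ->; rewrite normrM (ger0_norm x0).
  have h : `|r2 c| <= 2 * d by apply: r2d; rewrite in_itv/= c0'/=; lra.
  by have := normr_ge0 (r2 c); nra.
have rd x : x \in `[0, 1] -> `|r x - f 0| <= 2 * d.
  rewrite in_itv/= => /andP[x0 x1]; have [c /andP[c0' cx]] := mvt01 dr x0.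
  rewrite {2}/r P0 subr0 => ->; rewrite normrM (ger0_norm x0).
  have h : `|r1 c| <= 2 * d by apply: r1d; rewrite in_itv/= c0'/=; lra.
  by have := normr_ge0 (r1 c); nra.
have cont (F F' : R -> R) : (forall x : R, is_derive x 1 F (F' x)) -> continuous F.
  by move=> dF x; apply: differentiable_continuous; apply/derivable1_diffP; case: (dF x).
have cr : continuous (fun x => r x - f 0).
  by move=> x; apply: cvgB; [exact: cont dr x|exact: cvg_cst].
have cqc : continuous (fun x => q x - c0).
  by move=> x; apply: cvgB; [exact: cospoly_continuous|exact: cvg_cst].
have cr2 : continuous r2 by move=> x; apply: cvgB; [exact: cf2|exact: cqc].
have e1 : kf f t = kf (fun x => r x - f 0) t + (kf P t + f 0).
  rewrite -[X in _ + (_ + X)](kf_cst (f 0) t0) -kfD; [|exact: cont dP|by move=> x; exact: cvg_cst].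
  rewrite -kfD//; last by move=> x; apply: cvgD; [exact: cont dP x|exact: cvg_cst].
  by congr (kf _ t); apply/funext => x; rewrite /r; ring.
have e2 : \int[mu]_(s in `]0, t[) kf f2 s =
    \int[mu]_(s in `]0, t[) kf r2 s + \int[mu]_(s in `]0, t[) kf (fun x => q x - c0) s.
  rewrite -RintegralD//; [|exact: integrable_kf|exact: integrable_kf].
  apply: eq_Rintegral => s _; rewrite -kfD//.
  by congr (kf _ s); apply/funext => x; rewrite /r2; ring.
have h1 : `|kf (fun x => r x - f 0) t| <= 2 * d by exact: kf_le.
have ir2 := @integrable_kf R r2 t cr2.
have h2 : `|\int[mu]_(s in `]0, t[) kf r2 s| <= 2 * d * t.
  apply: le_trans (le_normr_Rintegral _ ir2) _ => //.
  apply: (@le_trans _ _ (\int[mu]_(s in `]0, t[) (2 * d))).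
    apply: le_Rintegral => //; first exact: integrable_norm ir2.
      apply: (bounded_Rintegrable (m := mu) (M := `|2 * d|)) => //; exact: fin_itv.
    by move=> s _; exact: kf_le.
  have mt : mu `]0, t[ = t%:E by rewrite /= lebesgue_measure_itv/= lte_fin t0 oppr0 adde0.
  by rewrite Rintegral_cst// (_ : fine _ = t)//; exact: (congr1 (@fine R) mt).
rewrite e1 e2 (kP t t0) -ed; clear - h1 h2.
move: (f 0) (kf (fun x => r x - f 0) t) (\int[mu]_(s in `]0, t[) kf r2 s)
  (\int[mu]_(s in `]0, t[) kf (fun x => q x - c0) s) h1 h2 => f0 A I1 I2 h1 h2.
rewrite [X in `|X|](_ : _ = A - I1); last by ring.
by apply: le_trans (ler_normB _ _) _; exact: lerD.
Qed.

End kernel_identity.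

Section real_fubini.
Context {R : realType}.
Local Notation mu := (@lebesgue_measure R).

Lemma integralE_Rintegral (D : set R) (f : R -> R) : measurable D -> mu.-integrable D (EFin \o f) ->
  (\int[mu]_(x in D) (f x)%:E = (\int[mu]_(x in D) f x)%R%:E)%E.
Proof. by move=> mD if_; rewrite /Rintegral fineK//; exact: integrable_fin_num. Qed.

(** The bound on the inner integrals of |F| gives, by Tonelli, integrability on the
    product. *)
Lemma RFubini (F : R -> R -> R) (g : R -> R) :
  measurable_fun setT (fun z : R * R => F z.1 z.2) ->
  (forall x, mu.-integrable setT (EFin \o F x)) ->
  (forall y, mu.-integrable setT (EFin \o (F ^~ y))) ->
  mu.-integrable setT (EFin \o g) ->
  (forall y, \int[mu]_x `|F x y| <= g y) ->
  mu.-integrable setT (EFin \o (fun x => \int[mu]_y F x y)) /\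
  \int[mu]_x \int[mu]_y F x y = \int[mu]_y \int[mu]_x F x y.
Proof.
move=> mF iF1 iF2 ig Fg.
pose f (z : measurableTypeR R * measurableTypeR R) : \bar R := (F z.1 z.2)%:E.
have mf : measurable_fun setT f by apply/measurable_EFinP; exact: mF.
have g0 y : 0 <= g y by apply: le_trans (Fg y); exact: Rintegral_ge0.
have if_ : (mu \x mu)%E.-integrable setT f.
  apply: (proj2 (integrable21ltyP mu mu mf)).
  move/integrableP : ig => [mg]; apply: le_lt_trans.
  apply: ge0_le_integral => //.
  - by move=> y _; exact: integral_ge0.
  - have mf' : measurable_fun setT (abse \o f) by exact: measurableT_comp.
    by apply: (measurable_fun_fubini_tonelli_G (m1 := mu) (abse \o f)); [exact: mf'|move=> z; exact: abse_ge0].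
  - exact: measurableT_comp.
  - move=> y _; rewrite /f/= ger0_norm//.
    have := integralE_Rintegral measurableT (integrable_norm (iF2 y)) => /= ->.
    by rewrite lee_fin.
have eF := Fubini if_.
have i1 := integrable_fubini_F if_.
have E1 x : fubini_F mu f x = (\int[mu]_y F x y)%:E.
  exact: (integralE_Rintegral measurableT (iF1 x)).
split; first by apply: eq_integrable i1 => // x _; rewrite E1.
rewrite /Rintegral; congr fine.
transitivity (\int[mu]_x \int[mu]_y f (x, y))%E.
  by apply: eq_integral => x _; rewrite -/(Rintegral mu setT (F x)) -E1.
rewrite eF; apply: eq_integral => y _.
exact: (integralE_Rintegral measurableT (iF2 y)).
Qed.

End real_fubini.

(** * Two integrability lemmas *)

Section preliminaries.
Context {R : realType}.
Local Notation mu := (@lebesgue_measure R).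
Implicit Types (x t : R).

Lemma is_derive_shift (a s : R) : is_derive s 1 (fun s : R => s + a) 1.
Proof. by apply: is_derive_eq; rewrite addr0. Qed.

(** Monotone convergence from (s + 1/n) ^ (-1/2), whose primitives are explicit. *)
Lemma integrable_sqrtV (T : R) : mu.-integrable `]0, T[ (EFin \o (fun s => (Num.sqrt s)^-1)).
Proof.
have [T0|T0] := leP T 0; first by rewrite set_itv_ge ?bnd_simp -?leNgt//; exact: integrable_set0.
have mf : measurable_fun setT (fun s : R => (Num.sqrt s)^-1).
  apply: (measurableT_comp (f := fun x : R => x^-1)); first exact: measurable_inv.
  by apply: continuous_measurable_fun; exact: sqrt_continuous.
apply/integrableP; split; first by apply/measurable_EFinP; exact: measurable_funTS.
pose h n s : R := (s + n.+1%:R^-1) `^ (- 2^-1).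
have e0 n : (0 : R) < n.+1%:R^-1 by rewrite invr_gt0.
have hE n s : 0 <= s -> h n s = (Num.sqrt (s + n.+1%:R^-1))^-1.
  move=> s0; rewrite /h powRN powR12_sqrt//.
  by rewrite addr_ge0// ltW.
have ch n (s : R) : 0 <= s -> {for s, continuous (h n)}.
  move=> s0; apply: differentiable_continuous; apply/derivable1_diffP.
  have s1 : 0 < s + n.+1%:R^-1 by rewrite ltr_wpDl.
  have d1 : is_derive s 1 (fun s : R => s + n.+1%:R^-1) 1 by exact: is_derive_shift.
  by have [] := @is_derive1_comp R (fun x => x `^ (- 2^-1)) (fun s => s + n.+1%:R^-1) s _ _
    (is_derive1_powR (- 2^-1) s1) d1.
pose F n s : R := 2 * (s + n.+1%:R^-1) `^ (2^-1).
have dF n (s : R) : 0 <= s -> is_derive s 1 (F n) (h n s).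
  move=> s0; have s1 : 0 < s + n.+1%:R^-1 by rewrite ltr_wpDl.
  have d1 : is_derive s 1 (fun s : R => s + n.+1%:R^-1) 1 by exact: is_derive_shift.
  have d2 := @is_derive1_comp R (fun x => x `^ (2^-1)) (fun s => s + n.+1%:R^-1) s _ _
    (is_derive1_powR (2^-1) s1) d1.
  apply: (is_derive_eq (is_derive_mulc 2 d2)); rewrite mulr1 mulrA divff ?mul1r//.
  by rewrite /h; congr (_ `^ _); lra.
have inth n : (\int[mu]_(s in `]0%R, T[) (h n s)%:E <= (F n T)%:E)%E.
  apply: (@le_trans _ _ (\int[mu]_(s in `[0%R, T]) (h n s)%:E)%E).
    apply: ge0_subset_integral => //.
    - apply/measurable_EFinP; apply: subspace_continuous_measurable_fun => //.
      by apply: continuous_in_subspaceT => s; rewrite inE/= in_itv/= => /andP[s0 _]; exact: ch.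
    - by move=> s _; rewrite lee_fin powR_ge0.
    - exact: subset_itv_oo_cc.
  rewrite (@continuous_FTC2 _ (h n) (F n)) //.
  - by rewrite -EFinB lee_fin gerBl /F mulr_ge0// powR_ge0.
  - by apply: continuous_in_subspaceT => s; rewrite inE/= in_itv/= => /andP[s0 _]; exact: ch.
  - have cF (s : R) : 0 <= s -> {for s, continuous (F n)}.
      move=> s0; apply: differentiable_continuous; apply/derivable1_diffP.
      by have [] := dF n s s0.
    split=> [s||].
    + by rewrite in_itv/= => /andP[/ltW s0 _]; have [] := dF n s s0.
    + by apply: cvg_at_right_filter; exact: cF.
    + by apply: cvg_at_left_filter; apply: cF; exact: ltW.
  - move=> s; rewrite in_itv/= => /andP[/ltW s0 _].
    by rewrite derive1E; have [_ ->] := dF n s s0.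
have hlim s : 0 < s -> h n s @[n --> \oo] --> (Num.sqrt s)^-1.
  move=> s0; have s1 : Num.sqrt (s + 0) != 0 by rewrite addr0 gt_eqF// sqrtr_gt0.
  rewrite (_ : (fun n => _) = fun n => (Num.sqrt (s + n.+1%:R^-1))^-1); last first.
    by apply/funext => n; rewrite hE// ltW.
  rewrite -[in X in _ --> X](addr0 s); apply: cvgV => //.
  apply: (cvg_comp _ (@Num.sqrt R)); last exact: sqrt_continuous.
  by apply: cvgD; [exact: cvg_cst|exact: cvg_harmonic].
have m01 : measurable (`]0, T[%classic : set R) by exact: measurable_itv.
have mh n : measurable_fun `]0, T[ (fun s => (h n s)%:E).
  apply/measurable_EFinP; apply: subspace_continuous_measurable_fun => //.
  by apply: continuous_in_subspaceT => s; rewrite inE/= in_itv/= => /andP[/ltW s0 _]; exact: ch.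
apply: (@le_lt_trans _ _ (2 * (T + 1) `^ (2^-1))%:E); last exact: ltry.
have cm : (\int[mu]_(s in `]0%R, T[) (h n s)%:E @[n --> \oo] -->
    \int[mu]_(s in `]0%R, T[) `|((Num.sqrt s)^-1)%:E|)%E.
  have -> : (\int[mu]_(s in `]0%R, T[) `|((Num.sqrt s)^-1)%:E| =
      \int[mu]_(s in `]0%R, T[) limn (fun n => (h n s)%:E))%E.
    apply: eq_integral => s; rewrite inE/= in_itv/= => /andP[s0 _].
    rewrite ger0_norm ?invr_ge0 ?sqrtr_ge0//; apply/esym/cvg_lim => //.
    by apply: cvg_EFin; [exact: nearW|exact: hlim].
  apply: cvg_monotone_convergence => //.
  - by move=> n s _; rewrite lee_fin powR_ge0.
  - move=> s; rewrite /= in_itv/= => /andP[s0 _] n m nm; rewrite lee_fin !hE ?(ltW s0)//.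
    rewrite lef_pV2 ?posrE ?sqrtr_gt0 ?ltr_wpDl ?(ltW s0)//.
    by rewrite ler_wsqrtr// lerD2l lef_pV2 ?posrE// ler_nat.
rewrite -(cvg_lim (@ereal_hausdorff R) cm).
apply: lime_le; first by apply/cvg_ex; eexists; exact: cm.
apply: nearW => n; apply: le_trans (inth n) _; rewrite lee_fin /F ler_wpM2l//.
rewrite ge0_ler_powR ?nnegrE//.
- by rewrite addr_ge0 ?ltW.
- by rewrite addr_ge0 ?ltW.
- by rewrite lerD2l invf_le1// ler1n.
Qed.

(** The integral of (r f - g) ^ 2 is a nonnegative quadratic polynomial in r. *)
Lemma cauchy_schwarz (D : set R) (f g : R -> R) : measurable D -> L2r D f -> L2r D g ->
  mu.-integrable D (EFin \o (fun x => f x * g x)) /\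
  (\int[mu]_(x in D) (f x * g x)) ^+ 2 <=
  \int[mu]_(x in D) (f x ^+ 2) * \int[mu]_(x in D) (g x ^+ 2).
Proof.
move=> mD [mf if_] [mg ig].
have ifg : mu.-integrable D (EFin \o (fun x => f x * g x)).
  apply: (le_Rintegrable (m := mu) (g := fun x => f x ^+ 2 + g x ^+ 2)) => //.
  - exact: measurable_funM.
  - move=> x _; rewrite ler_norml; have := sqr_ge0 (f x + g x); have := sqr_ge0 (f x - g x).
    by have := sqr_ge0 (f x); have := sqr_ge0 (g x) => *; apply/andP; split; nra.
  - by have : mu.-integrable D (fun x => (f x ^+ 2)%:E + (g x ^+ 2)%:E)%E by exact: integrableD.
split=> //.
set A := \int[mu]_(x in D) (f x ^+ 2); set B := \int[mu]_(x in D) (g x ^+ 2).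
set I := \int[mu]_(x in D) (f x * g x).
have A0 : 0 <= A by apply: Rintegral_ge0 => x _; exact: sqr_ge0.
have key r : 0 <= r ^+ 2 * A - 2 * r * I + B.
  have -> : r ^+ 2 * A - 2 * r * I + B = \int[mu]_(x in D) ((r * f x - g x) ^+ 2).
    rewrite [RHS](_ : _ = \int[mu]_(x in D) (r ^+ 2 * f x ^+ 2 - 2 * r * (f x * g x) + g x ^+ 2)); last first.
      by apply: eq_Rintegral => x _; ring.
    have i1 : mu.-integrable D (EFin \o (fun x => r ^+ 2 * f x ^+ 2)).
      by have : mu.-integrable D (fun x => (r ^+ 2)%:E * (f x ^+ 2)%:E)%E by exact: integrableZl.
    have i2 : mu.-integrable D (EFin \o (fun x => 2 * r * (f x * g x))).
      by have : mu.-integrable D (fun x => (2 * r)%:E * (f x * g x)%:E)%E by exact: integrableZl.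
    have i3 : mu.-integrable D (EFin \o (fun x => r ^+ 2 * f x ^+ 2 - 2 * r * (f x * g x))).
      by have : mu.-integrable D (fun x => (r ^+ 2 * f x ^+ 2)%:E - (2 * r * (f x * g x))%:E)%E by exact: integrableB.
    by rewrite RintegralD// RintegralB// RintegralZl// RintegralZl.
  by apply: Rintegral_ge0 => x _; exact: sqr_ge0.
clearbody A B I; move: A0; rewrite le_eqVlt => /predU1P[A0|A0].
  have [->|I0] := eqVneq I 0; first by rewrite expr0n -A0 mul0r.
  have := key ((B + 1) / (2 * I)); rewrite -A0.
  rewrite (_ : _ - _ + B = -1); first by lra.
  by field.
have := key (I / A); rewrite (_ : _ - _ + B = (A * B - I ^+ 2) / A); last by field; lra.
by rewrite pmulr_lge0 ?invr_gt0// subr_ge0.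
Qed.

End preliminaries.

(** * The layer potential *)

Section layer.
Context {R : realType}.
Local Notation mu := (@lebesgue_measure R).
Variables (T : R) (u : R -> R).
Hypothesis uL : L2r `]0, T[ u.
Implicit Types (x t : R).

(** A single layer heat potential: the heat flow in (0, 1) from zero initial data
    with inward flux u at x = 0 and no flux at x = 1. *)
Definition layer t x : R := \int[mu]_(s in `]0, t[) (2 * theta x (t - s) * u s).

Let ue := u \_ `]0, T[.

Let iu : mu.-integrable `]0, T[ (EFin \o u).
Proof. by apply: L2r_integrable => //; exact: fin_itv. Qed.

Let mue : measurable_fun setT ue.
Proof. by apply/(measurable_restrictT _ _).1 => //; case: uL. Qed.

Let iue : mu.-integrable setT (EFin \o ue).
Proof.
rewrite (_ : EFin \o ue = (EFin \o u) \_ `]0, T[).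
  exact: (integrable_mkcond _ _).1.
by apply/funext => x; rewrite /ue /patch/=; case: ifP.
Qed.

Lemma measurable_thB (t x : R) : x \in `]0, 1[ -> measurable_fun setT (fun s : R => theta x (t - s)).
Proof.
rewrite in_itv/= => /andP[x0 x1]; apply: continuous_measurable_fun => s.
apply: (continuous_comp (f := fun s => t - s) (g := theta x)).
  by apply: cvgB; [exact: cvg_cst|exact: cvg_id].
by apply: continuous_th; rewrite x0 ltW.
Qed.

Lemma theta_bounded x s : x \in `]0, 1[ -> s <= T ->
  `|theta x s| <= 2 * Num.sqrt T / x ^+ 2 + 8 * Num.sqrt T.
Proof.
move=> x01 sT; rewrite ger0_norm ?theta_ge0//.
have [s0|/ltW s0] := leP s 0.
  rewrite theta_neg//; have sq := sqrtr_ge0 T.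
  by apply: addr_ge0; [apply: divr_ge0; [exact: mulr_ge0|exact: sqr_ge0]|exact: mulr_ge0].
have x0 : x != 0 by move: x01; rewrite in_itv/= => /andP[x0 _]; rewrite gt_eqF.
apply: le_trans (theta_le s0 (itv01_norm x01) x0) _; apply: lerD.
  by apply: ler_wpM2r; [rewrite invr_ge0 sqr_ge0|apply: ler_wpM2l => //; exact: ler_wsqrtr].
by apply: ler_wpM2l => //; exact: ler_wsqrtr.
Qed.

(** The kernel cut off outside (0, 1), so that it is measurable on the whole plane. *)
Let thr (x s : R) : R := if x \in `]0, 1[ then theta x s else 0.

Let measurable_thr : measurable_fun setT (fun z : R * R => thr z.1 z.2).
Proof.
rewrite (_ : (fun z => _) = (fun z : R * R => theta z.1 z.2) \_ ((`]0, 1[%classic : set R) `*` (setT : set R))).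
  apply/(measurable_restrictT _ _).1; first exact: measurableX.
  apply: measurable_funS measurable_th2; first exact: measurableX.
  move=> [x s] /= [+ _]; rewrite !in_itv/= => /andP[x0 x1]; split=> //.
  by apply/andP; split; lra.
apply/funext => -[x s]; rewrite /thr /patch/=.
case: ifPn => x01; first by rewrite mem_set.
by rewrite memNset//= => -[] /(negP x01).
Qed.

Let measurable_thrB t : measurable_fun setT (fun z : R * R => thr z.1 (t - z.2)).
Proof.
apply: (measurable_comp (F := setT) (g := fun z : R * R => (z.1, t - z.2)) measurableT _ measurable_thr) => //.
apply/measurable_fun_pair => /=; first exact: measurable_fst.
by apply: measurable_funB => //; exact: measurable_snd.
Qed.

Let thr_int (x t : R) : t <= T -> mu.-integrable setT (EFin \o (fun s => 2 * thr x (t - s) * ue s)).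
Proof.
move=> tT; rewrite /thr; have [x01|x01] := boolP (x \in `]0, 1[); last first.
  by apply: eq_integrable (integrable0 _ _) => //= s _; rewrite mulr0 mul0r.
pose B := 2 * Num.sqrt T / x ^+ 2 + 8 * Num.sqrt T.
apply: (le_Rintegrable (m := mu) (g := fun s => 2 * B * `|ue s|)) => //.
- apply: measurable_funM => //; apply: measurable_funM => //; exact: measurable_thB.
- move=> s _; rewrite normrM normrM (ger0_norm (x := 2))//.
  rewrite /ue /patch; case: ifPn; rewrite ?normr0 ?mulr0// inE/= in_itv/= => /andP[s0 sT].
  apply: ler_wpM2r => //; apply: ler_wpM2l => //; apply: theta_bounded => //; lra.
- have : mu.-integrable setT (fun s => (2 * B)%:E * `|ue s|%:E)%E.
    by apply: integrableZl => //; exact: integrable_norm.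
  by apply: eq_integrable.
Qed.

Lemma layer_ext t x : t <= T -> x \in `]0, 1[ -> layer t x = \int[mu]_s (2 * thr x (t - s) * ue s).
Proof.
move=> tT x01; rewrite /layer Rintegral_mkcond; apply: eq_Rintegral => s _.
rewrite /patch /thr x01 /ue /patch !mem_setE !in_itv/=.
have [s0|s0] /= := ltP 0 s; last by rewrite mulr0.
have [st|st] := ltP s t; first by rewrite (lt_le_trans st tT).
by rewrite theta_neg ?subr_le0// mulr0 mul0r.
Qed.

(** Fubini between the position and the time of emission. *)
Lemma layer_moment t (f : R -> R) : t <= T -> continuous f ->
  mu.-integrable `]0, 1[ (EFin \o (fun x => layer t x * f x)) /\
  \int[mu]_(x in `]0, 1[) (layer t x * f x) = \int[mu]_(s in `]0, t[) (kf f (t - s) * u s).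
Proof.
move=> tT cf; have [M M0 fM] := continuous_bounded01 cf.
pose fe := f \_ `]0, 1[.
have feM x : `|fe x| <= M.
  rewrite /fe /patch; case: ifPn; rewrite ?normr0// inE/= => x01; apply: fM.
  exact: itv01_sub.
have mfe : measurable_fun setT fe.
  apply/(measurable_restrictT _ _).1 => //; apply: measurable_funTS; exact: continuous_measurable_fun.
pose F x s := 2 * thr x (t - s) * ue s * fe x.
have mF : measurable_fun setT (fun z : R * R => F z.1 z.2).
  apply: measurable_funM; last exact: (measurableT_comp mfe (measurable_fst)).
  apply: measurable_funM; last exact: (measurableT_comp mue (measurable_snd)).
  by apply: measurable_funM => //; exact: measurable_thrB.
have iF1 x : mu.-integrable setT (EFin \o F x).
  have : mu.-integrable setT (fun s => (2 * thr x (t - s) * ue s)%:E * (fe x)%:E)%E.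
    by apply: integrableZr => //; exact: thr_int.
  by apply: eq_integrable.
have Fx s : F ^~ s = (fun x => ue s * (2 * theta x (t - s) * f x)) \_ `]0, 1[.
  apply/funext => x; rewrite /F /thr /fe /patch mem_setE.
  by case: ifPn => _; rewrite ?mulr0//; ring.
have ith s : mu.-integrable `]0, 1[ (EFin \o (fun x => ue s * (2 * theta x (t - s) * f x))).
  have : mu.-integrable `]0, 1[ (fun x => (ue s)%:E * (2 * theta x (t - s) * f x)%:E)%E.
    by apply: integrableZl => //; exact: integrable_thM.
  by apply: eq_integrable.
have iF2 s : mu.-integrable setT (EFin \o (F ^~ s)).
  rewrite Fx (_ : EFin \o _ = (EFin \o (fun x => ue s * (2 * theta x (t - s) * f x))) \_ `]0, 1[).
    exact: (integrable_mkcond _ _).1.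
  by apply/funext => x; rewrite /patch/=; case: ifP.
have E2 s : \int[mu]_x F x s = ue s * kf f (t - s).
  rewrite (_ : \int[mu]_x F x s = \int[mu]_x (F ^~ s) x)// Fx -Rintegral_mkcond RintegralZl//.
  exact: integrable_thM.
have cabs : continuous (fun x => `|f x|) by move=> x; apply: cvg_norm; exact: cf.
have [] := @RFubini R F (fun s => M * `|ue s|) mF iF1 iF2.
- have : mu.-integrable setT (fun s => M%:E * `|ue s|%:E)%E.
    by apply: integrableZl => //; exact: integrable_norm.
  by apply: eq_integrable.
- move=> s.
  have -> : \int[mu]_x `|F x s| = `|ue s| * kf (fun x => `|f x|) (t - s).
    rewrite /kf -RintegralZl//; last exact: integrable_thM.
    rewrite [RHS]Rintegral_mkcond; apply: eq_Rintegral => x _.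
    rewrite -[F x s]/((F ^~ s) x) Fx /patch mem_setE; case: ifPn => x01; last by rewrite normr0.
    by rewrite !normrM (ger0_norm (x := 2))// (ger0_norm (theta_ge0 _ x01)).
  rewrite mulrC; apply: ler_wpM2r => //; apply: le_trans (ler_norm _) _; apply: kf_le => // x x01.
  by rewrite normr_id fM.
have EW : (fun x => \int[mu]_s F x s) = (fun x => layer t x * f x) \_ `]0, 1[.
  apply/funext => x; rewrite /patch mem_setE /F; case: ifPn => x01.
    rewrite layer_ext// -RintegralZr//; last exact: thr_int.
    by apply: eq_Rintegral => s _; rewrite /fe /patch mem_setE x01.
  rewrite (_ : (fun s => _) = cst 0); first by rewrite Rintegral_cst// mul0r.
  by apply/funext => s; rewrite /fe /patch mem_setE (negbTE x01) mulr0.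
move=> i1 e1; split.
  apply/(integrable_mkcond _ _).2 => //.
  rewrite (_ : (EFin \o _) \_ _ = EFin \o (fun x => \int[mu]_s F x s))//.
  by rewrite EW; apply/funext => x; rewrite /patch/=; case: ifP.
rewrite Rintegral_mkcond -EW e1 [RHS]Rintegral_mkcond; apply: eq_Rintegral => s _.
rewrite E2 /ue /patch !mem_setE !in_itv/=.
have [s0|s0] /= := ltP 0 s; last by rewrite mul0r.
have [st|st] := ltP s t; first by rewrite (lt_le_trans st tT) mulrC.
by rewrite kf_neg ?mulr0// subr_le0.
Qed.

Lemma layer_moment_cosn n : \int[mu]_(x in `]0, 1[) (layer T x * cosn n x) = moment T u n.
Proof.
rewrite (layer_moment (lexx T) (@continuous_cosn R n)).2 /moment; apply: eq_Rintegral => s.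
by rewrite inE/= in_itv/= => /andP[s0 sT]; rewrite kf_cosn// subr_gt0.
Qed.

Let G x := \int[mu]_(s in `]0, T[) (theta x s ^+ 2).

Let thL x t : x \in `]0, 1[ -> t <= T -> L2r `]0, T[ (fun s => theta x (t - s)).
Proof.
move=> x01 tT; apply: (L2r_bounded (M := 2 * Num.sqrt T / x ^+ 2 + 8 * Num.sqrt T)) => //.
- exact: fin_itv.
- by apply: measurable_funTS; exact: measurable_thB.
- move=> s; rewrite /= in_itv/= => /andP[s0 _]; apply: theta_bounded => //; lra.
Qed.

(** Since theta ^ 2 <= theta * sup theta and the integral of 2 theta over (0, 1) is 1,
    the integral of theta ^ 2 in x is O(s ^ (-1/2)), which is integrable in time. *)
Let integrable_G : mu.-integrable `]0, 1[ (EFin \o G).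
Proof.
pose F x s := (thr x s * (\1_(`]0, T[%classic) s : R)) ^+ 2.
have mF : measurable_fun setT (fun z : R * R => F z.1 z.2).
  apply: measurable_funX; apply: measurable_funM; first exact: measurable_thr.
  exact: (measurableT_comp (measurable_indic (measurable_itv _)) measurable_snd).
have Fs x : F x = (fun s => thr x s ^+ 2) \_ `]0, T[.
  apply/funext => s; rewrite /F /patch indicE mem_setE; case: ifP => _; rewrite ?mulr1 ?mulr0//.
  by rewrite expr0n.
have th2 x : mu.-integrable `]0, T[ (EFin \o (fun s => thr x s ^+ 2)).
  rewrite /thr; have [x01|x01] := boolP (x \in `]0, 1[).
    have [_] := thL x01 (lexx T); move=> h.
    have mth : measurable_fun `]0, T[ (theta x).
      apply: measurable_funTS; apply: continuous_measurable_fun; apply: continuous_th.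
      by move: x01; rewrite in_itv/= => /andP[-> /ltW].
    have [_] : L2r `]0, T[ (theta x); last by [].
    apply: (L2r_bounded (M := 2 * Num.sqrt T / x ^+ 2 + 8 * Num.sqrt T)) => //.
      exact: fin_itv.
    by move=> s; rewrite /= in_itv/= => /andP[_ /ltW sT]; exact: theta_bounded.
  by apply: eq_integrable (integrable0 _ _) => //= s _; rewrite expr0n.
have iF1 x : mu.-integrable setT (EFin \o F x).
  rewrite Fs (_ : EFin \o _ = (EFin \o (fun s => thr x s ^+ 2)) \_ `]0, T[).
    exact: (integrable_mkcond _ _).1.
  by apply/funext => s; rewrite /patch/=; case: ifP.
pose c s : R := (Num.sqrt s)^-1 + 8 * Num.sqrt s.
have c0 s : 0 <= c s by rewrite addr_ge0 ?invr_ge0 ?mulr_ge0 ?sqrtr_ge0.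
have Fy s : F ^~ s = (fun x => (\1_(`]0, T[%classic) s : R) ^+ 2 * (theta x s) ^+ 2) \_ `]0, 1[.
  apply/funext => x; rewrite /F /thr /patch mem_setE.
  by case: ifPn => _; rewrite ?mul0r ?expr0n//= exprMn mulrC.
have i2 s : 0 < s -> mu.-integrable `]0, 1[ (EFin \o (fun x => (\1_(`]0, T[%classic) s : R) ^+ 2 * (theta x s) ^+ 2)).
  move=> s0; apply: (bounded_Rintegrable (m := mu) (M := c s ^+ 2)) => //.
  - exact: fin_itv.
  - apply: measurable_funM => //; apply: measurable_funX; exact: measurable_th_x.
  - move=> x x01; rewrite ger0_norm; last by apply: mulr_ge0; exact: sqr_ge0.
    have h : theta x s ^+ 2 <= c s ^+ 2.
      by apply: lerXn2r; rewrite ?nnegrE ?theta_ge0//; exact: theta_sup (ltW s0).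
    by rewrite indicE; case: (_ \in _); rewrite ?expr1n ?mul1r// expr0n mul0r sqr_ge0.
have iF2 s : mu.-integrable setT (EFin \o (F ^~ s)).
  have [s0|s0] := leP s 0.
    apply: eq_integrable (integrable0 _ _) => //= x _.
    by rewrite /F indicE memNset ?mulr0 ?expr0n//= in_itv/= ltNge s0.
  rewrite Fy (_ : EFin \o _ = (EFin \o (fun x => (\1_(`]0, T[%classic) s : R) ^+ 2 * (theta x s) ^+ 2)) \_ `]0, 1[).
    by apply/(integrable_mkcond _ _).1 => //; exact: i2.
  by apply/funext => x; rewrite /patch/=; case: ifP.
have [] := @RFubini R F (fun s => (c \_ `]0, T[) s) mF iF1 iF2.
- have ic : mu.-integrable `]0, T[ (EFin \o c).
    have i1 := integrable_sqrtV T.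
    have i3 : mu.-integrable `]0, T[ (EFin \o (fun s => 8 * Num.sqrt s)).
      apply: (bounded_Rintegrable (m := mu) (M := 8 * Num.sqrt T)) => //; first exact: fin_itv.
        apply: measurable_funM => //; apply: measurable_funTS; apply: continuous_measurable_fun.
        exact: sqrt_continuous.
      move=> s; rewrite /= in_itv/= => /andP[_ /ltW sT].
      by rewrite ger0_norm ?mulr_ge0 ?sqrtr_ge0//; apply: ler_wpM2l => //; exact: ler_wsqrtr.
    by have : mu.-integrable `]0, T[ (fun s => ((Num.sqrt s)^-1)%:E + (8 * Num.sqrt s)%:E)%E by exact: integrableD.
  rewrite (_ : EFin \o _ = (EFin \o c) \_ `]0, T[); first exact: (integrable_mkcond _ _).1.
  by apply/funext => s; rewrite /patch/=; case: ifP.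
- move=> s; rewrite /patch mem_setE; case: ifPn => sT; last first.
    rewrite (_ : (fun x => _) = cst 0); first by rewrite Rintegral_cst// mul0r.
    by apply/funext => x; rewrite /F indicE mem_setE (negbTE sT) mulr0 expr0n normr0.
  have s0 : 0 < s by move: sT; rewrite in_itv/= => /andP[].
  have -> : \int[mu]_x `|F x s| = \int[mu]_(x in `]0, 1[) (theta x s ^+ 2).
    rewrite [RHS]Rintegral_mkcond; apply: eq_Rintegral => x _.
    rewrite -[F x s]/((F ^~ s) x) Fy /patch mem_setE; case: ifPn => x01; last by rewrite normr0.
    by rewrite indicE mem_setE sT expr1n mul1r ger0_norm ?sqr_ge0.
  apply: (@le_trans _ _ (\int[mu]_(x in `]0, 1[) (c s * (2 * theta x s)))).
    have ith := integrable_th s.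
    apply: le_Rintegral => //.
    - by apply: eq_integrable (i2 s s0) => //= x _; rewrite indicE mem_setE sT expr1n mul1r.
    - by have : mu.-integrable `]0, 1[ (fun x => (c s)%:E * (2 * theta x s)%:E)%E by exact: integrableZl.
    - move=> x x01; rewrite expr2; apply: ler_pM; rewrite ?theta_ge0//; first exact: theta_sup (ltW s0).
      by rewrite ler_peMl ?theta_ge0// ler1n.
  rewrite RintegralZl//; last exact: integrable_th.
  have := kf_cst 1 s0; rewrite /kf; under eq_Rintegral do rewrite mulr1.
  by move=> ->; rewrite mulr1.
move=> i1 _; apply/(integrable_mkcond _ _).2 => //.
apply: eq_integrable i1 => // x _; rewrite /= /patch mem_setE.
have -> : \int[mu]_s F x s = \int[mu]_(s in `]0, T[) (thr x s ^+ 2).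
  by rewrite [RHS]Rintegral_mkcond -Fs.
rewrite /thr; case: ifPn => // x01; congr EFin.
under eq_Rintegral do rewrite expr0n; by rewrite Rintegral_cst// mul0r.
Qed.

Let U := \int[mu]_(s in `]0, T[) (u s ^+ 2).

Let U0 : 0 <= U. Proof. by apply: Rintegral_ge0 => s _; exact: sqr_ge0. Qed.

(** Cauchy-Schwarz in time, with a majorant that does not depend on t. *)
Let layer_sq x t : x \in `]0, 1[ -> t <= T -> layer t x ^+ 2 <= 4 * G x * U.
Proof.
move=> x01 tT; have thLt := thL x01 tT.
have [i1 cs] := cauchy_schwarz (measurable_itv _) thLt uL.
have -> : layer t x = 2 * \int[mu]_(s in `]0, T[) (theta x (t - s) * u s).
  rewrite -RintegralZl// layer_ext// [RHS]Rintegral_mkcond; apply: eq_Rintegral => s _.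
  by rewrite /thr x01 /ue /patch; case: ifP => _; rewrite ?mulr0// mulrA.
suff h : \int[mu]_(s in `]0, T[) (theta x (t - s) ^+ 2) <= G x.
  have {}cs := le_trans cs (ler_wpM2r U0 h).
  move: cs; move: (\int[mu]_(s in `]0, T[) (theta x (t - s) * u s)) => I.
  by move: (G x) (U) => g v cs; lra.
have th2 : mu.-integrable `]0, T[ (EFin \o (fun s => theta x s ^+ 2)).
  have [_] : L2r `]0, T[ (theta x); last by [].
  apply: (L2r_bounded (M := 2 * Num.sqrt T / x ^+ 2 + 8 * Num.sqrt T)) => //.
  - exact: fin_itv.
  - apply: measurable_funTS; apply: continuous_measurable_fun; apply: continuous_th.
    by move: x01; rewrite in_itv/= => /andP[-> /ltW].
  - by move=> s; rewrite /= in_itv/= => /andP[_ /ltW sT]; exact: theta_bounded.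
pose g := (fun s => theta x s ^+ 2) \_ `]0, T[.
have mg : measurable_fun setT g.
  by apply/(measurable_restrictT _ _).1 => //; case/integrableP : th2 => /measurable_EFinP.
have ig : mu.-integrable setT (EFin \o g).
  rewrite (_ : EFin \o g = (EFin \o (fun s => theta x s ^+ 2)) \_ `]0, T[).
    exact: (integrable_mkcond _ _).1.
  by apply/funext => s; rewrite /g /patch/=; case: ifP.
rewrite /G [leRHS]Rintegral_mkcond -/g -(Rintegral_reflect t mg) Rintegral_mkcond.
apply: le_Rintegral => //.
- have [_ h] := thLt; move/(integrable_mkcond _ _).1 : h => /(_ (measurable_itv _)).
  by apply: eq_integrable => // s _; rewrite /patch/=; case: ifP.
- exact: (integrable_reflect t ig).
move=> s _; rewrite /g /patch !mem_setE !in_itv/=.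
have [s0|s0] /= := ltP 0 s; last by case: ifP => // _; exact: sqr_ge0.
have [sT|sT] := ltP s T; last by case: ifP => // _; exact: sqr_ge0.
have [ts|ts] := ltP s t.
  by rewrite subr_gt0 ts (_ : t - s < T)//; lra.
by rewrite theta_neg ?subr_le0// expr0n/= ltNge subr_le0 ts.
Qed.

Let measurable_W t : t <= T -> measurable_fun (`]0, 1[%classic : set R) (layer t).
Proof.
move=> tT; have [i1 _] := layer_moment tT (fun x => cvg_cst (1 : R)).
case/integrableP : i1 => /measurable_EFinP + _.
by apply: eq_measurable_fun => x _; rewrite mulr1.
Qed.

Lemma layer_L2r t : t <= T -> L2r `]0, 1[ (layer t).
Proof.
move=> tT; split; first exact: measurable_W.
apply: (le_Rintegrable (m := mu) (g := fun x => 4 * G x * U)) => //.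
- by apply: measurable_funX; exact: measurable_W.
- by move=> x x01; rewrite ger0_norm ?sqr_ge0//; exact: layer_sq.
- have : mu.-integrable `]0, 1[ (fun x => (4 * U)%:E * (G x)%:E)%E by exact: integrableZl.
  by apply: eq_integrable => // x _; rewrite -EFinM; congr EFin; ring.
Qed.

Let layer_cvg x (a : nat -> R) (t : R) : x \in `]0, 1[ -> (forall n, a n <= T) -> t <= T ->
  a n @[n --> \oo] --> t -> layer (a n) x @[n --> \oo] --> layer t x.
Proof.
move=> x01 aT tT at_.
pose B := 2 * Num.sqrt T / x ^+ 2 + 8 * Num.sqrt T.
have x01' : 0 < x <= 1 by move: x01; rewrite in_itv/= => /andP[-> /ltW].
have := @Rdominated_cvg R _ _ mu setT (fun n s => 2 * thr x (a n - s) * ue s)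
  (fun s => 2 * thr x (t - s) * ue s) (fun s => 2 * B * `|ue s|) measurableT.
case=> [n|s _||n s _|_].
- by case/integrableP : (thr_int x (aT n)) => /measurable_EFinP.
- apply: cvgM; last exact: cvg_cst.
  apply: cvgM; first exact: cvg_cst.
  rewrite /thr x01; apply: (cvg_comp _ (theta x)); last exact: continuous_th.
  by apply: cvgB => //; exact: cvg_cst.
- have : mu.-integrable setT (fun s => (2 * B)%:E * `|ue s|%:E)%E.
    by apply: integrableZl => //; exact: integrable_norm.
  by apply: eq_integrable.
- rewrite normrM normrM (ger0_norm (x := 2))// /thr x01.
  rewrite /ue /patch; case: ifPn; rewrite ?normr0 ?mulr0// inE/= in_itv/= => /andP[s0 sT].
  apply: ler_wpM2r => //; apply: ler_wpM2l => //; apply: theta_bounded => //.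
  by have := aT n; lra.
by rewrite layer_ext//; under eq_fun do rewrite -layer_ext//.
Qed.

(** Dominated convergence along sequences. Beyond T the time is clipped, which
    turns the one-sided limits at the end points into ordinary ones. *)
Lemma layer_continuous t : t \in `[0, T] ->
  \int[mu]_(x in `]0, 1[) (layer s x - layer t x) ^+ 2 @[s --> within `[0, T] (nbhs t)] --> (0 : R).
Proof.
rewrite in_itv/= => /andP[t0 tT].
pose h s := \int[mu]_(x in `]0, 1[) (layer (Num.min s T) x - layer t x) ^+ 2.
have ch : h s @[s --> t] --> (0 : R).
  apply/(@cvg_nbhsP _ R^o) => a at_.
  have amT n : Num.min (a n) T <= T by rewrite ge_min lexx orbT.
  have am : Num.min (a n) T @[n --> \oo] --> t.
    have cm : continuous (fun s : R => Num.min s T).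
      by apply: (lipschitz_continuous (L := 1)) => r s; rewrite mul1r lip_min.
    have e : t = Num.min t T by rewrite (min_idPl tT).
    by rewrite [X in _ --> X]e; exact: (cvg_comp _ _ at_ (cm t)).
  have := @Rdominated_cvg R _ _ mu `]0, 1[%classic (fun n x => (layer (Num.min (a n) T) x - layer t x) ^+ 2)
    (fun=> 0) (fun x => 16 * G x * U) (measurable_itv _).
  case=> [n|x x01||n x x01|_].
  - by apply: measurable_funX; apply: measurable_funB; exact: measurable_W.
  - have -> : (0 : R) = (layer t x - layer t x) ^+ 2 by rewrite subrr expr0n.
    have c1 : layer (Num.min (a n) T) x - layer t x @[n --> \oo] --> layer t x - layer t x.
      by apply: cvgB; [exact: layer_cvg|exact: cvg_cst].
    by apply: (cvg_comp _ (fun y => y ^+ 2) c1); exact: exprn_continuous.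
  - have : mu.-integrable `]0, 1[ (fun x => (16 * U)%:E * (G x)%:E)%E by exact: integrableZl.
    by apply: eq_integrable => // x _; rewrite -EFinM; congr EFin; ring.
  - rewrite ger0_norm ?sqr_ge0//.
    have h1 := layer_sq x01 (amT n); have h2 := layer_sq x01 tT.
    move: h1 h2; rewrite -!mulrA; move: (G x * U) (layer (Num.min _ _) x) (layer t x) => v y z h1 h2.
    rewrite (_ : (y - z) ^+ 2 = 2 * y ^+ 2 + 2 * z ^+ 2 - (y + z) ^+ 2); last by ring.
    by have := sqr_ge0 (y + z); lra.
  by rewrite Rintegral_cst// mul0r.
apply: cvg_trans (cvg_within_filter _ ch); apply: near_eq_cvg.
near=> s; rewrite /h; have : s \in `[0, T].
  by near: s; apply: withinT; exact: nbhs_filter.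
by rewrite in_itv/= => /andP[_ sT]; rewrite (min_idPl sT).
Unshelve. all: by end_near. Qed.

End layer.

(** * Duhamel's principle for the layer potential *)

Section layer_weak.
Context {R : realType}.
Local Notation mu := (@lebesgue_measure R).
Variables (T : R) (u : R -> R).
Hypothesis uL : L2r `]0, T[ u.

(** Duhamel's principle: the time primitive of the kernel identity is
    integrated against the flux, and the order of the two time integrations is
    exchanged over the triangle s < r < t. *)
Lemma layer_weak_identity (f f1 f2 : R -> R) t : (forall x : R, is_derive x 1 f (f1 x)) ->
  (forall x : R, is_derive x 1 f1 (f2 x)) -> continuous f2 -> f1 0 = 0 -> f1 1 = 0 ->
  0 <= t <= T ->
  \int[mu]_(x in `]0, 1[) (layer u t x * f x) =
  \int[mu]_(s in `]0, t[) (\int[mu]_(x in `]0, 1[) (layer u s x * f2 x))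
  + f 0 * \int[mu]_(s in `]0, t[) u s.
Proof.
move=> df df1 cf2 f10 f11 /andP[t0 tT].
have cf : continuous f.
  by move=> y; apply: differentiable_continuous; apply/derivable1_diffP; case: (df y).
rewrite (layer_moment uL tT cf).2.
have [M M0 fM] := continuous_bounded01 cf2.
have kM s : `|kf f2 s| <= M by exact: kf_le.
have mk := measurable_kf cf2.
pose ut := u \_ `]0, t[.
have uLt : L2r `]0, t[ u.
  apply: L2rS uL => // s /=; rewrite !in_itv/= => /andP[-> st]; exact: lt_le_trans tT.
have iu : mu.-integrable `]0, t[ (EFin \o u) by apply: L2r_integrable => //; exact: fin_itv.
have mut : measurable_fun setT ut by apply/(measurable_restrictT _ _).1 => //; case: uLt.
have iut : mu.-integrable setT (EFin \o ut).
  rewrite (_ : EFin \o ut = (EFin \o u) \_ `]0, t[).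
    exact: (integrable_mkcond _ _).1.
  by apply/funext => x; rewrite /ut /patch/=; case: ifP.
have iaut : mu.-integrable setT (EFin \o (fun s => `|ut s|)).
  have : mu.-integrable setT (fun s => `|(ut s)%:E|)%E by exact: integrable_norm.
  by apply: eq_integrable.
pose I1 (r : R) : R := \1_(`]0, t[%classic : set R) r.
have mI1 : measurable_fun setT I1 by exact: measurable_indic.
have I1_le r : `|I1 r| <= 1 by rewrite /I1 indicE; case: (_ \in _); rewrite ?normr1// normr0.
(* As kf f2 vanishes at nonpositive times, F is supported in s < r < t. *)
pose F r s := I1 r * kf f2 (r - s) * ut s.
have mF : measurable_fun setT (fun z : R * R => F z.1 z.2).
  apply: measurable_funM; last exact: (measurableT_comp mut measurable_snd).
  apply: measurable_funM; first exact: (measurableT_comp mI1 measurable_fst).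
  apply: (measurableT_comp (f := kf f2) mk).
  by apply: measurable_funB; [exact: measurable_fst|exact: measurable_snd].
have FM r s : `|F r s| <= `|I1 r| * M * `|ut s|.
  by rewrite /F !normrM; apply: ler_wpM2r => //; apply: ler_wpM2l.
have mB (s : R) : measurable_fun setT (fun r : R => kf f2 (r - s)).
  by apply: (measurableT_comp (f := kf f2) mk); exact: measurable_funB.
have mC (r : R) : measurable_fun setT (fun s : R => kf f2 (r - s)).
  by apply: (measurableT_comp (f := kf f2) mk); exact: measurable_funB.
have iF1 r : mu.-integrable setT (EFin \o F r).
  apply: (@le_Rintegrable _ _ _ mu setT (F r) (fun s => `|I1 r| * M * `|ut s|)).
  - exact: measurableT.
  - apply: measurable_funM; last exact: mut.
    by apply: measurable_funM; [exact: measurable_cst|exact: mC].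
  - by move=> s _; exact: FM.
  have : mu.-integrable setT (fun s => (`|I1 r| * M)%:E * `|ut s|%:E)%E by exact: integrableZl.
  by apply: eq_integrable.
have iI1 : mu.-integrable setT (EFin \o I1).
  rewrite (_ : EFin \o I1 = (EFin \o cst 1) \_ (`]0, t[%classic : set R)).
    apply/(integrable_mkcond _ _).1 => //.
    by apply: (bounded_Rintegrable (m := mu) (M := 1)) => //; [exact: fin_itv|move=> x _; rewrite normr1].
  by apply/funext => x; rewrite /I1 /patch/= indicE; case: (_ \in _).
have iaI1 : mu.-integrable setT (EFin \o (fun s => `|I1 s|)).
  have : mu.-integrable setT (fun s => `|(I1 s)%:E|)%E by exact: integrable_norm.
  by apply: eq_integrable.
have eI1 : \int[mu]_r `|I1 r| = t.
  rewrite (_ : (fun r => `|I1 r|) = (fun=> 1 : R) \_ (`]0, t[%classic : set R)).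
    rewrite -Rintegral_mkcond Rintegral_cst// mul1r.
    by rewrite /= lebesgue_measure_itv/= lte_fin; case: ltgtP t0 => //= <-; rewrite ?subr0.
  by apply/funext => x; rewrite /I1 /patch/= indicE; case: (_ \in _); rewrite ?normr1// normr0.
have iM (s : R) : mu.-integrable setT (EFin \o (fun r => `|I1 r| * M * `|ut s|)).
  have : mu.-integrable setT (fun r => (M * `|ut s|)%:E * `|I1 r|%:E)%E by exact: integrableZl.
  by apply: eq_integrable => // r _; rewrite -EFinM; congr EFin; rewrite mulrC mulrA.
have iF2 s : mu.-integrable setT (EFin \o (F ^~ s)).
  apply: (@le_Rintegrable _ _ _ mu setT (F ^~ s) (fun r => `|I1 r| * M * `|ut s|)).
  - exact: measurableT.
  - apply: measurable_funM; last exact: measurable_cst.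
    by apply: measurable_funM; [exact: mI1|exact: mB].
  - by move=> r _; exact: FM.
  - exact: iM.
have [] := @RFubini R F (fun s => t * M * `|ut s|) mF iF1 iF2.
- have : mu.-integrable setT (fun s => (t * M)%:E * `|ut s|%:E)%E by exact: integrableZl.
  by apply: eq_integrable.
- move=> s; apply: (@le_trans _ _ (\int[mu]_r (`|I1 r| * M * `|ut s|))).
    apply: le_Rintegral => //.
    have : mu.-integrable setT (fun r => `|(F r s)%:E|)%E by apply: integrable_norm => //; exact: iF2.
    by apply: eq_integrable.
  rewrite (_ : (fun r => _) = (fun r => (M * `|ut s|) * `|I1 r|)); last first.
    by apply/funext => r; rewrite -mulrA mulrC.
  by rewrite RintegralZl// eI1 mulrC mulrA.
move=> _ FE.
have E1 : \int[mu]_r (\int[mu]_s F r s) =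
    \int[mu]_(s in `]0, t[) (\int[mu]_(x in `]0, 1[) (layer u s x * f2 x)).
  rewrite [RHS]Rintegral_mkcond; apply: eq_Rintegral => r _.
  have z : \int[mu]_s (0 * kf f2 (r - s) * ut s) = 0.
    rewrite (_ : (fun s => 0 * kf f2 (r - s) * ut s) = (fun=> 0)); last by apply/funext => s; rewrite !mul0r.
    by rewrite Rintegral_cst// mul0r.
  rewrite /patch mem_setE /F /I1 indicE mem_setE in_itv/=.
  have [r0|r0] /= := ltP 0 r; last by rewrite z.
  have [rt|rt] := ltP r t; last by rewrite z.
  rewrite (layer_moment uL (le_trans (ltW rt) tT) cf2).2 [RHS]Rintegral_mkcond.
  apply: eq_Rintegral => s _; rewrite mul1r /ut /patch !mem_setE !in_itv/=.
  have [s0|s0] /= := ltP 0 s; last by rewrite mulr0.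
  have [sr|sr] := ltP s r; first by rewrite (lt_trans sr rt).
  by rewrite kf_neg ?subr_le0// mul0r.
have E2 s : \int[mu]_r F r s = ut s * \int[mu]_(r in `]0, (t - s)[) kf f2 r.
  have -> : (fun r => F r s) = (fun r => ut s * (I1 r * kf f2 (r - s))).
    by apply/funext => r; rewrite /F mulrC.
  have iK : mu.-integrable setT (EFin \o (fun r => I1 r * kf f2 (r - s))).
    apply: (@le_Rintegrable _ _ _ mu setT (fun r => I1 r * kf f2 (r - s)) (fun r => M * `|I1 r|)).
    - exact: measurableT.
    - by apply: measurable_funM; [exact: mI1|exact: mB].
    - by move=> r _; rewrite normrM mulrC; apply: ler_wpM2r.
    - have : mu.-integrable setT (fun r => M%:E * `|I1 r|%:E)%E by exact: integrableZl.
      by apply: eq_integrable.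
  rewrite RintegralZl// /ut /patch; case: ifPn; last by rewrite !mul0r.
  rewrite inE/= in_itv/= => /andP[s0 st]; congr (_ * _).
  rewrite [RHS]Rintegral_mkcond.
  have mres : measurable_fun setT (kf f2 \_ (`]0, (t - s)[%classic : set R)).
    by apply/(measurable_restrictT _ _).1 => //; apply: measurable_funTS; exact: mk.
  rewrite -(Rintegral_translate s mres).
  apply: eq_Rintegral => r _; rewrite /I1 indicE /patch !mem_setE !in_itv/= ltrBlDr subrK subr_gt0.
  have [rs|rs] := ltP s r; last first.
    by rewrite kf_neg ?subr_le0// mulr0.
  by rewrite (lt_trans s0 rs)/=; case: ltP; rewrite ?mul1r// mul0r.
have [M' M'0 fM'] := continuous_bounded01 cf.
have iau : mu.-integrable `]0, t[ (fun s => `|(u s)%:E|)%E by exact: integrable_norm.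
have iK : mu.-integrable `]0, t[ (EFin \o (fun s => kf f (t - s) * u s)).
  apply: (@le_Rintegrable _ _ _ mu `]0, t[%classic (fun s => kf f (t - s) * u s) (fun s => M' * `|u s|)).
  - exact: measurable_itv.
  - apply: measurable_funM; last by case: uLt.
    apply: measurable_funTS; apply: (measurableT_comp (f := kf f) (measurable_kf cf)).
    exact: measurable_funB.
  - by move=> s _; rewrite normrM; apply: ler_wpM2r => //; exact: kf_le.
  - have : mu.-integrable `]0, t[ (fun s => M'%:E * `|u s|%:E)%E by exact: integrableZl.
    by apply: eq_integrable.
have iC : mu.-integrable `]0, t[ (EFin \o (fun s => f 0 * u s)).
  have : mu.-integrable `]0, t[ (fun s => (f 0)%:E * (u s)%:E)%E by exact: integrableZl.
  by apply: eq_integrable.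
rewrite -RintegralZl// -E1 FE; apply/eqP; rewrite -subr_eq -RintegralB//; apply/eqP.
rewrite [LHS]Rintegral_mkcond; apply: eq_Rintegral => s _; rewrite E2 /ut /patch.
case: ifPn; last by rewrite mul0r.
rewrite inE/= in_itv/= => /andP[s0 st].
rewrite (kernel_identity df df1 cf2 f10 f11); last by rewrite subr_gt0.
by move: (\int[mu]_(r in _) _) => J; ring.
Qed.

End layer_weak.

(** * Uniqueness of weak solutions *)

Section volterra.
Context {R : realType}.
Local Notation mu := (@lebesgue_measure R).

Lemma Rintegral_FTC_oo f F (a b : R) : a <= b -> continuous f ->
  (forall x : R, is_derive x 1 F (f x)) -> \int[mu]_(x in `]a, b[) f x = F b - F a.
Proof.
move=> ab cf dF; rewrite -(Rintegral_FTC ab cf dF).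
have ii : mu.-integrable `[a, b] (EFin \o f).
  by apply: continuous_compact_integrable; [exact: segment_compact|exact: continuous_subspaceT].
rewrite Rintegral_itv_bndo_bndc; last first.
  by apply: integrableS ii => //; apply: subset_itv; rewrite bnd_simp.
by rewrite Rintegral_itv_obnd_cbnd//; apply: integrableS ii => //; apply: subset_itv; rewrite bnd_simp.
Qed.

Lemma Rintegral_exprn (t : R) k : 0 <= t ->
  \int[mu]_(s in `]0, t[) (s ^+ k / k`!%:R) = t ^+ k.+1 / k.+1`!%:R.
Proof.
move=> t0.
have c : continuous (fun s : R => s ^+ k / k`!%:R).
  by move=> s; apply: cvgM; [exact: exprn_continuous|exact: cvg_cst].
have d (s : R) : is_derive s 1 (fun s : R => s ^+ k.+1 / k.+1`!%:R) (s ^+ k / k`!%:R).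
  have h : is_derive s 1 (fun s : R => s ^+ k.+1) (k.+1%:R * s ^+ k).
    have h := is_deriveX k.+1 (is_derive_id s (1 : R)).
    rewrite (_ : (fun s : R => s ^+ k.+1) = (@idfun R : R -> R) ^+ k.+1); last first.
      by apply/funext => x; rewrite exprfctE.
    by apply: (is_derive_eq h); rewrite /GRing.scale/= mulr1.
  have := is_derive_mulc (k.+1`!%:R)^-1 h.
  rewrite (_ : (fun x => _) = (fun s : R => s ^+ k.+1 / k.+1`!%:R)); last first.
    by apply/funext => x; rewrite mulrC.
  rewrite (_ : (k.+1`!%:R)^-1 * _ = s ^+ k / k`!%:R)//.
  rewrite factS natrM invfM; have := ltr0Sn R k; move: (k.+1%:R : R) ((k`!)%:R^-1 : R) => a b a0.
  by field; rewrite gt_eqF.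
by rewrite (Rintegral_FTC_oo t0 c d) expr0n/= mul0r subr0.
Qed.

(** Iterating the integral equation k times gains a factor (l t)^k / k!. *)
Lemma volterra0 (T l B : R) (e : R -> R) : 0 <= l -> measurable_fun `]0, T[ e ->
  (forall t, 0 <= t <= T -> `|e t| <= B) ->
  (forall t, 0 <= t <= T -> e t = - l * \int[mu]_(s in `]0, t[) e s) ->
  forall t, 0 <= t <= T -> e t = 0.
Proof.
move=> l0 me eB eE.
have step k t : 0 <= t <= T -> `|e t| <= B * l ^+ k * (t ^+ k / k`!%:R).
  elim: k t => [|k IH] t tT.
    by rewrite !expr0 fact0 invr1 !mulr1 eB.
  have /andP[t0 tT'] := tT.
  have sub : `]0, t[ `<=` `]0, T[.
    by move=> s /=; rewrite !in_itv/= => /andP[-> /lt_le_trans ->].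
  have met : measurable_fun `]0, t[ e by apply: measurable_funS me.
  have eBt (s : R) : s \in `]0, t[ -> `|e s| <= B.
    by rewrite in_itv/= => /andP[s0 st]; apply: eB; rewrite !ltW// (lt_le_trans st).
  have ie : mu.-integrable `]0, t[ (EFin \o e).
    by apply: (bounded_Rintegrable (m := mu) (M := B)) => //; exact: fin_itv.
  have ip : mu.-integrable `]0, t[ (EFin \o (fun s : R => s ^+ k / k`!%:R)).
    apply: (bounded_Rintegrable (m := mu) (M := t ^+ k / k`!%:R)) => //; first exact: fin_itv.
      apply: measurable_funTS; apply: continuous_measurable_fun.
      by move=> s; apply: cvgM; [exact: exprn_continuous|exact: cvg_cst].
    move=> s; rewrite /= in_itv/= => /andP[s0 st].
    rewrite ger0_norm ?divr_ge0 ?exprn_ge0 ?ler0n ?(ltW s0)//.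
    apply: ler_wpM2r; first by rewrite invr_ge0 ler0n.
    by apply: lerXn2r; rewrite ?nnegrE ?(ltW s0) ?(ltW st).
  rewrite eE// normrM normrN (ger0_norm l0).
  have h : `|\int[mu]_(s in `]0, t[) e s| <= B * l ^+ k * (t ^+ k.+1 / k.+1`!%:R).
    rewrite -(Rintegral_exprn k t0) -RintegralZl//.
    apply: le_trans (le_normr_Rintegral _ ie) _ => //.
    apply: le_Rintegral => //.
    - by have : mu.-integrable `]0, t[ (fun s => `|(e s)%:E|)%E by exact: integrable_norm.
    - have : mu.-integrable `]0, t[ (fun s => (B * l ^+ k)%:E * (s ^+ k / k`!%:R)%:E)%E by exact: integrableZl.
      by apply: eq_integrable.
    - by move=> s; rewrite /= in_itv/= => /andP[s0 st]; apply: IH; rewrite !ltW// (lt_le_trans st).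
  apply: le_trans (ler_wpM2l l0 h) _; rewrite (exprS l).
  by move: (t ^+ k.+1 / _) (l ^+ k) => a b; rewrite le_eqVlt; apply/orP; left; apply/eqP; ring.
move=> t tT; have /andP[t0 _] := tT.
have cv : B * exp_coeff (l * t) k @[k --> \oo] --> (0 : R).
  have := cvg_series_cvg_0 (is_cvg_series_exp_coeff (l * t)) => h.
  by have := cvgM (cvg_cst B) h; rewrite mulr0; apply.
apply/eqP; rewrite -normr_le0.
have -> : (0 : R) = limn (fun k => B * exp_coeff (l * t) k).
  by apply/esym/cvg_lim => //; exact: Rhausdorff.
apply: limr_ge; first by apply/cvg_ex; exists 0.
apply: nearW => k; apply: le_trans (step k t tT) _.
by rewrite /exp_coeff/= exprMn !mulrA.
Qed.

Lemma sin_natpi n : sin (n%:R * pi) = 0 :> R.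
Proof.
elim: n => [|n IH]; first by rewrite mul0r sin0.
by rewrite -natr1 mulrDl mul1r sinDpi IH oppr0.
Qed.

Lemma cos_natpi n : cos (n%:R * pi) = (-1) ^+ n :> R.
Proof.
elim: n => [|n IH]; first by rewrite mul0r cos0.
by rewrite -natr1 mulrDl mul1r cosDpi IH exprS mulN1r.
Qed.

Lemma cosn_reflect n (x : R) : cosn n (1 - x) = (-1) ^+ n * cosn n x.
Proof.
rewrite /cosn mulrBr mulr1 addrC cosD cosN sinN cos_natpi sin_natpi mulr0 subr0.
by rewrite mulrC.
Qed.

Lemma integral_cosn n : \int[mu]_(x in `]0, 1[) cosn n x = (n == 0%N)%:R :> R.
Proof.
case: n => [|n]; first by rewrite cosn0 Rintegral_cst//= lebesgue_measure_itv/= lte01 mul1r oppr0 adde0.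
have np : n.+1%:R * pi != 0 :> R by rewrite mulf_neq0// gt_eqF// pi_gt0.
have d (x : R) : is_derive x 1 (fun x : R => (n.+1%:R * pi)^-1 * sin (n.+1%:R * pi * x)) (cosn n.+1 x).
  apply: (is_derive_eq (is_derive_mulc (n.+1%:R * pi)^-1 (is_derive_sinM (n.+1%:R * pi) x))).
  by rewrite mulrA mulVf// mul1r.
rewrite (Rintegral_FTC_oo ler01 (@continuous_cosn R n.+1) d).
by rewrite mulr1 sin_natpi !mulr0 sin0 mulr0 subrr.
Qed.

End volterra.

Section real_solution.
Context {R : realType}.
Local Notation mu := (@lebesgue_measure R).

Let I01 : set R := `]0, 1[%classic.
Let mI : measurable I01. Proof. exact: measurable_itv. Qed.
Let fI : (mu I01 < +oo)%E. Proof. exact: fin_itv. Qed.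

(** The weak Neumann problem for real data. The derivatives of the test function
    are given explicitly, so that they can be computed with. *)
Definition real_solution (T : R) (ul ur : R -> R) (v : R -> R -> R) : Prop :=
  [/\ forall t, t \in `[0, T] -> L2r `]0, 1[ (v t),
      forall t, t \in `[0, T] ->
        \int[mu]_(x in `]0, 1[) (v s x - v t x) ^+ 2 @[s --> within `[0, T] (nbhs t)] --> (0 : R) &
      forall f f1 f2 : R -> R, (forall x : R, is_derive x 1 f (f1 x)) ->
        (forall x : R, is_derive x 1 f1 (f2 x)) -> continuous f2 -> f1 0 = 0 -> f1 1 = 0 ->
        forall t, t \in `[0, T] ->
        \int[mu]_(x in `]0, 1[) (v t x * f x) =
        \int[mu]_(s in `]0, t[) (\int[mu]_(x in `]0, 1[) (v s x * f2 x))
        + (f 1 * \int[mu]_(s in `]0, t[) ur s - f 0 * \int[mu]_(s in `]0, t[) ul s)].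

Lemma L2rB (u v : R -> R) : L2r I01 u -> L2r I01 v -> L2r I01 (fun x => u x - v x).
Proof.
move=> uL vL; have := L2rD mI uL (L2rZ (-1) mI vL).
by rewrite (_ : _ \+ _ = fun x => u x - v x)//; apply/funext => x; rewrite /= mulN1r.
Qed.

Lemma integrable_L2_continuous (v f : R -> R) : L2r I01 v -> continuous f ->
  mu.-integrable I01 (EFin \o (fun x => v x * f x)).
Proof. by move=> vL cf; apply: integrable_mul_continuous => //; exact: L2r_integrable. Qed.

Lemma L2r_continuous01 (f : R -> R) : continuous f -> L2r I01 f.
Proof.
move=> cf; have [M M0 fM] := continuous_bounded01 cf.
apply: (L2r_bounded (M := M)) => //; first by apply: measurable_funTS; exact: continuous_measurable_fun.
by move=> x x01; apply: fM; exact: itv01_sub.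
Qed.

(** By Cauchy-Schwarz, continuity in L^2 passes to every coefficient. *)
Lemma coef_continuous T (v : R -> R -> R) f : (forall t, t \in `[0, T] -> L2r I01 (v t)) ->
  (forall t, t \in `[0, T] ->
    \int[mu]_(x in I01) (v s x - v t x) ^+ 2 @[s --> within `[0, T] (nbhs t)] --> (0 : R)) ->
  continuous f -> {within `[0, T], continuous (fun t => \int[mu]_(x in I01) (v t x * f x))}.
Proof.
move=> vL vc cf; apply/subspace_continuousP => t tT; apply/cvgrPdist_le => e e0.
have fL := L2r_continuous01 cf.
pose F := \int[mu]_(x in I01) (f x ^+ 2).
have F0 : 0 <= F by apply: Rintegral_ge0 => x _; exact: sqr_ge0.
have d0 : 0 < e ^+ 2 / (F + 1) by rewrite divr_gt0 ?exprn_gt0// ltr_wpDl.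
have sT : \forall s \near within `[0, T] (nbhs t), s \in `[0, T] by apply: withinT; exact: nbhs_filter.
have /cvgrPdist_le/(_ _ d0) := vc t tT; apply: filterS2 sT => s sT.
rewrite sub0r normrN => h.
have vst := L2rB (vL s sT) (vL t tT).
have [_ cs] := cauchy_schwarz mI vst fL.
rewrite distrC -RintegralB//; [|exact: integrable_L2_continuous (vL _ _) cf..].
rewrite (_ : (fun x => v s x * f x - v t x * f x) = (fun x => (v s x - v t x) * f x)); last first.
  by apply/funext => x; rewrite mulrBl.
rewrite -(@ler_pXn2r _ 2)// ?nnegrE ?(ltW e0)// real_normK ?num_real//.
apply: le_trans cs _; rewrite -/F.
apply: (@le_trans _ _ (e ^+ 2 / (F + 1) * F)).
  by apply: ler_wpM2r => //; apply: le_trans h; exact: ler_norm.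
rewrite -mulrA ler_piMr ?sqr_ge0//.
by rewrite mulrC ler_pdivrMr ?mul1r ?lerDl// ltr_wpDl.
Qed.

Lemma coef_integrable T (v : R -> R -> R) f t : (forall t, t \in `[0, T] -> L2r I01 (v t)) ->
  (forall t, t \in `[0, T] ->
    \int[mu]_(x in I01) (v s x - v t x) ^+ 2 @[s --> within `[0, T] (nbhs t)] --> (0 : R)) ->
  continuous f -> t \in `[0, T] ->
  mu.-integrable `]0, t[ (EFin \o (fun t => \int[mu]_(x in I01) (v t x * f x))).
Proof.
move=> vL vc cf; rewrite in_itv/= => /andP[t0 tT].
have ii : mu.-integrable `[0, T] (EFin \o (fun t => \int[mu]_(x in I01) (v t x * f x))).
  by apply: continuous_compact_integrable; [exact: segment_compact|exact: coef_continuous].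
apply: integrableS ii => // s /=; rewrite !in_itv/= => /andP[s0 st].
by rewrite (ltW s0) (le_trans (ltW st)).
Qed.

(** The difference of two solutions has no flux, so that its coefficient on
    cos (n pi x) solves c' = - lam n c with c(0) = 0. *)
Lemma real_solution_unique T ul ur v1 v2 : 0 <= T ->
  real_solution T ul ur v1 -> real_solution T ul ur v2 ->
  {ae mu, forall x, x \in `]0, 1[ -> v1 T x = v2 T x}.
Proof.
move=> T0 [L1 C1 w1] [L2 C2 w2].
have TT : T \in `[0, T] by rewrite in_itv/= T0 lexx.
suff cf n : \int[mu]_(x in I01) (v1 T x * cosn n x) = \int[mu]_(x in I01) (v2 T x * cosn n x).
  have dL := L2rB (L1 _ TT) (L2 _ TT).
  have := cosine_complete (L2r_integrable mI fI dL).
  case=> [n|A [mA A0 AS]].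
    rewrite (_ : (fun x => _) = (fun x => v1 T x * cosn n x - v2 T x * cosn n x)); last first.
      by apply/funext => x; rewrite mulrBl.
    rewrite RintegralB//; first by rewrite cf subrr.
    - exact: integrable_L2_continuous (L1 _ TT) (@continuous_cosn R n).
    - exact: integrable_L2_continuous (L2 _ TT) (@continuous_cosn R n).
  exists A; split=> // x nx; apply: AS => h; apply: nx => x01.
  by have /eqP := h x01; rewrite subr_eq0 => /eqP.
pose c (v : R -> R -> R) t := \int[mu]_(x in I01) (v t x * cosn n x).
have cc := @continuous_cosn R n.
pose f1 (x : R) := - (n%:R * pi) * sin (n%:R * pi * x).
pose f2 (x : R) := - lam n * cosn n x.
have df (x : R) : is_derive x 1 (@cosn R n) (f1 x) by exact: is_derive_cosn.
have df1 (x : R) : is_derive x 1 f1 (f2 x).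
  apply: (is_derive_eq (is_derive_mulc (- (n%:R * pi)) (is_derive_sinM (n%:R * pi) x))).
  by rewrite /f2 /lam /cosn mulrA mulNr expr2.
have cf2 : continuous f2 by move=> x; apply: cvgM; [exact: cvg_cst|exact: cc].
have f10 : f1 0 = 0 by rewrite /f1 mulr0 sin0 mulr0.
have f11 : f1 1 = 0 by rewrite /f1 mulr1 sin_natpi mulr0.
have wc v : (forall t, t \in `[0, T] -> L2r I01 (v t)) -> forall t, t \in `[0, T] ->
    \int[mu]_(s in `]0, t[) (\int[mu]_(x in I01) (v s x * f2 x)) =
    \int[mu]_(s in `]0, t[) (- lam n * c v s).
  move=> vL t; rewrite in_itv/= => /andP[t0 tT].
  apply: eq_Rintegral => s; rewrite inE/= in_itv/= => /andP[s0 st].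
  have sT : s \in `[0, T] by rewrite in_itv/= (ltW s0) (le_trans (ltW st)).
  rewrite /c -RintegralZl//; last exact: integrable_L2_continuous (vL _ sT) cc.
  by apply: eq_Rintegral => x _; rewrite /f2 mulrCA.
have k1 := coef_continuous L1 C1 cc; have k2 := coef_continuous L2 C2 cc.
pose e t := c v1 t - c v2 t.
have ke : {within `[0, T], continuous e}.
  by move=> t; apply: continuousB; [exact: k1|exact: k2].
have me : measurable_fun `]0, T[ e.
  have : measurable_fun `[0, T] e by apply: subspace_continuous_measurable_fun.
  by apply: measurable_funS => //; exact: subset_itv_oo_cc.
have kae : {within `[0, T], continuous (fun t => `|e t|)}.
  by move=> t; apply: continuous_comp; [exact: ke|exact: norm_continuous].
have [m _ mM] := EVT_max T0 kae.
suff ee t : 0 <= t <= T -> e t = - lam n * \int[mu]_(s in `]0, t[) e s.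
  have TT' : 0 <= T <= T by rewrite T0 lexx.
  have := @volterra0 R T (lam n) `|e m| e (lam_ge0 _) me (fun t tT => mM t tT) ee T TT'.
  by move/eqP; rewrite subr_eq0 => /eqP.
move=> tT; have tT' : t \in `[0, T] by rewrite in_itv.
have i1 := coef_integrable L1 C1 cc tT'; have i2 := coef_integrable L2 C2 cc tT'.
rewrite /e {1}/c (w1 _ _ _ df df1 cf2 f10 f11 t tT') {1}/c (w2 _ _ _ df df1 cf2 f10 f11 t tT').
rewrite (wc v1 L1 t tT') (wc v2 L2 t tT') !RintegralZl// RintegralB//.
move: (\int[mu]_(s in _) c v1 s) (\int[mu]_(s in _) c v2 s) (\int[mu]_(s in _) ur s) => a b x.
by move: (\int[mu]_(s in _) ul s) => y; ring.
Qed.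

End real_solution.

(** * Existence of weak solutions and steering *)

Section potential_solution.
Context {R : realType}.
Local Notation mu := (@lebesgue_measure R).

Let I01 : set R := `]0, 1[%classic.
Let mI : measurable I01. Proof. exact: measurable_itv. Qed.
Let fI : (mu I01 < +oo)%E. Proof. exact: fin_itv. Qed.

Lemma L2r_reflect01 (u : R -> R) : L2r I01 u -> L2r I01 (fun x => u (1 - x)).
Proof.
move=> /(L2r_ext _ mI) uL; apply/(L2r_ext _ mI).
rewrite (_ : _ \_ _ = fun x => (u \_ I01) (1 - x)); first exact: L2r_reflect.
by apply/funext => x; rewrite /patch !mem_setE reflect_itv.
Qed.

(** The heat flow in (0, 1) from zero initial data whose derivative in x equals
    [ul] at x = 0 and [ur] at x = 1. *)
Definition state (ul ur : R -> R) t x : R := layer ur t (1 - x) - layer ul t x.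

Section fixed.
Variables (T : R) (ul ur : R -> R).
Hypotheses (lL : L2r `]0, T[ ul) (rL : L2r `]0, T[ ur).

Lemma state_L2r t : t \in `[0, T] -> L2r I01 (state ul ur t).
Proof.
rewrite in_itv/= => /andP[t0 tT]; apply: L2rB; last exact: layer_L2r lL _ tT.
by apply: L2r_reflect01; exact: layer_L2r rL _ tT.
Qed.

(** Reflecting x to 1 - x exchanges the two ends of the interval. *)
Lemma integral_state (f : R -> R) t : continuous f -> t \in `[0, T] ->
  \int[mu]_(x in I01) (state ul ur t x * f x) =
  \int[mu]_(x in I01) (layer ur t x * f (1 - x)) - \int[mu]_(x in I01) (layer ul t x * f x).
Proof.
move=> cf; rewrite in_itv/= => /andP[t0 tT].
have cg : continuous (fun x : R => f (1 - x)).
  move=> x; apply: (continuous_comp (f := fun x : R => 1 - x) (g := f)); last exact: cf.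
  by apply: cvgB; [exact: cvg_cst|exact: cvg_id].
have [i1 _] := layer_moment rL tT cg; have [i2 _] := layer_moment lL tT cf.
have m1 : measurable_fun I01 (fun x => layer ur t x * f (1 - x)) by case/integrableP : i1 => /measurable_EFinP.
have e x : layer ur t (1 - x) * f x = (fun x => layer ur t x * f (1 - x)) (1 - x) by rewrite /= subKr.
have i3 : mu.-integrable I01 (EFin \o (fun x => layer ur t (1 - x) * f x)).
  apply: integrable_L2_continuous => //; apply: L2r_reflect01; exact: layer_L2r rL _ tT.
rewrite -[X in _ = X - _](Rintegral_reflect_itv m1) -RintegralB//.
  by apply: eq_Rintegral => x _; rewrite /state mulrBl/= subKr.
by move: i3; apply: eq_integrable => // x _; rewrite /= subKr.
Qed.

Lemma state_continuous t : t \in `[0, T] ->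
  \int[mu]_(x in I01) (state ul ur s x - state ul ur t x) ^+ 2 @[s --> within `[0, T] (nbhs t)] --> (0 : R).
Proof.
move=> tT.
have h : 2 * \int[mu]_(x in I01) (layer ur s x - layer ur t x) ^+ 2 +
    2 * \int[mu]_(x in I01) (layer ul s x - layer ul t x) ^+ 2 @[s --> within `[0, T] (nbhs t)] --> (0 : R).
  have := cvgD (cvgM (cvg_cst (2 : R)) (layer_continuous rL tT)) (cvgM (cvg_cst (2 : R)) (layer_continuous lL tT)).
  by rewrite mulr0 addr0; apply.
apply: squeeze_cvgr (cvg_cst 0) h.
have sT : \forall s \near within `[0, T] (nbhs t), s \in `[0, T] by apply: withinT; exact: nbhs_filter.
apply: filterS sT => s sT; apply/andP; split; first by apply: Rintegral_ge0 => x _; exact: sqr_ge0.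
have le_ r : r \in `[0, T] -> r <= T by rewrite in_itv/= => /andP[].
have aL : L2r I01 (fun x => layer ur s x - layer ur t x).
  by apply: L2rB; [exact: layer_L2r rL _ (le_ _ sT)|exact: layer_L2r rL _ (le_ _ tT)].
have bL : L2r I01 (fun x => layer ul s x - layer ul t x).
  by apply: L2rB; [exact: layer_L2r lL _ (le_ _ sT)|exact: layer_L2r lL _ (le_ _ tT)].
have arL := L2r_reflect01 aL.
have vL := L2rB (state_L2r sT) (state_L2r tT).
have m2 : measurable_fun I01 (fun x => (layer ur s x - layer ur t x) ^+ 2).
  by case: aL => m _; apply: measurable_funX.
rewrite -(Rintegral_reflect_itv m2).
case: arL => _ ia; case: bL => _ ib; case: vL => _ iv.
have i1 : mu.-integrable I01 (EFin \o (fun x => 2 * (layer ur s (1 - x) - layer ur t (1 - x)) ^+ 2)).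
  by have : mu.-integrable I01 (fun x => 2%:E * ((layer ur s (1 - x) - layer ur t (1 - x)) ^+ 2)%:E)%E by exact: integrableZl.
have i2 : mu.-integrable I01 (EFin \o (fun x => 2 * (layer ul s x - layer ul t x) ^+ 2)).
  by have : mu.-integrable I01 (fun x => 2%:E * ((layer ul s x - layer ul t x) ^+ 2)%:E)%E by exact: integrableZl.
rewrite -RintegralZl// -RintegralZl// -RintegralD//.
apply: le_Rintegral => //.
  by have : mu.-integrable I01 (fun x => (2 * (layer ur s (1 - x) - layer ur t (1 - x)) ^+ 2)%:E
    + (2 * (layer ul s x - layer ul t x) ^+ 2)%:E)%E by exact: integrableD.
move=> x _; rewrite /state.
move: (layer ur s _) (layer ur t _) (layer ul s x) (layer ul t x) => p q y z.
have := sqr_ge0 ((p - q) + (y - z)); rewrite -subr_ge0 => h0.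
rewrite -subr_ge0 [X in 0 <= X](_ : _ = (p - q + (y - z)) ^+ 2 - 0)//; ring.
Qed.

Lemma state_solution : real_solution T ul ur (state ul ur).
Proof.
split; [exact: state_L2r|exact: state_continuous|].
move=> f f1 f2 df df1 cf2 f10 f11 t tT.
have t0T : 0 <= t <= T by move: tT; rewrite in_itv.
have cf : continuous f.
  by move=> y; apply: differentiable_continuous; apply/derivable1_diffP; case: (df y).
have rder (g g1 : R -> R) : (forall x : R, is_derive x 1 g (g1 x)) ->
    forall x : R, is_derive x 1 (fun x => g (1 - x)) (- g1 (1 - x)).
  move=> dg x; have d1 : is_derive x 1 (fun x : R => 1 - x) (- 1 : R).
    by apply: is_derive_eq; rewrite add0r mul1r.
  by have := @is_derive1_comp R g (fun x : R => 1 - x) x _ _ (dg (1 - x)) d1; rewrite mulrN1.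
have dr := rder _ _ df.
have dr1 (x : R) : is_derive x 1 (fun x => - f1 (1 - x)) (f2 (1 - x)).
  have := is_derive_mulc (- 1) (rder _ _ df1 x); rewrite mulN1r opprK.
  by rewrite (_ : (fun x => _ * _) = (fun x => - f1 (1 - x)))//; apply/funext => y; rewrite mulN1r.
have cr2 : continuous (fun x : R => f2 (1 - x)).
  move=> x; apply: (continuous_comp (f := fun x : R => 1 - x) (g := f2)); last exact: cf2.
  by apply: cvgB; [exact: cvg_cst|exact: cvg_id].
have r0 : - f1 (1 - 0) = 0 by rewrite subr0 f11 oppr0.
have r1 : - f1 (1 - 1) = 0 by rewrite subrr f10 oppr0.
rewrite (integral_state cf tT) (layer_weak_identity rL dr dr1 cr2 r0 r1 t0T) (layer_weak_identity lL df df1 cf2 f10 f11 t0T).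
have WL u : L2r `]0, T[ u -> forall s, s \in `[0, T] -> L2r I01 (layer u s).
  by move=> uL s; rewrite in_itv/= => /andP[_ sT]; exact: layer_L2r uL _ sT.
have i1 := coef_integrable (WL _ rL) (fun t => @layer_continuous _ _ _ rL t) cr2 tT.
have i2 := coef_integrable (WL _ lL) (fun t => @layer_continuous _ _ _ lL t) cf2 tT.
have -> : \int[mu]_(s in `]0, t[) (\int[mu]_(x in `]0, 1[) (state ul ur s x * f2 x)) =
    \int[mu]_(s in `]0, t[) (\int[mu]_(x in `]0, 1[) (layer ur s x * f2 (1 - x)))
    - \int[mu]_(s in `]0, t[) (\int[mu]_(x in `]0, 1[) (layer ul s x * f2 x)).
  rewrite -RintegralB//; apply: eq_Rintegral => s; rewrite inE/= in_itv/= => /andP[s0 st].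
  apply: integral_state => //; rewrite in_itv/= (ltW s0)/=.
  by case/andP: t0T => _; apply: le_trans; exact: ltW.
rewrite subr0; move: (\int[mu]_(s in _) _) (\int[mu]_(s in _) _) (\int[mu]_(s in _) ur s).
by move=> a b c; move: (\int[mu]_(s in _) ul s) => d; ring.
Qed.

Lemma state_moment n : 0 <= T ->
  \int[mu]_(x in I01) (state ul ur T x * cosn n x) = (-1) ^+ n * moment T ur n - moment T ul n.
Proof.
move=> T0; have TT : T \in `[0, T] by rewrite in_itv/= T0 lexx.
rewrite (integral_state (@continuous_cosn R n) TT) (layer_moment_cosn lL).
congr (_ - _); under eq_Rintegral do rewrite cosn_reflect mulrCA.
rewrite RintegralZl//; first by rewrite (layer_moment_cosn rL).
exact: (layer_moment rL (lexx T) (@continuous_cosn R n)).1.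
Qed.

End fixed.

(** Two square integrable functions agree as soon as their cosine moments do;
    any constant can moreover be added to the moment of order 0. *)
Lemma steering (T S c : R) (ul ur : R -> R) : 0 < T -> 0 < S ->
  L2r `]0, S[ ul -> L2r `]0, S[ ur ->
  exists ul' ur', [/\ L2r `]0, T[ ul', L2r `]0, T[ ur' &
    {ae mu, forall x, x \in `]0, 1[ -> state ul' ur' T x = state ul ur S x + c}].
Proof.
move=> T0 S0 lL rL.
have [wr [wrL wrM]] := moment_transfer T0 rL.
have [wl [wlL wlM]] := moment_transfer T0 lL.
have [w [wL wM]] : exists u, L2r `]0, T[ u /\
    forall n, moment T u n = expR (- (lam n * T)) * (- c * (n == 0%N)%:R).
  apply: (control_moments (B := `|c|) T0) => n.
  by case: (n == 0%N); rewrite ?mulr1 ?normrN// mulr0 normr0.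
have mT : measurable (`]0, T[%classic : set R) by exact: measurable_itv.
have lL' := L2rD mT wlL wL.
exists (wl \+ w), wr; split => //.
have TT : T \in `[0, T] by rewrite in_itv/= (ltW T0) lexx.
have SS : S \in `[0, S] by rewrite in_itv/= (ltW S0) lexx.
have V1 := state_L2r lL' wrL TT; have V2 := state_L2r lL rL SS.
have cL : L2r I01 (fun=> c) by apply: L2r_continuous01 => x; exact: cvg_cst.
have V3 : L2r I01 (fun x => state ul ur S x + c) by exact: L2rD.
have dL := L2rB V1 V3.
have := cosine_complete (L2r_integrable mI fI dL).
case=> [n|A [mA A0 AS]]; last first.
  exists A; split=> // x nx; apply: AS => h; apply: nx => x01.
  by have /eqP := h x01; rewrite subr_eq0 => /eqP.
have cc := @continuous_cosn R n.
have i1 := integrable_L2_continuous V1 cc; have i2 := integrable_L2_continuous V2 cc.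
have i3 := integrable_L2_continuous cL cc; have i4 := integrable_L2_continuous V3 cc.
rewrite (_ : (fun x => _) = (fun x => state (wl \+ w) wr T x * cosn n x - (state ul ur S x + c) * cosn n x)); last first.
  by apply/funext => x; rewrite mulrBl.
rewrite RintegralB// (state_moment lL' wrL _ (ltW T0)).
rewrite (_ : (fun x => (state ul ur S x + c) * _) = (fun x => state ul ur S x * cosn n x + c * cosn n x)); last first.
  by apply/funext => x; rewrite mulrDl.
rewrite RintegralD// (state_moment lL rL _ (ltW S0)) wrM.
have ic : mu.-integrable I01 (EFin \o cosn n).
  by apply: L2r_integrable => //; exact: L2r_continuous01.
rewrite RintegralZl// integral_cosn.
have -> : moment T (wl \+ w) n = moment S ul n - c * (n == 0%N)%:R.
  rewrite -wlM /moment.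
  have mi u : L2r `]0, T[ u -> mu.-integrable `]0, T[ (EFin \o (fun s => expR (- (lam n * (T - s))) * u s)).
    move=> uL; have iu : mu.-integrable `]0, T[ (EFin \o u) by apply: L2r_integrable => //; exact: fin_itv.
    apply: (le_Rintegrable (m := mu) (g := fun s => `|u s|)) => //.
    - apply: measurable_funM; last by case: uL.
      by apply: measurable_expRNM_comp; exact: measurable_funB.
    - move=> s; rewrite /= in_itv/= => /andP[s0 sT]; rewrite normrM ler_piMl//.
      by rewrite ger0_norm ?expR_ge0// -expR0 ler_expR oppr_le0 mulr_ge0 ?lam_ge0// subr_ge0 ltW.
    - by have : mu.-integrable `]0, T[ (fun s => `|(u s)%:E|)%E by exact: integrable_norm.
  rewrite (_ : (fun s => _) = (fun s => expR (- (lam n * (T - s))) * wl s + expR (- (lam n * (T - s))) * w s)); last first.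
    by apply/funext => s; rewrite mulrDr.
  rewrite RintegralD//; [|exact: mi..].
  congr (_ + _); have := wM n; rewrite /moment => ->.
  case: n {i1 i2 i3 i4 cc ic mi} => [|n]; last by rewrite !mulr0 oppr0.
  by rewrite /lam !mul0r expr0n/= mul0r oppr0 expR0 mul1r mulNr.
move: (moment S ur n) (moment S ul n) => a b.
by ring.
Qed.

End potential_solution.

(** * Complex controls and the reachable space *)

Local Open Scope complex_scope.

Section parts.
Context {R : realType}.
Local Notation mu := (@lebesgue_measure R).

(** Real and imaginary parts at once: b selects the imaginary part. *)
Definition part (b : bool) (z : R[i]) : R := if b then complex.Im z else complex.Re z.

Lemma partB b z w : part b (z - w) = part b z - part b w.
Proof. by case: b z w => [] [a c] [a' c']. Qed.

Lemma partD b z w : part b (z + w) = part b z + part b w.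
Proof. by case: b z w => [] [a c] [a' c']. Qed.

Lemma partZ b z (r : R) : part b (z * r%:C) = part b z * r.
Proof. by case: b z => [] [a c] /=; rewrite mulr0 ?subr0 ?add0r. Qed.

Lemma part_sq b z : part b z ^+ 2 <= sqnorm z.
Proof. by case: b; rewrite /sqnorm/= ?lerDl ?lerDr sqr_ge0. Qed.

Lemma part_cintegral b A u : part b (cintegral A u) = \int[mu]_(x in A) part b (u x).
Proof. by case: b. Qed.

Lemma partP z w : (forall b, part b z = part b w) -> z = w.
Proof. by case: z w => [a c] [a' c'] h; rewrite (h true : c = c') (h false : a = a'). Qed.

Lemma L2_part (D : set R) (u : R -> R[i]) : measurable D ->
  L2 D u <-> forall b, L2r D (fun x => part b (u x)).
Proof.
move=> mD; split=> [[mr mi fu] b|h].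
  have mp : measurable_fun D (fun x => part b (u x)) by case: b.
  split=> //; apply/integrableP; split.
    by apply/measurable_EFinP; exact: measurable_funX.
  apply: le_lt_trans fu; apply: ge0_le_integral => //.
  - by apply/measurable_EFinP; apply: measurableT_comp => //; exact: measurable_funX.
  - apply/measurable_EFinP; apply: measurable_funD; exact: measurable_funX.
  - by move=> x _; rewrite /= lee_fin ger0_norm ?sqr_ge0// part_sq.
have [mr ir] := h false; have [mi ii] := h true.
split=> //.
have iD : mu.-integrable D (EFin \o (fun x => sqnorm (u x))).
  by have : mu.-integrable D (fun x => ((complex.Re (u x)) ^+ 2)%:E + ((complex.Im (u x)) ^+ 2)%:E)%E by exact: integrableD.
case/integrableP : iD => _; apply: le_lt_trans.
apply: ge0_le_integral => //.
- by move=> x _; rewrite lee_fin addr_ge0 ?sqr_ge0.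
- by apply/measurable_EFinP; apply: measurable_funD; exact: measurable_funX.
- by apply/measurable_EFinP; apply: measurableT_comp => //; apply: measurable_funD; exact: measurable_funX.
- by move=> x _; rewrite /= lee_fin ler_norm.
Qed.

Lemma integrable_sqnorm (D : set R) (u : R -> R[i]) : measurable D ->
  (forall b, L2r D (fun x => part b (u x))) ->
  mu.-integrable D (EFin \o (fun x => sqnorm (u x))).
Proof.
move=> mD h; have [mr ir] := h false; have [mi ii] := h true.
by have : mu.-integrable D (fun x => ((complex.Re (u x)) ^+ 2)%:E + ((complex.Im (u x)) ^+ 2)%:E)%E by exact: integrableD.
Qed.

Lemma neumann_test_deriv (f f1 f2 : R -> R) : (forall x : R, is_derive x 1 f (f1 x)) ->
  (forall x : R, is_derive x 1 f1 (f2 x)) -> f^`()%classic = f1 /\ f^`(2)%classic = f2.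
Proof.
move=> df df1; have e1 : f^`()%classic = f1.
  by apply/funext => x; rewrite derive1E; case: (df x).
split=> //; rewrite derive1nS/= e1.
by apply/funext => x; rewrite derive1E; case: (df1 x).
Qed.

Let I01 : set R := `]0, 1[%classic.
Let mI : measurable I01. Proof. exact: measurable_itv. Qed.

Section solutions.
Variables (T : R) (ul ur : R -> R[i]).
Hypotheses (lL : L2 `]0, T[ ul) (rL : L2 `]0, T[ ur).

Let boundary b (p1 p0 t : R) : t \in `[0, T] ->
  \int[mu]_(s in `]0, t[) part b (ur s * p1%:C - ul s * p0%:C) =
  p1 * \int[mu]_(s in `]0, t[) part b (ur s) - p0 * \int[mu]_(s in `]0, t[) part b (ul s).
Proof.
rewrite in_itv/= => /andP[t0 tT].
have sub : `]0, t[ `<=` `]0, T[.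
  by move=> s /=; rewrite !in_itv/= => /andP[-> /lt_le_trans ->].
have ii u : L2 `]0, T[ u -> mu.-integrable `]0, t[ (EFin \o (fun s => part b (u s))).
  move=> /(L2_part _ (measurable_itv _)) /(_ b) uL; apply: L2r_integrable => //; first exact: fin_itv.
  by apply: L2rS uL.
have iz u p : L2 `]0, T[ u -> mu.-integrable `]0, t[ (EFin \o (fun s => p * part b (u s))).
  by move=> /ii iu; have : mu.-integrable `]0, t[ (fun s => p%:E * (part b (u s))%:E)%E by exact: integrableZl.
rewrite -!RintegralZl//; [|exact: ii..].
rewrite -RintegralB//; [|exact: iz..].
by apply: eq_Rintegral => s _; rewrite partB !partZ ![_ * part b _]mulrC.
Qed.

Lemma neumann_solution_part b v : neumann_solution T ul ur v ->
  real_solution T (fun s => part b (ul s)) (fun s => part b (ur s)) (fun t x => part b (v t x)).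
Proof.
move=> [[vL vc] v0 vw].
have vL' t : t \in `[0, T] -> forall b, L2r I01 (fun x => part b (v t x)).
  by move=> tT; apply/L2_part => //; exact: vL.
have dL s t : s \in `[0, T] -> t \in `[0, T] -> forall b, L2r I01 (fun x => part b (v s x - v t x)).
  move=> sT tT b'; rewrite (_ : (fun x => _) = (fun x => part b' (v s x) - part b' (v t x))).
    by apply: L2rB; exact: vL'.
  by apply/funext => x; rewrite partB.
split=> [t tT|t tT|f f1 f2 df df1 cf2 f10 f11 t tT]; first exact: vL'.
  apply: squeeze_cvgr (cvg_cst 0) (vc t tT).
  have sT : \forall s \near within `[0, T] (nbhs t), s \in `[0, T] by apply: withinT; exact: nbhs_filter.
  apply: filterS sT => s sT; apply/andP; split; first by apply: Rintegral_ge0 => x _; exact: sqr_ge0.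
  have [_ i1] := dL s t sT tT b; have i2 := integrable_sqnorm mI (dL s t sT tT).
  under eq_Rintegral do rewrite -partB.
  by apply: le_Rintegral => // x _; exact: part_sq.
have [e1 e2] := neumann_test_deriv df df1.
have ft : neumann_test f.
  by split; rewrite ?e1 ?e2.
have := congr1 (part b) (vw f ft t tT).
rewrite !partD !part_cintegral e2 (boundary b (f 1) (f 0) tT) => h.
have e3 : \int[mu]_(x in `]0, 1[) part b (v t x * (f x)%:C) =
    \int[mu]_(x in `]0, 1[) (part b (v t x) * f x).
  by apply: eq_Rintegral => x _; rewrite partZ.
rewrite -e3 h; congr (_ + _); apply: eq_Rintegral => s _; rewrite part_cintegral.
by apply: eq_Rintegral => x _; rewrite partZ.
Qed.

Lemma part_neumann_solution v : (forall x, v 0 x = 0) ->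
  (forall b, real_solution T (fun s => part b (ul s)) (fun s => part b (ur s))
     (fun t x => part b (v t x))) ->
  neumann_solution T ul ur v.
Proof.
move=> v0 h.
have vL' t : t \in `[0, T] -> forall b, L2r I01 (fun x => part b (v t x)).
  by move=> tT b; case: (h b) => + _ _; apply.
have dL s t : s \in `[0, T] -> t \in `[0, T] -> forall b, L2r I01 (fun x => part b (v s x - v t x)).
  move=> sT tT b'; rewrite (_ : (fun x => _) = (fun x => part b' (v s x) - part b' (v t x))).
    by apply: L2rB; exact: vL'.
  by apply/funext => x; rewrite partB.
split.
- split=> [t tT|t tT]; first by apply/L2_part => //; exact: vL'.
  have [_ cr _] := h false; have [_ ci _] := h true.
  have hc : \int[mu]_(x in `]0, 1[) (part false (v s x) - part false (v t x)) ^+ 2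
      + \int[mu]_(x in `]0, 1[) (part true (v s x) - part true (v t x)) ^+ 2
      @[s --> within `[0, T] (nbhs t)] --> (0 : R).
    by have := cvgD (cr t tT) (ci t tT); rewrite addr0; apply.
  apply: cvg_trans hc.
  have sT : \forall s \near within `[0, T] (nbhs t), s \in `[0, T] by apply: withinT; exact: nbhs_filter.
  apply: near_eq_cvg; apply: filterS sT => s sT.
  have [_ i1] := dL s t sT tT false; have [_ i2] := dL s t sT tT true.
  rewrite /sqnorm RintegralD//; congr (_ + _); apply: eq_Rintegral => x _.
    by rewrite -(partB false).
  by rewrite -(partB true).
- by apply: aeW => x _; exact: v0.
move=> phi [d1 d2 c2 p0 p1] t tT.
apply: partP => b; rewrite !partD !part_cintegral (boundary b _ _ tT).
have df (x : R) : is_derive x 1 phi (phi^`()%classic x).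
  by apply: DeriveDef; [exact: d1|rewrite derive1E].
have df1 (x : R) : is_derive x 1 phi^`()%classic (phi^`(2)%classic x).
  by apply: DeriveDef; [exact: d2|rewrite derive1nS derive1E].
have [_ _ w] := h b.
rewrite -[LHS](_ : \int[mu]_(x in `]0, 1[) (part b (v t x) * phi x) = _); last first.
  by apply: eq_Rintegral => x _; rewrite partZ.
rewrite (w _ _ _ df df1 c2 p0 p1 t tT); congr (_ + _).
apply: eq_Rintegral => s _; rewrite part_cintegral.
by apply: eq_Rintegral => x _; rewrite partZ.
Qed.

End solutions.

Lemma layer0 (u : R -> R) x : layer u 0 x = 0.
Proof. by rewrite /layer set_itvoo0 Rintegral_set0. Qed.

(** The final state of the Neumann problem with controls al + i bl and
    ar + i br. *)
Definition complex_state (al bl ar br : R -> R) t (x : R) : R[i] := state al ar t x +i* state bl br t x.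

(** Existence is the layer potential; conversely, by uniqueness, every solution is
    that potential almost everywhere at the final time. *)
Lemma reachNE (T : R) (g : R -> R[i]) : 0 < T ->
  reachN T g <-> exists al bl ar br, [/\ L2r `]0, T[ al, L2r `]0, T[ bl,
    L2r `]0, T[ ar, L2r `]0, T[ br & ae_eq_on `]0, 1[ g (complex_state al bl ar br T)].
Proof.
move=> T0; have mT : measurable (`]0, T[%classic : set R) by exact: measurable_itv.
split=> [[ul [ur [lL rL [v vs gv]]]]|[al [bl [ar [br [alL blL arL brL gE]]]]]].
  have /(L2_part _ mT) lL' := lL; have /(L2_part _ mT) rL' := rL.
  exists (fun s => part false (ul s)), (fun s => part true (ul s)),
    (fun s => part false (ur s)), (fun s => part true (ur s)).
  split; [exact: lL' false|exact: lL' true|exact: rL' false|exact: rL' true|].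
  have u b := real_solution_unique (ltW T0) (neumann_solution_part lL rL b vs)
    (state_solution (lL' b) (rL' b)).
  have u0 := u false; have u1 := u true.
  apply: (@filterS3 _ _ (ae_filter_ringOfSetsType mu) _ _ _ _ _ gv u0 u1) => x e e0 e1 x01.
  by rewrite e//; apply: partP => -[]; [exact: e1|exact: e0].
pose ul s := al s +i* bl s; pose ur s := ar s +i* br s.
have lL : L2 `]0, T[ ul by apply/L2_part => // -[].
have rL : L2 `]0, T[ ur by apply/L2_part => // -[].
exists ul, ur; split=> //; exists (complex_state al bl ar br) => //.
apply: part_neumann_solution => //.
  by move=> x; rewrite /complex_state /state !layer0 subrr.
by case; exact: state_solution.
Qed.

(** A constant is an equilibrium of the Neumann problem, so that it can be added to
    the moment of order 0 of the controls. *)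
Lemma reachN_shift (T S c d : R) (g : R -> R[i]) al bl ar br : 0 < T -> 0 < S ->
  L2r `]0, S[ al -> L2r `]0, S[ bl -> L2r `]0, S[ ar -> L2r `]0, S[ br ->
  ae_eq_on `]0, 1[ g (fun x => complex_state al bl ar br S x + (c +i* d)) -> reachN T g.
Proof.
move=> T0 S0 alL blL arL brL gE.
have [al' [ar' [alL' arL' e0]]] := steering c T0 S0 alL arL.
have [bl' [br' [blL' brL' e1]]] := steering d T0 S0 blL brL.
apply/reachNE => //; exists al', bl', ar', br'; split=> //.
apply: (@filterS3 _ _ (ae_filter_ringOfSetsType mu) _ _ _ _ _ gE e0 e1) => x e f0 f1 x01.
by rewrite e// /complex_state f0// f1.
Qed.

Lemma reachN_time (T S : R) : 0 < T -> 0 < S -> reachN S `<=` @reachN R T.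
Proof.
move=> T0 S0 g /(reachNE _ S0)[al [bl [ar [br [alL blL arL brL gE]]]]].
apply: (reachN_shift (c := 0) (d := 0) T0 S0 alL blL arL brL).
apply: (@filterS _ _ (ae_filter_ringOfSetsType mu) _ _ _ gE) => x e x01.
by rewrite e// addr0.
Qed.

End parts.

(** * The complex heat kernel *)

Section complex_size.
Context {R : realType}.
Implicit Types (z w a h : R[i]).

(** The l^1 norm: real valued, submultiplicative, and compared with the modulus
    only where complex derivatives are taken. *)
Definition csize z : R := `|complex.Re z| + `|complex.Im z|.

Lemma csize_ge0 z : 0 <= csize z. Proof. exact: addr_ge0. Qed.

Lemma csizeD z w : csize (z + w) <= csize z + csize w.
Proof.
case: z w => [a b] [c d]; rewrite /csize/=.
by have := ler_normD a c; have := ler_normD b d; lra.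
Qed.

Lemma csizeN z : csize (- z) = csize z.
Proof. by case: z => [a b]; rewrite /csize/= !normrN. Qed.

Lemma csizeB z w : csize (z - w) <= csize z + csize w.
Proof. by apply: le_trans (csizeD _ _) _; rewrite csizeN. Qed.

Lemma csizeM z w : csize (z * w) <= csize z * csize w.
Proof.
case: z w => [a b] [c d]; rewrite /csize/=.
have h1 := ler_normB (a * c) (b * d); have h2 := ler_normD (a * d) (b * c).
apply: le_trans (lerD h1 h2) _; rewrite !normrM.
by move: `|a| `|b| `|c| `|d| => p q r s; rewrite le_eqVlt; apply/orP; left; apply/eqP; ring.
Qed.

Lemma csizeZ (r : R) z : csize (r%:C * z) = `|r| * csize z.
Proof. by case: z => [a b]; rewrite /csize/= !mul0r subr0 addr0 !normrM mulrDr. Qed.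

Lemma part_csize b z : `|part b z| <= csize z.
Proof. by case: b; rewrite /part /csize ?lerDl ?lerDr. Qed.

Lemma csize_cexp z : csize (cexp z) <= 2 * expR (complex.Re z).
Proof.
case: z => [a b]; rewrite /csize /cexp/= !normrM (ger0_norm (expR_ge0 a)) -mulrDr mulrC.
apply: ler_wpM2r; first exact: expR_ge0.
have h1 : `|cos b| <= 1 by rewrite ler_norml cos_geN1 cos_le1.
have h2 : `|sin b| <= 1 by rewrite ler_norml sin_geN1 sin_le1.
lra.
Qed.

Lemma cexpD z w : cexp (z + w) = cexp z * cexp w.
Proof.
case: z w => [a b] [c d]; rewrite /cexp/= expRD cosD sinD.
by apply/eqP; rewrite eq_complex/=; apply/andP; split; apply/eqP; ring.
Qed.

(** Along the segment from 0 to w, the real and imaginary parts of exp satisfy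
    a linear system; the mean value theorem is applied twice. *)
Lemma cexp_taylor w : csize (cexp w - 1 - w) <= 2 * csize w ^+ 2 * expR (csize w).
Proof.
case: w => [x y]; set N := csize (x +i* y).
have N0 : 0 <= N by exact: csize_ge0.
have xN : `|x| <= N by exact: (part_csize false (x +i* y)).
pose c (t : R) := expR (x * t) * cos (y * t).
pose s (t : R) := expR (x * t) * sin (y * t).
have dc (t : R) : is_derive t 1 c (x * c t - y * s t).
  apply: (is_derive_eq (is_derive_mul (is_derive_expRM x t) (is_derive_cosM y t))).
  by rewrite /c /s; ring.
have ds (t : R) : is_derive t 1 s (y * c t + x * s t).
  apply: (is_derive_eq (is_derive_mul (is_derive_expRM x t) (is_derive_sinM y t))).
  by rewrite /c /s; ring.
pose phi (p q t : R) := p * c t + q * s t.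
have dphi (p q t : R) : is_derive t 1 (phi p q) (phi (p * x + q * y) (q * x - p * y) t).
  have h1 := is_derive_mulc p (dc t); have h2 := is_derive_mulc q (ds t).
  apply: (is_derive_eq (is_deriveD h1 h2)).
  by rewrite /phi; ring.
have le1 (p q : R) : `|p * x + q * y| + `|q * x - p * y| <= (`|p| + `|q|) * N.
  have h1 := ler_normD (p * x) (q * y); have h2 := ler_normB (q * x) (p * y).
  apply: le_trans (lerD h1 h2) _; rewrite !normrM /N /csize/=.
  by move: `|p| `|q| `|x| `|y| => p' q' x' y'; rewrite le_eqVlt; apply/orP; left; apply/eqP; ring.
have phi_le (p q t : R) : 0 <= t <= 1 -> `|phi p q t| <= (`|p| + `|q|) * expR N.
  move=> /andP[t0 t1].
  have et : expR (x * t) <= expR N.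
    rewrite ler_expR; apply: le_trans (ler_norm _) _; rewrite normrM (ger0_norm t0).
    by apply: le_trans xN; rewrite ler_piMr.
  have h3 := expR_ge0 (x * t).
  have h1 : `|c t| <= expR N.
    rewrite /c normrM (ger0_norm h3); apply: le_trans et; rewrite ler_piMr//.
    by rewrite ler_norml cos_geN1 cos_le1.
  have h2 : `|s t| <= expR N.
    rewrite /s normrM (ger0_norm h3); apply: le_trans et; rewrite ler_piMr//.
    by rewrite ler_norml sin_geN1 sin_le1.
  apply: le_trans (ler_normD _ _) _; rewrite (normrM p) (normrM q) mulrDl.
  by apply: lerD; apply: ler_wpM2l.
have T (p q : R) : `|p| + `|q| = 1 ->
    `|phi p q 1 - phi p q 0 - phi (p * x + q * y) (q * x - p * y) 0| <= N ^+ 2 * expR N.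
  move=> pq; have [u /andP[u0 u1] e1] := mvt01 (dphi p q) ler01.
  have [v /andP[v0 v1] e2] := mvt01 (dphi (p * x + q * y) (q * x - p * y)) u0.
  rewrite e1 mulr1 e2 normrM (ger0_norm u0).
  have v01 : 0 <= v <= 1 by rewrite v0 (le_trans v1).
  have h := phi_le ((p * x + q * y) * x + (q * x - p * y) * y)
    ((q * x - p * y) * x - (p * x + q * y) * y) v v01.
  apply: le_trans (_ : _ <= `|phi ((p * x + q * y) * x + (q * x - p * y) * y)
    ((q * x - p * y) * x - (p * x + q * y) * y) v|) _; first by rewrite ler_piMr.
  apply: le_trans h _; apply: ler_wpM2r; first exact: expR_ge0.
  apply: le_trans (le1 _ _) _; rewrite expr2; apply: ler_wpM2r => //.
  by apply: le_trans (le1 _ _) _; rewrite pq mul1r.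
have T1 := T 1 0; have T2 := T 0 1.
rewrite normr1 normr0 addr0 in T1; rewrite normr0 normr1 add0r in T2.
have {T1} := T1 erefl; have {T2} := T2 erefl.
rewrite /phi /c /s !mulr0 !mulr1 expR0 cos0 sin0 !mul0r !mul1r !mulr0 ?mulr1 ?addr0 ?add0r ?subr0 ?sub0r.
move=> h2 h1; rewrite /csize/= /cexp/= -mulrA mulr_natl mulr2n; apply: lerD => //.
by move: h2; rewrite oppr0 addr0.
Qed.

End complex_size.

Section complex_kernel.
Context {R : realType}.
Implicit Types (z w a h : R[i]).

(** The complex heat kernel. *)
Definition cK a (s : R) : R[i] :=
  ((2 * Num.sqrt pi * Num.sqrt s)^-1)%:C * cexp (- (a ^+ 2 / (4 * s)%:C)).

(** The power 3/2 in the definition of [dK] is s * sqrt s. *)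
Lemma dKE a (s : R) : 0 < s -> dK a s = - (a / (2 * s)%:C) * cK a s.
Proof.
move=> s0; rewrite /dK /cK.
have -> : s `^ (3 / 2) = s * Num.sqrt s.
  rewrite (_ : 3 / 2 = 1 + 2^-1 :> R); last by field.
  by rewrite powRD ?powRr1 ?powR12_sqrt ?ltW// (gt_eqF s0) implybT.
have p0 : 0 < Num.sqrt pi :> R by rewrite sqrtr_gt0 pi_gt0.
have q0 : 0 < Num.sqrt s by rewrite sqrtr_gt0.
rewrite !mulNr !mulrA; congr (- (_ * _)); rewrite -!mulrA; congr (_ * _).
rewrite -!fmorphV -rmorphM; congr (_%:C).
by field; rewrite !gt_eqF.
Qed.

(** The exponent at a + h is the exponent at a plus w, and w is - h a / (2 s) up to
    a term of second order in h. *)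
Lemma cK_taylor a h (s : R) : 0 < s ->
  let w := - ((2 * a * h + h ^+ 2) / (4 * s)%:C) in
  cK (a + h) s - cK a s - h * dK a s = cK a s * ((cexp w - 1 - w) - h ^+ 2 / (4 * s)%:C).
Proof.
move=> s0 w; rewrite dKE//.
have e1 : cK (a + h) s = cK a s * cexp w.
  rewrite /cK -[RHS]mulrA -cexpD; congr (_ * cexp _); rewrite /w.
  by move: ((4 * s)%:C^-1) => k; ring.
have e2 : ((2 * s)%:C)^-1 = 2 * ((4 * s)%:C)^-1 :> R[i].
  rewrite -!fmorphV (_ : (2 * s)^-1 = 2 * (4 * s)^-1); last by field; rewrite gt_eqF.
  by rewrite rmorphM/= rmorph_nat.
by rewrite e1 e2 /w; move: ((4 * s)%:C^-1) (cK a s) (cexp _) => k K e; ring.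
Qed.

End complex_kernel.

(** * Estimates in sectors *)

Section sector.
Context {R : realType}.
Implicit Types (z w a h : R[i]).

(** In the sector |Im a| + 4 d <= |Re a| the kernel decays like
    exp (- d |Re a| / s), which absorbs any power of 1 / s. *)
Lemma sector_decay (S d rho s : R) : 0 < d -> 4 * d <= rho -> 0 < s <= S ->
  (Num.sqrt s)^-1 * expR (- (d * rho / (2 * s))) * (rho / s) ^+ 2
  <= (8 / d) ^+ 4 * (S * Num.sqrt S) / rho ^+ 2.
Proof.
move=> d0 rd /andP[s0 sS].
have r0 : 0 < rho by apply: lt_le_trans rd; rewrite mulr_gt0.
have q0 : 0 < Num.sqrt s by rewrite sqrtr_gt0.
have qq : Num.sqrt s ^+ 2 = s by rewrite sqr_sqrtr// ltW.
set y := d * rho / (2 * s).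
have y0 : 0 < y by rewrite divr_gt0 ?mulr_gt0.
(* The fourth power leaves (s / rho) ^ 2 after multiplication by (rho / s) ^ 2. *)
have e4 : expR (- y) <= (4 / y) ^+ 4.
  have p4 : 0 < (4 / y) ^+ 4 by apply: exprn_gt0; exact: divr_gt0.
  rewrite expRN -[leRHS]invrK lef_pV2; [|rewrite posrE; exact: expR_gt0|by rewrite posrE invr_gt0].
  have := @expR_geXn R y 4 (ltW y0) isT; apply: le_trans.
  by rewrite -exprVn invf_div lerDr.
have -> : (8 / d) ^+ 4 * (S * Num.sqrt S) / rho ^+ 2 = (8 / d) ^+ 4 * (S * Num.sqrt S / rho ^+ 2).
  by rewrite -[LHS]mulrA.
have e5 : (Num.sqrt s)^-1 * (4 / y) ^+ 4 * (rho / s) ^+ 2 = (8 / d) ^+ 4 * (s * Num.sqrt s / rho ^+ 2).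
  rewrite (_ : 4 / y = 8 / d * (s / rho)); last first.
    by rewrite /y; field; rewrite !gt_eqF.
  rewrite exprMn; move: ((8 / d) ^+ 4) => D.
  move: (Num.sqrt s) q0 qq => q q0 <-.
  by field; rewrite !gt_eqF.
apply: (@le_trans _ _ ((Num.sqrt s)^-1 * (4 / y) ^+ 4 * (rho / s) ^+ 2)).
  apply: ler_wpM2r; first exact: sqr_ge0.
  by apply: ler_wpM2l => //; rewrite invr_ge0 ltW.
rewrite e5; apply: ler_wpM2l; first by rewrite exprn_ge0 // divr_ge0 // ltW.
apply: ler_wpM2r; first by rewrite invr_ge0 sqr_ge0.
by apply: ler_pM => //; rewrite ?sqrtr_ge0 ?(ltW s0) ?ler_wsqrtr.
Qed.

(** With E the exponential of [sector_decay], the kernel is bounded by E ^ 2 while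
    the increment w costs at most 1 / E: one factor E is left to absorb the
    powers of 1 / s in the Taylor remainder. *)
Lemma sector_bounds (S d : R) : 0 < S -> 0 < d -> exists2 M, 0 <= M &
  forall a (s : R), 0 < s <= S -> `|complex.Im a| + 4 * d <= `|complex.Re a| ->
  [/\ csize (cK a s) <= M / complex.Re a ^+ 2, csize (dK a s) <= M / complex.Re a ^+ 2 &
    forall h, csize h <= d / 4 ->
    csize (cK (a + h) s - cK a s - h * dK a s) <= csize h ^+ 2 * (M / complex.Re a ^+ 2)].
Proof.
move=> S0 d0.
pose C0 := (8 / d) ^+ 4 * (S * Num.sqrt S); pose k := S / (4 * d).
have C00 : 0 <= C0.
  apply: mulr_ge0; last by rewrite mulr_ge0 ?sqrtr_ge0// ltW.
  by apply: exprn_ge0; rewrite divr_ge0// ltW.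
have k0 : 0 < k by rewrite divr_gt0 ?mulr_gt0.
pose M1 := 16 * C0 + 2 * (k * C0 / (16 * d)).
have M10 : 0 <= M1.
  apply: addr_ge0; first by rewrite mulr_ge0.
  apply: mulr_ge0 => //; apply: divr_ge0; first exact: mulr_ge0 (ltW k0) C00.
  by rewrite mulr_ge0// ltW.
have M20 : 0 <= 2 * (k * C0) by apply: mulr_ge0 => //; apply: mulr_ge0 => //; exact: ltW.
have M30 : 0 <= 2 * (k ^+ 2 * C0).
  by apply: mulr_ge0 => //; apply: mulr_ge0 => //; exact: sqr_ge0.
pose M := M1 + 2 * (k * C0) + 2 * (k ^+ 2 * C0).
exists M; first by apply: addr_ge0 => //; exact: addr_ge0.
move=> a s sS; have /andP[s0 sS'] := sS.
set rho := `|complex.Re a| => ha.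
have rd : 4 * d <= rho by apply: le_trans ha; rewrite lerDr.
have r0 : 0 < rho by apply: lt_le_trans rd; rewrite mulr_gt0.
have -> : complex.Re a ^+ 2 = rho ^+ 2 by rewrite real_normK// num_real.
pose E := expR (- (d * rho / (2 * s))).
have E0 : 0 < E by exact: expR_gt0.
have E1 : E <= 1.
  by rewrite -expR0 ler_expR oppr_le0 divr_ge0 ?mulr_ge0 ?(ltW d0) ?(ltW r0) ?(ltW s0).
have q0 : 0 < Num.sqrt s by rewrite sqrtr_gt0.
pose G := (Num.sqrt s)^-1 * E; pose X := rho / s.
have G0 : 0 < G by rewrite mulr_gt0 ?invr_gt0.
have X0 : 0 < X by rewrite divr_gt0.
have GX2 : G * X ^+ 2 <= C0 / rho ^+ 2 by exact: sector_decay.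
have kX : 1 <= k * X.
  rewrite /k /X mulf_div ler_pdivlMr ?mulr_gt0// mul1r.
  by rewrite [leRHS]mulrC; apply: ler_pM => //; rewrite ?mulr_ge0 ?(ltW d0) ?(ltW s0).
have GX : G * X <= k * C0 / rho ^+ 2.
  rewrite -mulrA; apply: le_trans (ler_wpM2l (ltW k0) GX2).
  rewrite (_ : k * (G * X ^+ 2) = (k * X) * (G * X)); last by ring.
  by rewrite ler_peMl// mulr_ge0// ltW.
have GG : G <= k ^+ 2 * C0 / rho ^+ 2.
  rewrite -mulrA expr2 -mulrA; rewrite -mulrA in GX; apply: le_trans (ler_wpM2l (ltW k0) GX).
  rewrite (_ : k * (G * X) = (k * X) * G); last by ring.
  by rewrite ler_peMl// ltW.
have a2 : csize a <= 2 * rho.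
  by rewrite /csize -/rho mulr_natl mulr2n lerD2l; apply: le_trans ha; rewrite lerDl mulr_ge0// ltW.
have Kle : csize (cK a s) <= 2 * (G * E).
  rewrite /cK csizeZ.
  have p1 : 1 <= Num.sqrt pi :> R.
    by rewrite -[leLHS]sqrtr1; apply: ler_wsqrtr; have := @pi_ge2 R; lra.
  have h1 : `|(2 * Num.sqrt pi * Num.sqrt s)^-1| <= (Num.sqrt s)^-1.
    have p0 : 0 < 2 * Num.sqrt pi :> R by lra.
    rewrite ger0_norm ?invr_ge0 ?mulr_ge0 ?sqrtr_ge0//.
    rewrite lef_pV2 ?posrE ?(mulr_gt0 p0)//.
    by rewrite ler_peMl ?sqrtr_ge0//; lra.
  have h2 : csize (cexp (- (a ^+ 2 / (4 * s)%:C))) <= 2 * E ^+ 2.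
    apply: le_trans (csize_cexp _) _; apply: ler_wpM2l => //.
    have -> : complex.Re (- (a ^+ 2 / (4 * s)%:C)) =
        - ((complex.Re a ^+ 2 - complex.Im a ^+ 2) / (4 * s)).
      by rewrite -fmorphV; case: (a) => [x y] /=; rewrite !mulr0 !subr0 !expr2.
    rewrite /E -expRM_natl ler_expR mulrN lerN2.
    have h : 4 * d * rho <= complex.Re a ^+ 2 - complex.Im a ^+ 2.
      rewrite -[complex.Re a ^+ 2]real_normK ?num_real// -[complex.Im a ^+ 2]real_normK ?num_real// -/rho.
      have := normr_ge0 (complex.Im a); move: ha; move: (`|complex.Im a|) => y ha y0.
      rewrite subr_sqr; apply: ler_pM; rewrite ?mulr_ge0 ?(ltW d0) ?(ltW r0)//; first lra.
      by rewrite lerDl.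
    rewrite ler_pdivlMr ?mulr_gt0//; apply: le_trans h.
    by rewrite le_eqVlt; apply/orP; left; apply/eqP; field; rewrite gt_eqF.
  apply: (@le_trans _ _ ((Num.sqrt s)^-1 * (2 * E ^+ 2))).
    by apply: ler_pM => //; exact: csize_ge0.
  by rewrite le_eqVlt; apply/orP; left; apply/eqP; rewrite /G; ring.
have GE : G * E <= G by rewrite ler_piMr// ltW.
have K1 : csize (cK a s) <= 2 * G by apply: le_trans Kle _; rewrite ler_pM2l.
have r2 : 0 < rho ^+ 2 by rewrite exprn_gt0.
have toM x y : 0 <= y -> x <= y / rho ^+ 2 -> y <= M -> x <= M / rho ^+ 2.
  by move=> y0 xy yM; apply: le_trans xy _; rewrite ler_pM2r// invr_gt0.
split.
- apply: (toM _ (2 * (k ^+ 2 * C0))) => //; last by rewrite /M lerDr addr_ge0.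
  by apply: le_trans K1 _; rewrite -mulrA ler_pM2l.
- apply: (toM _ (2 * (k * C0))) => //; last by rewrite /M -addrA addrCA lerDl addr_ge0.
  rewrite dKE// mulNr csizeN; apply: le_trans (csizeM _ _) _.
  have h1 : csize (a / (2 * s)%:C) <= X.
    rewrite mulrC -fmorphV csizeZ ger0_norm ?invr_ge0 ?mulr_ge0 ?(ltW s0)//.
    rewrite mulrC ler_pdivrMr ?mulr_gt0//; apply: le_trans a2 _.
    by rewrite le_eqVlt; apply/orP; left; apply/eqP; rewrite /X; field; rewrite gt_eqF.
  apply: (@le_trans _ _ (X * (2 * G))); first by apply: ler_pM => //; exact: csize_ge0.
  by rewrite mulrCA -[leRHS]mulrA ler_pM2l// mulrC.
move=> h hd; rewrite cK_taylor//; set w := - _; set eta := csize h.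
have eta0 : 0 <= eta by exact: csize_ge0.
have etar : eta <= rho by apply: le_trans hd _; lra.
have s4 : 0 < (4 * s)^-1 by rewrite invr_gt0 mulr_gt0.
have wle : csize w <= 5 * rho * eta / (4 * s).
  rewrite /w csizeN -fmorphV mulrC csizeZ (gtr0_norm s4) mulrC ler_pM2r//.
  apply: le_trans (csizeD _ _) _.
  have h1 : csize (2 * a * h) <= 4 * rho * eta.
    apply: le_trans (csizeM _ _) _; apply: ler_wpM2r => //.
    rewrite (_ : (2 : R[i]) = (2 : R)%:C); last by rewrite rmorph_nat.
    rewrite csizeZ ger0_norm//; lra.
  have h2 : csize (h ^+ 2) <= rho * eta.
    by rewrite expr2; apply: le_trans (csizeM _ _) _; apply: ler_wpM2r.
  lra.
have w0 := csize_ge0 w.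
have wX : csize w <= 2 * X * eta.
  apply: le_trans wle _.
  rewrite (_ : 5 * rho * eta / (4 * s) = 5 / 4 * (X * eta)); last by rewrite /X; field; rewrite gt_eqF.
  have := mulr_ge0 (ltW X0) eta0; lra.
have wE : expR (csize w) <= E^-1.
  rewrite /E -expRN opprK ler_expR; apply: le_trans wle _.
  rewrite ler_pdivrMr ?mulr_gt0// (_ : d * rho / (2 * s) * (4 * s) = rho * (2 * d)); last first.
    by field; rewrite gt_eqF.
  rewrite (_ : 5 * rho * eta = rho * (5 * eta)); last by ring.
  by rewrite ler_pM2l//; have hd' : eta <= d / 4 := hd; lra.
have P1 : csize (cexp w - 1 - w) <= 8 * (X * eta) ^+ 2 * E^-1.
  apply: le_trans (cexp_taylor w) _; apply: ler_pM; rewrite ?expR_ge0//.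
    by rewrite mulr_ge0// sqr_ge0.
  rewrite (_ : 8 * (X * eta) ^+ 2 = 2 * (2 * X * eta) ^+ 2); last by ring.
  apply: ler_wpM2l => //; apply: lerXn2r => //.
  by rewrite nnegrE; apply: mulr_ge0 => //; apply: mulr_ge0 => //; exact: ltW.
have P2 : csize (h ^+ 2 / (4 * s)%:C) <= eta ^+ 2 * (X / (16 * d)).
  rewrite -fmorphV mulrC csizeZ (gtr0_norm s4) mulrC.
  apply: ler_pM; [exact: csize_ge0|exact: ltW| |].
    by rewrite !expr2; exact: csizeM.
  rewrite /X -mulrA -invfM ler_pdivlMr ?mulr_gt0//.
  rewrite (_ : (4 * s)^-1 * (s * (16 * d)) = 4 * d)//; by field; rewrite gt_eqF.
apply: le_trans (csizeM _ _) _.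
have P3 : csize (cexp w - 1 - w - h ^+ 2 / (4 * s)%:C) <=
    8 * (X * eta) ^+ 2 * E^-1 + eta ^+ 2 * (X / (16 * d)).
  by apply: le_trans (csizeB _ _) _; exact: lerD.
apply: (@le_trans _ _ (2 * (G * E) * (8 * (X * eta) ^+ 2 * E^-1 + eta ^+ 2 * (X / (16 * d))))).
  by apply: ler_pM => //; exact: csize_ge0.
have -> : 2 * (G * E) * (8 * (X * eta) ^+ 2 * E^-1 + eta ^+ 2 * (X / (16 * d))) =
    eta ^+ 2 * (16 * (G * X ^+ 2) + 2 * ((G * X) * E / (16 * d))).
  by move: (E) E0 (G) (X) => E' E'0 G' X'; field; rewrite !gt_eqF.
apply: ler_wpM2l; first exact: sqr_ge0.
apply: (toM _ M1) => //; last by rewrite /M -addrA lerDl addr_ge0.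
have GXE : G * X * E / (16 * d) <= k * C0 / rho ^+ 2 / (16 * d).
  apply: ler_wpM2r; first by rewrite invr_ge0 mulr_ge0// ltW.
  by apply: le_trans GX; rewrite ler_piMr// mulr_ge0// ltW.
rewrite (_ : M1 / rho ^+ 2 = 16 * (C0 / rho ^+ 2) + 2 * (k * C0 / rho ^+ 2 / (16 * d))).
  by apply: lerD; apply: ler_wpM2l.
rewrite /M1; move: (C0) (k) => C k'; by field; rewrite !gt_eqF.
Qed.

(** A point of [Qinf] is farther from every integer horizontally than from the
    real axis. Hence all its images lie in one sector, at distances that grow
    linearly. *)
Lemma Qinf_images z : Qinf z -> exists d c : R, [/\ 0 < d, 0 < c & forall n : nat,
  (`|complex.Im (z + (2 * n)%:R)| + 4 * d <= `|complex.Re (z + (2 * n)%:R)| /\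
   c * n%:R <= `|complex.Re (z + (2 * n)%:R)|) /\
  (`|complex.Im (z - (2 * n)%:R)| + 4 * d <= `|complex.Re (z - (2 * n)%:R)| /\
   c * n%:R <= `|complex.Re (z - (2 * n)%:R)|)].
Proof.
case=> k _ [[x y] [/= yx yx1] <-].
have ek : k%:~R = (k%:~R : R)%:C :> R[i] by rewrite rmorph_int.
have en (n : nat) : (2 * n)%:R = ((2 * n)%:R : R)%:C :> R[i] by rewrite rmorph_nat.
pose m := Num.min x (1 - x); pose d := (m - `|y|) / 4.
have d0 : 0 < d by rewrite divr_gt0// subr_gt0 lt_min yx.
have y0 := normr_ge0 y.
have x0 : 0 < x by apply: le_lt_trans yx.
have x1 : 0 < 1 - x by apply: le_lt_trans yx1.
have md : `|y| + 4 * d = m by rewrite /d; field.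
have far (j : int) : m <= `|j%:~R + x|.
  rewrite /m ge_min; case: j => j.
    by rewrite ger0_norm ?lerDr ?ler0n// addr_ge0// ltW.
  apply/orP; right; rewrite NegzE mulrNz ler0_norm; last first.
    by rewrite addrC subr_le0 (le_trans (ltW (_ : x < 1)))// ?ler1z//; lra.
  rewrite opprD opprK; apply: lerD => //; by rewrite ler1z.
pose M := `|k%:~R + x|; pose c := 2 / (1 + M / (4 * d)).
have M0 : 0 <= M by exact: normr_ge0.
have c1 : 0 < 1 + M / (4 * d) by rewrite ltr_pwDl// divr_ge0// mulr_ge0// ltW.
have c0 : 0 < c by rewrite divr_gt0.
have clow (n : nat) r : m <= r -> (2 * n)%:R - M <= r -> c * n%:R <= r.
  move=> mr nr; rewrite /c mulrAC ler_pdivrMr// mulrDr mulr1.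
  have dr : 4 * d <= r by apply: le_trans mr; rewrite -md lerDr.
  have h : M <= r * (M / (4 * d)).
    have d4 : 0 < 4 * d by rewrite mulr_gt0.
    by rewrite mulrA (ler_pdivlMr _ _ d4) mulrC; apply: ler_wpM2r.
  by rewrite natrM in nr; lra.
exists d, c; split => // n; rewrite ek en /=.
rewrite subr0 addr0 add0r md; split.
  have e : k%:~R + x + (2 * n)%:R = (k + (2 * n)%:Z)%:~R + x by rewrite intrD; ring.
  split; first by rewrite e; exact: far.
  apply: clow; first by rewrite e; exact: far.
  have h := ler_normB (k%:~R + x + (2 * n)%:R) (k%:~R + x).
  by rewrite addrC addKr (ger0_norm (ler0n _ _)) -/M in h; lra.
have e : k%:~R + x - (2 * n)%:R = (k - (2 * n)%:Z)%:~R + x by rewrite intrB; ring.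
split; first by rewrite e; exact: far.
apply: clow; first by rewrite e; exact: far.
have h := ler_normB (k%:~R + x - (2 * n)%:R) (k%:~R + x).
by rewrite addrC addKr normrN (ger0_norm (ler0n _ _)) -/M in h; lra.
Qed.
End sector.

(** * The periodized complex kernel *)

Section symmetric_sums.
Context {R : realType}.
Implicit Types (z w a h : R[i]).

Definition ccvg (u : nat -> R[i]) (l : R[i]) : Prop :=
  forall b, part b (u n) @[n --> \oo] --> part b l.

Definition clim (u : nat -> R[i]) : R[i] :=
  limn (fun n => complex.Re (u n)) +i* limn (fun n => complex.Im (u n)).

Lemma ccvg_clim u : (forall b, cvgn (fun n => part b (u n))) -> ccvg u (clim u).
Proof. by move=> cu; case; [exact: cu true|exact: cu false]. Qed.

Lemma ccvgD u v l m : ccvg u l -> ccvg v m -> ccvg (fun n => u n + v n) (l + m).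
Proof.
move=> cu cv b; rewrite partD; under eq_fun do rewrite partD.
by apply: cvgD; [exact: cu|exact: cv].
Qed.

Lemma part_mul b z w : part b (z * w) =
  if b then complex.Re z * part true w + complex.Im z * part false w
  else complex.Re z * part false w - complex.Im z * part true w.
Proof. by case: b z w => [] [x y] [p q]. Qed.

Lemma ccvgM c u l : ccvg u l -> ccvg (fun n => c * u n) (c * l).
Proof.
move=> cu b; rewrite part_mul; under eq_fun do rewrite part_mul.
by case: b; [apply: cvgD|apply: cvgB]; apply: cvgM (cvg_cst _) (cu _).
Qed.

Lemma ccvg_ext u v l : (forall n, u n = v n) -> ccvg u l -> ccvg v l.
Proof. by move=> e cu; rewrite (_ : v = u)//; apply/funext => n; rewrite e. Qed.

Lemma ccvg_unique u l m : ccvg u l -> ccvg u m -> l = m.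
Proof. by move=> cu cv; apply: partP => b; exact: (cvg_unique (@Rhausdorff R) (cu b) (cv b)). Qed.

Lemma ccvg_csize_le u l B : ccvg u l -> (forall n, csize (u n) <= B) -> csize l <= B.
Proof.
move=> cu uB.
have c : csize (u n) @[n --> \oo] --> csize l.
  by apply: cvgD; apply: cvg_norm; [exact: cu false|exact: cu true].
have -> : csize l = limn (fun n => csize (u n)) by apply/esym/cvg_lim => //; exact: Rhausdorff.
by apply: limr_le; [apply/cvg_ex; exists (csize l)|exact: nearW].
Qed.

Lemma norm_csize z : `|z| <= (csize z)%:C.
Proof.
rewrite normc_def lecR /csize; set x := complex.Re z; set y := complex.Im z.
have h : 0 <= `|x| + `|y| by exact: addr_ge0.
rewrite -[leRHS](ger0_norm h) -sqrtr_sqr; apply: ler_wsqrtr.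
rewrite -[x ^+ 2]real_normK ?num_real// -[y ^+ 2]real_normK ?num_real// sqrrD.
by rewrite -addrA lerD2l lerDr mulrn_wge0// mulr_ge0.
Qed.

Lemma csize_norm z : ((csize z)%:C <= 2 * `|z|).
Proof.
rewrite normc_def; set q := Num.sqrt _.
have -> : 2 * q%:C = (2 * q)%:C :> R[i] by rewrite rmorphM rmorph_nat.
rewrite lecR /csize /q.
rewrite mulr_natl mulr2n; apply: lerD; rewrite -sqrtr_sqr; apply: ler_wsqrtr; rewrite ?lerDl ?lerDr; exact: sqr_ge0.
Qed.

Lemma ccvg_lim (u : nat -> R[i]) l : ccvg u l -> lim ((u n : R[i]^o) @[n --> \oo]) = l.
Proof.
move=> cu; apply/cvg_lim; first exact: norm_hausdorff.
apply/cvgrPdist_le => -[e e']; rewrite ltcE/= => /andP[/eqP -> e0].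
have e20 : 0 < e / 2 by rewrite divr_gt0.
have /cvgrPdist_le/(_ _ e20) h0 := cu false.
have /cvgrPdist_le/(_ _ e20) h1 := cu true.
apply: filterS2 h0 h1 => n h0 h1; apply: le_trans (norm_csize _) _.
rewrite -/(e%:C) lecR /csize -/(part false _) -/(part true _) !partB; lra.
Qed.

Definition symsum (k : R[i] -> R[i]) z N : R[i] :=
  k z + \sum_(1 <= n < N.+1) (k (z + (2 * n)%:R) + k (z - (2 * n)%:R)).

Lemma part_sum b (I : Type) (r : seq I) (P : pred I) (f : I -> R[i]) :
  part b (\sum_(i <- r | P i) f i) = \sum_(i <- r | P i) part b (f i).
Proof.
elim/big_rec2 : _ => [|i x y _ <-]; first by case: b.
by rewrite partD.
Qed.

Lemma sum_invsq N : \sum_(0 <= j < N) (j.+1%:R ^- 2) <= 2 :> R.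
Proof.
case: N => [|N]; first by rewrite big_geq.
rewrite big_nat_recl// expr1n invr1.
by have := @sum_inv_sq R 0 N; rewrite invr1; set x := bigop _ _ _; lra.
Qed.

Lemma bounded_series (t : nat -> R) B : 0 <= B -> (forall n, (0 < n)%N -> `|t n| <= B / n%:R ^+ 2) ->
  cvgn (fun N => \sum_(1 <= n < N.+1) t n) /\ forall N, `|\sum_(1 <= n < N.+1) t n| <= 2 * B.
Proof.
move=> B0 tB.
have sB N : \sum_(0 <= n < N) `|t n.+1| <= 2 * B.
  apply: (@le_trans _ _ (B * \sum_(0 <= j < N) (j.+1%:R ^- 2))).
    by rewrite mulr_sumr; apply: ler_sum => n _; exact: tB.
  by rewrite mulrC; apply: ler_wpM2r => //; exact: sum_invsq.
have e N : \sum_(1 <= n < N.+1) t n = \sum_(0 <= n < N) t n.+1 by rewrite big_add1.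
split=> [|N]; last by rewrite e; apply: le_trans (sB N); exact: ler_norm_sum.
rewrite (_ : (fun N => _) = series (fun n => t n.+1)); last by apply/funext => N; exact: e.
apply: normed_cvg.
have -> : [normed series (fun n => t n.+1)] = (fun N => \sum_(0 <= n < N) `|t n.+1|) by [].
apply: nondecreasing_is_cvgn.
  by apply/nondecreasing_seqP => n; rewrite big_nat_recr//= lerDl.
by exists (2 * B) => _ [N _ <-]; exact: sB.
Qed.

Lemma symsum_bound (k : R[i] -> R[i]) z B : 0 <= B -> csize (k z) <= B ->
  (forall n, (0 < n)%N -> csize (k (z + (2 * n)%:R)) <= B / n%:R ^+ 2) ->
  (forall n, (0 < n)%N -> csize (k (z - (2 * n)%:R)) <= B / n%:R ^+ 2) ->
  ccvg (symsum k z) (clim (symsum k z)) /\ forall N, csize (symsum k z N) <= 10 * B.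
Proof.
move=> B0 kB kp km.
(* A pair of images contributes at most 2 B / n ^ 2, and the 1 / n ^ 2 add up to at
   most 2. *)
pose t b n := part b (k (z + (2 * n)%:R) + k (z - (2 * n)%:R)).
have tB b n : (0 < n)%N -> `|t b n| <= 2 * B / n%:R ^+ 2.
  move=> n0; rewrite /t; apply: le_trans (part_csize _ _) _; apply: le_trans (csizeD _ _) _.
  by rewrite -[leRHS]mulrA mulr_natl mulr2n; exact: lerD (kp n n0) (km n n0).
have B2 : 0 <= 2 * B by exact: mulr_ge0.
have e b N : part b (symsum k z N) = part b (k z) + \sum_(1 <= n < N.+1) t b n.
  by rewrite /symsum partD part_sum.
split.
  apply: ccvg_clim => b; under eq_fun do rewrite e.
  by apply: is_cvgD; [exact: is_cvg_cst|have [] := bounded_series B2 (tB b)].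
move=> N; have h b : `|part b (symsum k z N)| <= 5 * B.
  rewrite e; apply: le_trans (ler_normD _ _) _.
  have [_ /(_ N) h1] := bounded_series B2 (tB b).
  by have := le_trans (part_csize b _) kB; lra.
by have := h false; have := h true; rewrite /csize /part; lra.
Qed.

Lemma symsumD (k k' : R[i] -> R[i]) z N : symsum k z N + symsum k' z N = symsum (fun a => k a + k' a) z N.
Proof.
rewrite /symsum addrACA -big_split/=; congr (_ + _); apply: eq_bigr => n _; exact: addrACA.
Qed.

Lemma symsumM c (k : R[i] -> R[i]) z N : c * symsum k z N = symsum (fun a => c * k a) z N.
Proof. by rewrite /symsum mulrDr mulr_sumr; congr (_ + _); apply: eq_bigr => n _; rewrite mulrDr. Qed.

Lemma symsum_shift (k : R[i] -> R[i]) z h N : symsum k (z + h) N = symsum (fun a => k (a + h)) z N.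
Proof.
by rewrite /symsum; congr (_ + _); apply: eq_bigr => n _; rewrite -!addrA ![h + _]addrC.
Qed.

(** The periodized complex heat kernel. *)
Definition ctheta z (s : R) : R[i] := clim (symsum (fun a => cK a s) z).

(** The estimates of [sector_bounds] are summable over the images, uniformly in
    time. *)
Lemma theta_taylor (S : R) z : 0 < S -> Qinf z -> exists B e : R, [/\ 0 <= B, 0 < e &
  forall s : R, 0 < s <= S ->
  [/\ ccvg (symsum (fun a => cK a s) z) (ctheta z s),
      ccvg (symsum (fun a => dK a s) z) (dtheta z s),
      csize (ctheta z s) <= B, csize (dtheta z s) <= B &
      forall h, csize h <= e -> ccvg (symsum (fun a => cK a s) (z + h)) (ctheta (z + h) s) /\
        csize (ctheta (z + h) s - ctheta z s - h * dtheta z s) <= B * csize h ^+ 2]].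
Proof.
move=> S0 /Qinf_images[d [c [d0 c0 im]]].
have [M M0 bnd] := sector_bounds S0 d0.
pose B := M * ((4 * d) ^- 2 + c ^- 2).
have d4 : 0 < 4 * d by exact: mulr_gt0.
have id0 : 0 <= (4 * d) ^- 2 by rewrite invr_ge0 sqr_ge0.
have ic0 : 0 <= c ^- 2 by rewrite invr_ge0 sqr_ge0.
have B0 : 0 <= B by rewrite mulr_ge0// addr_ge0.
have fB a n : (0 < n)%N -> c * n%:R <= `|complex.Re a| -> M / complex.Re a ^+ 2 <= B / n%:R ^+ 2.
  move=> n0 ca; have n0' : 0 < n%:R :> R by rewrite ltr0n.
  apply: (@le_trans _ _ (M * c ^- 2 / n%:R ^+ 2)); last first.
    apply: ler_wpM2r; first by rewrite invr_ge0 sqr_ge0.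
    by apply: ler_wpM2l => //; rewrite lerDr.
  rewrite -mulrA -invfM; apply: ler_wpM2l => //; rewrite -exprMn.
  rewrite -[complex.Re a ^+ 2]real_normK ?num_real//.
  have cn : 0 < c * n%:R by exact: mulr_gt0.
  rewrite lef_pV2 ?posrE ?exprn_gt0//; last exact: lt_le_trans ca.
  by apply: lerXn2r => //; rewrite nnegrE// ltW.
have zB : M / complex.Re z ^+ 2 <= B.
  have [[h _] _] := im 0%N; rewrite muln0 addr0 in h.
  apply: ler_wpM2l => //.
  have dz : 4 * d <= `|complex.Re z| by apply: le_trans h; rewrite lerDr.
  rewrite -[complex.Re z ^+ 2]real_normK ?num_real//.
  apply: (@le_trans _ _ ((4 * d) ^- 2)); last by rewrite lerDl.
  rewrite lef_pV2 ?posrE ?exprn_gt0//; last exact: lt_le_trans dz.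
  by apply: lerXn2r => //; rewrite nnegrE// ltW.
have sec0 : `|complex.Im z| + 4 * d <= `|complex.Re z|.
  by have [[h _] _] := im 0%N; rewrite muln0 addr0 in h.
exists (10 * B), (d / 4); split; [exact: mulr_ge0|exact: divr_gt0|move=> s sS].
have bK : ccvg (symsum (fun a => cK a s) z) (ctheta z s) /\
    forall N, csize (symsum (fun a => cK a s) z N) <= 10 * B.
  apply: symsum_bound => //.
  - by have [h _ _] := bnd z s sS sec0; exact: le_trans h zB.
  - move=> n n0; have [[h1 h2] _] := im n.
    by have [h _ _] := bnd _ s sS h1; exact: le_trans h (fB _ _ n0 h2).
  - move=> n n0; have [_ [h1 h2]] := im n.
    by have [h _ _] := bnd _ s sS h1; exact: le_trans h (fB _ _ n0 h2).
have bD : ccvg (symsum (fun a => dK a s) z) (clim (symsum (fun a => dK a s) z)) /\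
    forall N, csize (symsum (fun a => dK a s) z N) <= 10 * B.
  apply: symsum_bound => //.
  - by have [_ h _] := bnd z s sS sec0; exact: le_trans h zB.
  - move=> n n0; have [[h1 h2] _] := im n.
    by have [_ h _] := bnd _ s sS h1; exact: le_trans h (fB _ _ n0 h2).
  - move=> n n0; have [_ [h1 h2]] := im n.
    by have [_ h _] := bnd _ s sS h1; exact: le_trans h (fB _ _ n0 h2).
have eD : dtheta z s = clim (symsum (fun a => dK a s) z) by exact: ccvg_lim bD.1.
rewrite -eD in bD.
split; [exact: bK.1|exact: bD.1|exact: ccvg_csize_le bK.1 bK.2|exact: ccvg_csize_le bD.1 bD.2|].
move=> h hd.
(* Convergence at z + h is read off from that of the remainders and of the two
   sums at z. *)
pose r a := cK (a + h) s - cK a s - h * dK a s.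
have h2 : 0 <= csize h ^+ 2 by exact: sqr_ge0.
have bR : ccvg (symsum r z) (clim (symsum r z)) /\
    forall N, csize (symsum r z N) <= 10 * (csize h ^+ 2 * B).
  apply: symsum_bound; first exact: mulr_ge0.
  - have [_ _ /(_ h hd) h'] := bnd z s sS sec0; apply: le_trans h' _.
    by apply: ler_wpM2l.
  - move=> n n0; have [[h1 h3] _] := im n.
    have [_ _ /(_ h hd) h'] := bnd _ s sS h1; apply: le_trans h' _.
    by rewrite -[leRHS]mulrA; apply: ler_wpM2l => //; exact: fB.
  - move=> n n0; have [_ [h1 h3]] := im n.
    have [_ _ /(_ h hd) h'] := bnd _ s sS h1; apply: le_trans h' _.
    by rewrite -[leRHS]mulrA; apply: ler_wpM2l => //; exact: fB.
have cS : ccvg (symsum (fun a => cK a s) (z + h)) (clim (symsum r z) + ctheta z s + h * dtheta z s).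
  have := ccvgD (ccvgD bR.1 bK.1) (ccvgM (c := h) bD.1); apply: ccvg_ext => n.
  rewrite symsumM !symsumD symsum_shift; congr symsum; apply/funext => a.
  by rewrite /r; move: (cK (a + h) s) (cK a s) (h * dK a s) => p q t; ring.
have eS : ctheta (z + h) s = clim (symsum r z) + ctheta z s + h * dtheta z s.
  apply: (ccvg_unique _ cS); apply: ccvg_clim => b.
  by apply/cvg_ex; eexists; exact: cS b.
split; first by rewrite eS.
rewrite eS; have := ccvg_csize_le bR.1 bR.2.
rewrite (_ : _ + _ + _ - _ - _ = clim (symsum r z)); last first.
  by move: (clim _) (ctheta z s) (h * dtheta z s) => p q t; ring.
by rewrite [X in _ <= X -> _]mulrCA mulrC.
Qed.

End symmetric_sums.

(** * Complex integrals and derivatives *)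

Section complex_integral.
Context {R : realType}.
Local Notation mu := (@lebesgue_measure R).
Implicit Types (D : set R) (u v k : R -> R[i]) (z w h : R[i]).

Definition cintegrable D u : Prop := forall b, mu.-integrable D (EFin \o (fun s => part b (u s))).

Lemma integrable_csize D u : measurable D -> cintegrable D u ->
  mu.-integrable D (EFin \o (fun s => csize (u s))).
Proof.
move=> mD iu.
have i0 : mu.-integrable D (fun s => `|(part false (u s))%:E|)%E by apply: integrable_norm => //; exact: iu.
have i1 : mu.-integrable D (fun s => `|(part true (u s))%:E|)%E by apply: integrable_norm => //; exact: iu.
by have : mu.-integrable D (fun s => `|(part false (u s))%:E| + `|(part true (u s))%:E|)%E by exact: integrableD.
Qed.

Lemma cintegrableB D u v : measurable D -> cintegrable D u -> cintegrable D v ->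
  cintegrable D (fun s => u s - v s).
Proof.
move=> mD iu iv b.
have : mu.-integrable D (fun s => (part b (u s))%:E - (part b (v s))%:E)%E.
  by apply: integrableB => //; [exact: iu|exact: iv].
by apply: eq_integrable => // s _; rewrite /= partB EFinB.
Qed.

Lemma cintegralB D u v : measurable D -> cintegrable D u -> cintegrable D v ->
  cintegral D (fun s => u s - v s) = cintegral D u - cintegral D v.
Proof.
move=> mD iu iv; apply: partP => b; rewrite partB !part_cintegral -RintegralB//.
by apply: eq_Rintegral => s _; rewrite partB.
Qed.

Lemma cintegrableZ D h u : measurable D -> cintegrable D u -> cintegrable D (fun s => h * u s).
Proof.
move=> mD iu b.
have iz (c : R) b' : mu.-integrable D (fun s => c%:E * (part b' (u s))%:E)%E.
  by apply: integrableZl => //; exact: iu.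
case: b.
  have : mu.-integrable D (fun s => (complex.Re h)%:E * (part true (u s))%:E + (complex.Im h)%:E * (part false (u s))%:E)%E.
    by apply: integrableD => //; exact: iz.
  by apply: eq_integrable => // s _; rewrite -[RHS]/((part true (h * u s))%:E) part_mul EFinD !EFinM.
have : mu.-integrable D (fun s => (complex.Re h)%:E * (part false (u s))%:E - (complex.Im h)%:E * (part true (u s))%:E)%E.
  by apply: integrableB => //; exact: iz.
by apply: eq_integrable => // s _; rewrite -[RHS]/((part false (h * u s))%:E) part_mul EFinB !EFinM.
Qed.

Lemma cintegralZ D h u : measurable D -> cintegrable D u ->
  cintegral D (fun s => h * u s) = h * cintegral D u.
Proof.
move=> mD iu; apply: partP => b; rewrite part_mul !part_cintegral.
have iz (c : R) b' : mu.-integrable D (EFin \o (fun s => c * part b' (u s))).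
  have : mu.-integrable D (fun s => c%:E * (part b' (u s))%:E)%E.
    by apply: integrableZl => //; exact: iu.
  by apply: eq_integrable => // s _; rewrite /= EFinM.
case: b; rewrite -!RintegralZl//; try exact: iu.
  rewrite -RintegralD//; try exact: iz.
  by apply: eq_Rintegral => s _; rewrite part_mul.
rewrite -RintegralB//; try exact: iz.
by apply: eq_Rintegral => s _; rewrite part_mul.
Qed.

Lemma cintegrableM D k u B : measurable D -> (forall b, measurable_fun D (fun s => part b (k s))) ->
  (forall s, D s -> csize (k s) <= B) -> cintegrable D u -> cintegrable D (fun s => k s * u s).
Proof.
move=> mD mk kB iu.
have ip b b' : mu.-integrable D (EFin \o (fun s => part b (k s) * part b' (u s))).
  apply: (le_Rintegrable (m := mu) (g := fun s => B * `|part b' (u s)|)) => //.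
  - apply: measurable_funM; first exact: mk.
    by case/integrableP : (iu b') => /measurable_EFinP.
  - move=> s Ds; rewrite normrM; apply: ler_wpM2r => //.
    exact: le_trans (part_csize _ _) (kB s Ds).
  - have : mu.-integrable D (fun s => B%:E * `|(part b' (u s))%:E|)%E.
      by apply: integrableZl => //; apply: integrable_norm => //; exact: iu.
    by apply: eq_integrable => // s _; rewrite /= EFinM.
case.
  have : mu.-integrable D (fun s => (part false (k s) * part true (u s))%:E + (part true (k s) * part false (u s))%:E)%E.
    by apply: integrableD => //; exact: ip.
  by apply: eq_integrable => // s _; rewrite -[RHS]/((part true (k s * u s))%:E) part_mul EFinD.
have : mu.-integrable D (fun s => (part false (k s) * part false (u s))%:E - (part true (k s) * part true (u s))%:E)%E.
  by apply: integrableB => //; exact: ip.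
by apply: eq_integrable => // s _; rewrite -[RHS]/((part false (k s * u s))%:E) part_mul EFinB.
Qed.

Lemma csize_cintegral D v u C : measurable D -> cintegrable D v -> cintegrable D u ->
  (forall s, D s -> csize (v s) <= C * csize (u s)) ->
  csize (cintegral D v) <= 2 * C * \int[mu]_(s in D) csize (u s).
Proof.
move=> mD iv iu vu.
have h b : `|part b (cintegral D v)| <= C * \int[mu]_(s in D) csize (u s).
  rewrite part_cintegral -RintegralZl//; last exact: integrable_csize.
  apply: (le_trans (le_normr_Rintegral _ (iv b))) => //.
  apply: le_Rintegral => //.
  - by apply: integrable_norm => //; exact: iv.
  - have : mu.-integrable D (fun s => C%:E * (csize (u s))%:E)%E.
      by apply: integrableZl => //; exact: integrable_csize.
    by apply: eq_integrable => // s _; rewrite /= EFinM.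
  - by move=> s Ds; exact: le_trans (part_csize _ _) (vu s Ds).
rewrite -mulrA mulr_natl mulr2n; exact: lerD (h false) (h true).
Qed.

(** A second-order bound on the increment identifies the derivative. *)
Lemma complex_derive (F : R[i]^o -> R[i]^o) (z d : R[i]) (C e : R) : 0 <= C -> 0 < e ->
  (forall h, csize h <= e -> csize (F (z + h) - F z - h * d) <= C * csize h ^+ 2) ->
  is_derive (z : R[i]^o) 1 F d.
Proof.
move=> C0 e0 H.
suff cv : h^-1 *: ((F \o shift (z : R[i]^o)) (h *: (1 : R[i]^o)) - F z) @[h --> (0 : R[i]^o)^'] --> (d : R[i]^o).
  by split; [apply/cvg_ex; exists d|apply/cvg_lim => //; exact: norm_hausdorff].
apply/cvgrPdist_le => -[r r']; rewrite ltcE/= => /andP[/eqP -> r0].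
(* The size of h is at most twice its modulus, hence the factor 4 for its square. *)
pose dl := Num.min (e / 2) (r / (4 * C + 1)).
have C1 : 0 < 4 * C + 1 by rewrite ltr_wpDl// mulr_ge0.
have dl0 : 0 < dl by rewrite lt_min !divr_gt0.
have dlC : (0 : R[i]) < dl%:C by rewrite ltcR.
have n1 : \forall h \near (0 : R[i]^o)^', h != 0 by exact: nbhs_dnbhs_neq.
have n2 := @dnbhs0_le _ R[i]^o _ dlC.
apply: filterS2 n1 n2 => h h0 +.
have hn := csize_norm h; rewrite normc_def in hn *.
set q := Num.sqrt _ in hn *; rewrite lecR => hd.
have q0 : 0 <= q by exact: sqrtr_ge0.
have hq : csize h <= 2 * q.
  by move: hn; rewrite -lecR rmorphM/= rmorph_nat.
have /andP[he hr] : (q <= e / 2) && (q <= r / (4 * C + 1)) by rewrite -le_min.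
have he' : csize h <= e by lra.
have -> : d - h^-1 *: ((F \o shift (z : R[i]^o)) (h *: (1 : R[i]^o)) - F z) =
    - (h^-1 * (F (z + h) - F z - h * d)).
  rewrite /= /shift /GRing.scale/= mulr1 [h + z]addrC.
  by move: (F (z + h)) (F z) => a b; field.
rewrite normrN normrM normfV ler_pdivrMl ?normr_gt0//.
apply: le_trans (norm_csize _) _; rewrite [`|h|]normc_def -/q.
rewrite (_ : q%:C * _ = (q * r)%:C); last by rewrite rmorphM.
rewrite lecR; apply: le_trans (H h he') _.
have hsq : csize h ^+ 2 <= (2 * q) ^+ 2.
  by apply: lerXn2r; rewrite ?nnegrE ?csize_ge0// mulr_ge0.
apply: le_trans (ler_wpM2l C0 hsq) _.
rewrite (_ : C * (2 * q) ^+ 2 = q * (4 * C * q)); last by ring.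
apply: ler_wpM2l => //.
rewrite ler_pdivlMr// in hr.
by apply: le_trans hr; rewrite mulrC ler_wpM2l// lerDl.
Qed.

Lemma real_restriction (F : R[i]^o -> R[i]^o) (x : R) (d : R[i]) b :
  is_derive (x%:C : R[i]^o) 1 F d -> is_derive x 1 (fun t : R => part b (F t%:C)) (part b d).
Proof.
move=> [dF eF].
have cF : h^-1 *: ((F \o shift (x%:C : R[i]^o)) (h *: (1 : R[i]^o)) - F x%:C) @[h --> (0 : R[i]^o)^'] --> (d : R[i]^o).
  by rewrite -eF; exact: dF.
suff cv : h^-1 *: (((fun t : R => part b (F t%:C)) \o shift x) (h *: (1 : R)) - part b (F x%:C))
    @[h --> (0 : R)^'] --> part b d.
  by split; [apply/cvg_ex; exists (part b d)|apply/cvg_lim => //; exact: Rhausdorff].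
apply/cvgrPdist_le => r r0.
have r2 : (0 : R[i]) < (r / 2)%:C by rewrite ltcR divr_gt0.
have /cvgrPdist_le/(_ _ r2) := cF.
rewrite /dnbhs /within/= => /nbhs_ballP[[s s'] /=]; rewrite ltcE/= => /andP[/eqP -> s0] H.
apply/nbhs_ballP; exists s => // h; rewrite /ball/= sub0r normrN => hs h0.
have hC : h%:C != 0 :> R[i] by rewrite (inj_eq (@complexI R)).
have := H h%:C; rewrite /ball/= sub0r normrN.
have -> : `|h%:C| = `|h|%:C :> R[i] by rewrite normc_def/= expr0n addr0 sqrtr_sqr.
rewrite ltcR => /(_ hs hC) {}H.
have -> : part b d - h^-1 *: (part b (F ((h *: 1 + x)%:C)) - part b (F x%:C)) =
    part b (d - h%:C^-1 *: (F (h%:C *: 1 + x%:C) - F x%:C)).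
  rewrite partB /GRing.scale/= !mulr1 -fmorphV mulrC [in RHS]mulrC partZ partB.
  by rewrite rmorphD.
have := csize_norm (d - h%:C^-1 *: (F (h%:C *: 1 + x%:C) - F x%:C)).
move=> cn; have : (csize (d - h%:C^-1 *: (F (h%:C *: 1 + x%:C) - F x%:C)))%:C <= 2 * (r / 2)%:C :> R[i].
  by apply: le_trans cn _; apply: ler_wpM2l.
rewrite (_ : 2 * (r / 2)%:C = r%:C :> R[i]); last first.
  by rewrite -[X in X * _](rmorph_nat (real_complex R)) -rmorphM/= mulrC divfK.
by rewrite lecR; apply: le_trans; exact: part_csize.
Qed.

End complex_integral.

(** * The holomorphic extension of the reachable states *)

Section primitive.
Context {R : realType}.
Local Notation mu := (@lebesgue_measure R).
Implicit Types (z w a h : R[i]).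

Lemma part_realM b (r : R) z : part b (r%:C * z) = r * part b z.
Proof. by rewrite mulrC partZ mulrC. Qed.

Lemma measurable_cK a b : measurable_fun (setT : set R) (fun s => part b (cK a s)).
Proof.
have mi (c : R) : measurable_fun (setT : set R) (fun s : R => c * (4 * s)^-1).
  apply: measurable_funM => //; apply: (measurableT_comp (f := fun x : R => x^-1) measurable_inv).
  exact: measurable_funM.
have m0 : measurable_fun (setT : set R) (fun s : R => (2 * Num.sqrt pi * Num.sqrt s)^-1).
  apply: (measurableT_comp (f := fun x : R => x^-1) measurable_inv); apply: measurable_funM => //.
  by apply: continuous_measurable_fun; exact: sqrt_continuous.
rewrite (_ : (fun s => _) = (fun s => (2 * Num.sqrt pi * Num.sqrt s)^-1 *
   (expR (- complex.Re (a ^+ 2) * (4 * s)^-1) *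
    (if b then sin else cos) (- complex.Im (a ^+ 2) * (4 * s)^-1)))); last first.
  apply/funext => s; rewrite /cK part_realM; congr (_ * _).
  rewrite -fmorphV; case: (a ^+ 2) => [x y].
  by case: b; rewrite /part /cexp/= !mulr0 ?subr0 ?addr0 ?add0r !mulNr.
apply: measurable_funM => //; apply: measurable_funM.
  exact: (measurableT_comp (f := expR)).
case: b.
  by apply: (measurableT_comp (f := sin)) => //; apply: continuous_measurable_fun; exact: continuous_sin.
by apply: (measurableT_comp (f := cos)) => //; apply: continuous_measurable_fun; exact: continuous_cos.
Qed.

Section fixed.
Variables (S : R) (u : R -> R[i]).
Hypotheses (S0 : 0 < S) (uL : L2 `]0, S[ u).
Let D : set R := `]0, S[%classic.
Let mD : measurable D. Proof. exact: measurable_itv. Qed.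

Let iu : cintegrable D u.
Proof. by move=> b; apply: L2r_integrable => //; [exact: fin_itv|move/(L2_part _ mD) : uL; apply]. Qed.

Let SB s : D s -> 0 < S - s <= S.
Proof. by rewrite /D/= in_itv/= => /andP[s0 sS]; rewrite subr_gt0 sS gerBl ltW. Qed.

Let mKS a b : measurable_fun D (fun s => part b (cK a (S - s))).
Proof.
apply: measurable_funTS; apply: (measurableT_comp (measurable_cK a b)).
exact: measurable_funB.
Qed.

Let mDS a b : measurable_fun D (fun s => part b (dK a (S - s))).
Proof.
have h : measurable_fun D (fun s : R => part b (- a * cK a (S - s)) * (2 * (S - s))^-1).
  apply: measurable_funM; last first.
    apply: measurable_funTS; apply: (measurableT_comp (f := fun x : R => x^-1) measurable_inv).
    by apply: measurable_funM => //; exact: measurable_funB.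
  under eq_fun do rewrite part_mul.
  by case: b; [apply: measurable_funD|apply: measurable_funB]; apply: measurable_funM.
apply: eq_measurable_fun h => s; rewrite inE => /SB/andP[s0 _]; rewrite dKE// -partZ fmorphV.
by congr (part b _); rewrite !mulNr mulrAC.
Qed.

(** Each partial sum is measurable in time. *)
Lemma measurable_climit (k : R[i] -> R -> R[i]) z (l : R -> R[i]) :
  (forall a b, measurable_fun D (fun s => part b (k a (S - s)))) ->
  (forall s, D s -> ccvg (symsum (fun a => k a (S - s)) z) (l s)) ->
  forall b, measurable_fun D (fun s => part b (l s)).
Proof.
move=> mk ck b.
apply: (measurable_fun_cvg (h := fun (N : nat) (s : R) => part b (symsum (fun a => k a (S - s)) z N))) => // [N|s Ds].
  rewrite /symsum; under eq_fun do rewrite partD part_sum.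
  apply: measurable_funD; first exact: mk.
  apply: measurable_sum => n; under eq_fun do rewrite partD.
  by apply: measurable_funD; exact: mk.
exact: ck.
Qed.

Definition cpot z : R[i] := cintegral D (fun s => ctheta z (S - s) * u s).
Definition dcpot z : R[i] := cintegral D (fun s => dtheta z (S - s) * u s).

Lemma cpot_integrable z : Qinf z -> cintegrable D (fun s => ctheta z (S - s) * u s).
Proof.
move=> /(theta_taylor S0)[B [e [B0 e0 H]]].
apply: (cintegrableM (B := B)) => // [b|s /SB/H[_ _ h _ _]//].
by apply: (measurable_climit (k := cK) (z := z)) => // s /SB/H[].
Qed.

(** The remainder of the kernel is bounded uniformly in time, so that it can be
    integrated against the flux. *)
Lemma cpot_taylor z : Qinf z -> exists C e : R, [/\ 0 <= C, 0 < e &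
  forall h, csize h <= e -> csize (cpot (z + h) - cpot z - h * dcpot z) <= C * csize h ^+ 2].
Proof.
move=> /[dup] qz /(theta_taylor S0)[B [e [B0 e0 H]]].
pose U := \int[mu]_(s in D) csize (u s).
have U0 : 0 <= U by apply: Rintegral_ge0 => s _; exact: csize_ge0.
exists (2 * B * U), e; split=> [||h he]; [by rewrite !mulr_ge0|by []|].
have i0 := cpot_integrable qz.
have id : cintegrable D (fun s => dtheta z (S - s) * u s).
  apply: (cintegrableM (B := B)) => // [b|s /SB/H[_ _ _ h' _]//].
  by apply: (measurable_climit (k := dK) (z := z)) => // s /SB/H[].
have ih : cintegrable D (fun s => ctheta (z + h) (S - s) * u s).
  apply: (cintegrableM (B := B * csize h ^+ 2 + B + csize h * B)) => // [b|s Ds].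
    apply: (measurable_climit (k := cK) (z := z + h)) => // s /SB/H[_ _ _ _ h'].
    by have [] := h' h he.
  have [_ _ h1 h2 /(_ h he)[_ h3]] := H _ (SB Ds).
  rewrite (_ : ctheta (z + h) (S - s) = (ctheta (z + h) (S - s) - ctheta z (S - s) - h * dtheta z (S - s))
    + ctheta z (S - s) + h * dtheta z (S - s)); last first.
    by move: (ctheta _ _) (ctheta _ _) (h * _) => p q r; ring.
  apply: le_trans (csizeD _ _) _; apply: lerD; last first.
    by apply: le_trans (csizeM _ _) _; apply: ler_wpM2l => //; exact: csize_ge0.
  by apply: le_trans (csizeD _ _) _; exact: lerD.
have idh := cintegrableZ h mD id.
have i1 := cintegrableB mD ih i0.
rewrite /cpot /dcpot -cintegralZ// -cintegralB// -cintegralB//.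
rewrite (_ : 2 * B * U * csize h ^+ 2 = 2 * (B * csize h ^+ 2) * U); last by move: (U) => v; ring.
apply: csize_cintegral => //; first exact: cintegrableB.
move=> s Ds; have [_ _ _ _ /(_ h he)[_ h3]] := H _ (SB Ds).
rewrite mulrA -!mulrBl; apply: le_trans (csizeM _ _) _.
by apply: ler_wpM2r; [exact: csize_ge0|exact: h3].
Qed.

(** On the real axis the complex kernel reduces to the real one. *)
Lemma cpot_real (x : R) (y : R[i]) b : `|x| <= 1 -> Qinf y ->
  (forall N s, symsum (fun a => cK a s) y N = (imgs N x s)%:C) ->
  2 * part b (cpot y) = \int[mu]_(s in D) (2 * theta x (S - s) * part b (u s)).
Proof.
move=> x1 qy e; have iy := cpot_integrable qy.
have [B [e' [_ _ H]]] := theta_taylor S0 qy.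
have ct s : D s -> ctheta y (S - s) = (theta x (S - s))%:C.
  move=> /SB/H[c _ _ _ _]; apply: (ccvg_unique c) => -[].
    by under eq_fun do rewrite e/=; exact: cvg_cst.
  by under eq_fun do rewrite e/=; exact: imgs_cvgT.
rewrite /cpot part_cintegral -RintegralZl//.
apply: eq_Rintegral => s; rewrite inE => Ds.
by rewrite ct// part_realM mulrA.
Qed.

End fixed.

Lemma Qinf_real (x : R) : x \in `]0, 1[ -> @Qinf R x%:C.
Proof.
rewrite in_itv/= => /andP[x0 x1]; exists 0 => //; exists x%:C; last by rewrite add0r.
by split; rewrite /= normr0 ?subr_gt0.
Qed.

Lemma Qinf_sub1 z : Qinf z -> Qinf (z - 1).
Proof.
case=> k _ [w qw <-]; exists (k - 1) => //; exists w => //.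
by rewrite intrB addrAC.
Qed.

Lemma cK_real (x s : R) : cK x%:C s = (gk x s)%:C.
Proof.
rewrite /cK /gk -rmorphXn -fmorphV -rmorphM -rmorphN/=.
rewrite /cexp/= cos0 sin0 mulr1 mulr0.
by rewrite -[_ +i* 0]/((_)%:C) -rmorphM.
Qed.

Lemma symsum_real (x s : R) N : symsum (fun a => cK a s) x%:C N = (imgs N x s)%:C.
Proof.
rewrite /symsum /imgs rmorphD rmorph_sum/= cK_real; congr (_ + _).
apply: eq_bigr => n _; rewrite -(rmorph_nat (real_complex R)).
by rewrite -rmorphD -rmorphB/= !cK_real -rmorphD.
Qed.

(** The holomorphic extension of the final state of the Neumann problem. *)
Definition extension (S : R) (ul ur : R -> R[i]) z : R[i] :=
  - 2 * cpot S ul z + 2 * cpot S ur (z - 1).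

Lemma extension_derive (S : R) (ul ur : R -> R[i]) z : 0 < S ->
  L2 `]0, S[ ul -> L2 `]0, S[ ur -> Qinf z ->
  is_derive (z : R[i]^o) 1 (extension S ul ur : R[i]^o -> R[i]^o) (dirichlet ul ur z S).
Proof.
move=> S0 lL rL qz.
have [Cl [el [Cl0 el0 Hl]]] := cpot_taylor S0 lL qz.
have [Cr [er [Cr0 er0 Hr]]] := cpot_taylor S0 rL (Qinf_sub1 qz).
apply: (complex_derive (C := 2 * Cl + 2 * Cr) (e := Num.min el er)).
- by rewrite addr_ge0// mulr_ge0.
- by rewrite lt_min el0.
move=> h; rewrite le_min => /andP[/Hl hl /Hr hr].
rewrite (_ : dirichlet ul ur z S = - 2 * dcpot S ul z + 2 * dcpot S ur (z - 1))//.
rewrite /extension (_ : z + h - 1 = z - 1 + h); last by rewrite addrAC.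
rewrite (_ : _ - _ - _ = 2%:C * (cpot S ur (z - 1 + h) - cpot S ur (z - 1) - h * dcpot S ur (z - 1))
  - 2%:C * (cpot S ul (z + h) - cpot S ul z - h * dcpot S ul z)); last first.
  rewrite rmorph_nat.
  move: (cpot S ul (z + h)) (cpot S ul z) (dcpot S ul z) => a b c.
  by move: (cpot S ur (z - 1 + h)) (cpot S ur (z - 1)) (dcpot S ur (z - 1)) => d e f; ring.
apply: le_trans (csizeB _ _) _; rewrite !csizeZ (ger0_norm (x := 2))//; lra.
Qed.

(** The kernel is even in x, so that translating by 1 amounts to reflecting the
    interval. *)
Lemma extension_real (S : R) (ul ur : R -> R[i]) (x : R) : 0 < S ->
  L2 `]0, S[ ul -> L2 `]0, S[ ur -> x \in `]0, 1[ ->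
  extension S ul ur x%:C =
  complex_state (fun s => part false (ul s)) (fun s => part true (ul s))
     (fun s => part false (ur s)) (fun s => part true (ur s)) S x.
Proof.
move=> S0 lL rL x01; have qx := Qinf_real x01.
have x1 := itv01_norm x01.
have x1' : `|1 - x| <= 1.
  by move: x01; rewrite in_itv/= => /andP[x0 x1'']; rewrite ger0_norm; lra.
have e (N : nat) (s : R) : symsum (fun a => cK a s) (x%:C - 1) N = (imgs N (1 - x) s)%:C.
  by rewrite -imgsN opprB -symsum_real rmorphB rmorph1.
apply: partP => b; rewrite /extension partD mulNr.
have pN z : part b (- z) = - part b z by rewrite -[- z]add0r partB; case: b; rewrite /= sub0r.
rewrite pN -(rmorph_nat (real_complex R)) !part_realM.
have hl := cpot_real S0 lL b x1 qx (fun N s => symsum_real x s N).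
have hr := cpot_real S0 rL b x1' (Qinf_sub1 qx) e.
by rewrite hl hr addrC; case: b {hl hr pN}.
Qed.

Lemma constant01 (g : R -> R) : (forall x : R, x \in `]0, 1[ -> is_derive x 1 g 0) ->
  forall x y : R, x \in `]0, 1[ -> y \in `]0, 1[ -> g x = g y.
Proof.
move=> dg.
suff h (x y : R) : x <= y -> x \in `]0, 1[ -> y \in `]0, 1[ -> g x = g y.
  by move=> x y x01 y01; case: (leP x y) => [/h|/ltW/h] -> .
move=> xy; rewrite !in_itv/= => /andP[x0 _] /andP[_ y1].
have sub (t : R) : t \in `[x, y] -> t \in `]0, 1[.
  by rewrite !in_itv/= => /andP[xt ty]; rewrite (lt_le_trans x0 xt) (le_lt_trans ty).
have d (t : R) : t \in `]x, y[ -> is_derive t 1 g ((fun=> 0) t).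
  by move=> /(@subset_itv_oo_cc _ _ _ _ _)/sub/dg.
have c : {within `[x, y], continuous g}.
  apply: continuous_in_subspaceT => t; rewrite inE/= => /sub/dg[dt _].
  by apply: differentiable_continuous; apply/derivable1_diffP.
have [t _ /eqP] := MVT_segment xy d c.
by rewrite mul0r subr_eq0 => /eqP.
Qed.

End primitive.

Theorem corollary5 (R : realType) :
  (forall T1 T2 : R, 0 < T1 -> 0 < T2 -> reachN T1 = reachN T2) /\
  (forall T S : R, 0 < T -> 0 < S ->
     reachN T =
     [set g : R -> R[i] | exists f : R[i] -> R[i]^o,
        [/\ hol Qinf f, reachD S f^`()%classic &
            ae_eq_on `]0, 1[ g (fun x => f x%:C)]]).
Proof.
split=> [T1 T2 T10 T20|T S T0 S0].
  by apply/seteqP; split; exact: reachN_time.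
have mS : measurable (`]0, S[%classic : set R) by exact: measurable_itv.
apply/seteqP; split=> g.
  move=> /(reachN_time S0 T0)/(reachNE _ S0)[al [bl [ar [br [alL blL arL brL gE]]]]].
  pose ul s := al s +i* bl s; pose ur s := ar s +i* br s.
  have lL : L2 `]0, S[ ul by apply/L2_part => // -[].
  have rL : L2 `]0, S[ ur by apply/L2_part => // -[].
  exists (extension S ul ur); split.
  - by move=> z qz; case: (extension_derive S0 lL rL qz).
  - exists ul, ur; split => // z qz; rewrite derive1E.
    by case: (extension_derive S0 lL rL qz).
  - apply: (@filterS _ _ (ae_filter_ringOfSetsType _) _ _ _ gE) => x e x01.
    by rewrite e// (extension_real S0 lL rL).
move=> [f [hf [ul [ur [lL rL fE]]] gE]].
have /(L2_part _ mS) lL' := lL; have /(L2_part _ mS) rL' := rL.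
pose G b (t : R) := part b (f t%:C) - part b (extension S ul ur t%:C).
have dG b (x : R) : x \in `]0, 1[ -> is_derive x 1 (G b) 0.
  move=> x01; have qx := Qinf_real x01.
  have df : is_derive (x%:C : R[i]^o) 1 (f : R[i]^o -> R[i]^o) (dirichlet ul ur x%:C S).
    by apply: DeriveDef; [exact: hf|rewrite -derive1E fE].
  have h1 := real_restriction b df.
  have h2 := real_restriction b (extension_derive S0 lL rL qx).
  by apply: (is_derive_eq (is_deriveB h1 h2)); rewrite subrr.
have h01 : (2^-1 : R) \in `]0, 1[ by rewrite in_itv/=; apply/andP; split; lra.
apply: (reachN_shift (c := G false 2^-1) (d := G true 2^-1) T0 S0
  (lL' false) (lL' true) (rL' false) (rL' true)).
apply: (@filterS _ _ (ae_filter_ringOfSetsType _) _ _ _ gE) => x e x01.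
rewrite e// -(extension_real S0 lL rL x01); apply: partP => b; rewrite partD.
have -> : part b (G false 2^-1 +i* G true 2^-1) = G b x.
  by case: b => /=; exact: constant01 (dG _) _ _ h01 x01.
by rewrite /G addrCA subrr addr0.
Qed.
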